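(* Let $G$ be an irreducible map on a surface $S$. Then every edge of $G$ is essentially noncontractible.
   Context: A surface is a compact two-dimensional manifold (without boundary). All graphs are simple. A map on $S$ is a connected simple graph $G$ embedded in $S$ such that every face (connected component of $S\setminus G$) is homeomorphic to an open disk. A face whose boundary walk traverses edges $v_1v_2,\dots,v_mv_1$ is denoted $v_1\cdots v_m$ (vertices need not be distinct, subscripts mod $m$) and has size $m$; a face of size $m\ge4$ is large; a face of size $3$ is a $3$-face. A large face $v_1\cdots v_m$ is irreducible if $v_i$ and $v_{i+2}$ are adjacent for all $i$. A map is face irreducible if every face is an irreducible face or a $3$-face. If $v_1v_2,v_2v_3,v_3v_1$ are edges, their union is the $3$-cycle $v_1v_2v_3$. An edge is contractible if it lies on exactly two $3$-cycles and both of them are (boundaries of) $3$-faces. An irreducible map is a face irreducible map in which no edge is contractible. A $3$-cycle is essential if it does not bound a disk in $S$; an edge is essentially noncontractible if at least one $3$-cycle containing it is essential.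
   Formalization: The triangle K_3 embedded in the sphere is excluded: it is an irreducible map under the definitions given (each edge lies on only one 3-cycle, so none is contractible), yet its only 3-cycle bounds a disk, so the claim fails for it. *)

(* Defs.v *)
From mathcomp Require Import all_boot all_order all_algebra.
From mathcomp Require Import all_classical all_reals all_analysis.

Set Implicit Arguments.
Unset Strict Implicit.
Unset Printing Implicit Defensive.

Import Order.TTheory GRing.Theory Num.Theory.
Import numFieldNormedType.Exports.

Local Open Scope classical_set_scope.
Local Open Scope ring_scope.

Definition homeomorphic (T U : topologicalType) (A : set T) (B : set U) : Prop :=
  exists (f : T -> U) (g : U -> T),
    [/\ {within A, continuous f}, {within B, continuous g},
        (forall x, A x -> B (f x) /\ g (f x) = x) &
        (forall y, B y -> A (g y) /\ f (g y) = y)].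

Section Models.
Variable R : realType.

Definition open_disk : set (R * R) := [set p | p.1 ^+ 2 + p.2 ^+ 2 < 1].
Definition closed_disk : set (R * R) := [set p | p.1 ^+ 2 + p.2 ^+ 2 <= 1].
Definition unit_circle : set (R * R) := [set p | p.1 ^+ 2 + p.2 ^+ 2 = 1].
Definition unit_sphere : set (R * R * R) :=
  [set p | p.1.1 ^+ 2 + p.1.2 ^+ 2 + p.2 ^+ 2 = 1].

Definition circle_point (s : R) : R * R := (cos (2 * pi * s), sin (2 * pi * s)).

(* Second countability is automatic for a compact locally Euclidean space, and
   connectedness of S follows from the existence of a map on S. *)
Definition surface (S : topologicalType) : Prop :=
  [/\ compact [set: S], hausdorff_space S &
      forall x : S, exists U : set S,
        [/\ open U, U x & homeomorphic U open_disk]].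

(* Needed to exclude the triangle K_3 on the sphere: each of its edges lies on a
   single 3-cycle, so none is contractible and the map is irreducible, yet that
   3-cycle bounds a disk. *)
Definition sphere (S : topologicalType) : Prop :=
  homeomorphic [set: S] unit_sphere.

(* A finite simple graph embedded in S.  For adjacent u and v, [earc u v]
   restricted to [0, 1] parametrizes the edge uv from u to v; its values are
   irrelevant when u and v are not adjacent or outside [0, 1]. *)
Record embedded_graph (S : topologicalType) := EmbeddedGraph {
  vertex :> finType;
  adj : rel vertex;
  adj_sym : symmetric adj;
  adj_irr : irreflexive adj;
  vpoint : vertex -> S;
  vpoint_inj : injective vpoint;
  earc : vertex -> vertex -> R -> S;
  earc_continuous : forall u v, adj u v -> {within `[0, 1], continuous (earc u v)};
  earc_inj : forall u v, adj u v -> {in `[0, 1] &, injective (earc u v)};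
  earc0 : forall u v, adj u v -> earc u v 0 = vpoint u;
  earc1 : forall u v, adj u v -> earc u v 1 = vpoint v;
  earc_rev : forall u v (t : R), adj u v -> t \in `[0, 1] -> earc v u t = earc u v (1 - t);
  earc_vertex : forall u v w (t : R), adj u v -> t \in `]0, 1[ -> earc u v t <> vpoint w;
  earc_disjoint : forall u v u' v' (s t : R), adj u v -> adj u' v' ->
    s \in `]0, 1[ -> t \in `]0, 1[ -> earc u v s = earc u' v' t ->
    (u' = u /\ v' = v) \/ (u' = v /\ v' = u)
}.

Section Maps.
Variables (S : topologicalType) (G : embedded_graph S).

Definition edge (u v : G) : set S := earc u v @` `[0, 1].

Definition graph_set : set S :=
  range (@vpoint S G) `|` [set x | exists u v : G, adj u v /\ edge u v x].

Definition face (F : set S) : Prop :=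
  exists2 x, ~ graph_set x & F = connected_component (~` graph_set) x.

Definition is_map : Prop :=
  [/\ (0 < #|G|)%N, forall u v : G, connect (@adj S G) u v &
      forall F, face F -> homeomorphic F open_disk].

(* A closed walk of length m is a function on 'I_m; [ordS] is the successor
   modulo m. *)
Definition closed_walk m (w : 'I_m -> G) : Prop :=
  forall i, adj (w i) (w (ordS i)).

Definition walk_set m (w : 'I_m -> G) : set S :=
  \bigcup_(i : 'I_m) edge (w i) (w (ordS i)).

(* F is the face w_0 ... w_(m-1): F is the image of the interior of an m-gon,
   modelled by the disk with its boundary circle cut into m equal arcs, under a
   map that extends continuously to the boundary and runs there through the
   edges w_0 w_1, ..., w_(m-1) w_0 in this order.  (The restriction to the open
   disk is a homeomorphism onto F, by compactness of the closed disk.) *)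
Definition boundary_walk (F : set S) m (w : 'I_m -> G) : Prop :=
  closed_walk w /\
  exists phi : R * R -> S,
    [/\ {within closed_disk, continuous phi},
        {in open_disk &, injective phi},
        phi @` open_disk = F &
        forall (i : 'I_m) (t : R), t \in `[0, 1] ->
          phi (circle_point ((i%:R + t) / m%:R)) = earc (w i) (w (ordS i)) t].

Definition three_face (F : set S) : Prop :=
  face F /\ exists w : 'I_3 -> G, boundary_walk F w.

Definition irreducible_face (F : set S) : Prop :=
  face F /\ exists m (w : 'I_m -> G),
    [/\ (4 <= m)%N, boundary_walk F w &
        forall i, adj (w i) (w (ordS (ordS i)))].

Definition face_irreducible : Prop :=
  forall F, face F -> irreducible_face F \/ three_face F.

Definition three_cycle (C : set S) : Prop :=
  exists2 w : 'I_3 -> G, closed_walk w & C = walk_set w.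

Definition bounds_three_face (C : set S) : Prop :=
  exists (F : set S) (w : 'I_3 -> G),
    [/\ face F, boundary_walk F w & C = walk_set w].

Definition contractible (u v : G) : Prop :=
  exists C1 C2 : set S,
    [/\ C1 <> C2,
        [set C | three_cycle C /\ edge u v `<=` C] = [set C1; C2],
        bounds_three_face C1 & bounds_three_face C2].

Definition irreducible_map : Prop :=
  [/\ is_map, face_irreducible & forall u v : G, adj u v -> ~ contractible u v].

Definition bounds_disk (C : set S) : Prop :=
  exists phi : R * R -> S,
    [/\ {within closed_disk, continuous phi},
        {in closed_disk &, injective phi} &
        phi @` unit_circle = C].

Definition essential (C : set S) : Prop := ~ bounds_disk C.

Definition essentially_noncontractible (u v : G) : Prop :=
  exists C, [/\ three_cycle C, edge u v `<=` C & essential C].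

End Maps.
End Models.

(* Main.v *)
Require Import Defs.
From mathcomp Require Import all_boot.

(** Suppose that every 3-cycle through the edge uv bounds a disk. In such a disk,
    choose a 3-cycle that surrounds some vertex x and as few faces as possible. The
    3-cycles through x then surround no vertex at all, so each of them bounds a
    3-face, and this makes every edge at x contractible. Hence the disk contains no
    vertex and is itself a 3-face. So all 3-cycles through uv are facial, and then
    either uv is contractible or the map is the triangle on the sphere.

    The edges are arbitrary continuous arcs, and all the plane topology rests on a
    single question: does z - q have a continuous square root on a given set K of
    complex numbers? If K is a closed curve, this is the parity of its winding number
    around q. Borsuk's theorem on odd maps shows that the boundary of an embedded disk
    winds an odd number of times around the points of its interior. This gives
    invariance of domain, hence the fact that every edge is on exactly two sides of
    faces, and, by moving one arc of a theta curve, the fact that the parity changes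
    when an edge of a 3-cycle is crossed. *)

(** The boundary walk of a large face may repeat vertices and edges, so closed faces need not be
    embedded disks. Everything local is therefore stated for sides, pairs of a face and an index,
    and both sides of an edge may lie on one face.

    A 3-cycle in the given disk surrounds the faces and vertices around which its parity is odd;
    [region] records what follows from this, and the counting is then combinatorial. It rests on two
    facts. The boundary mod 2 of a set of faces has even degree at each vertex, so if it lies on a
    3-cycle it is all of it or empty. A nonempty set of faces in a disk has nonempty boundary, since
    otherwise a ray avoiding the vertices could never leave it. Hence a 3-cycle through a surrounded
    vertex surrounds strictly fewer faces.

    If all 3-cycles through an edge are facial, a large face at it is excluded because consecutive
    triples of its walk are 3-cycles too, which leads to an edge with three sides. Apart from
    contractible edges, only two triangular faces with the same vertices remain. Such a pair has
    empty boundary, which is impossible inside a disk; in the surface it forces the triangle on the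
    sphere. *)

Set Implicit Arguments.
Unset Strict Implicit.
Unset Printing Implicit Defensive.

(** * Faces and triangles of a graph on a closed surface *)

Section Comb.
Variables (V FT : finType) (adj : rel V).
Hypothesis adjC : symmetric adj.
Hypothesis adjI : irreflexive adj.
Variables (m : FT -> nat) (w : FT -> nat -> V).
Hypothesis m3 : forall F, 2 < m F.
Hypothesis wper : forall F j, w F (j + m F) = w F j.
Hypothesis wadj1 : forall F j, adj (w F j) (w F j.+1).
Hypothesis wadj2 : forall F j, adj (w F j) (w F j.+2).

Definition side F j u v :=
  (w F j == u) && (w F j.+1 == v) || (w F j == v) && (w F j.+1 == u).

(** The complete list of the sides of an edge, without repetition. [F1 = F2] is allowed, since a
    boundary walk may run along an edge twice. *)
Definition sides u v F1 j1 F2 j2 :=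
  [/\ j1 < m F1 /\ j2 < m F2, side F1 j1 u v, side F2 j2 u v, (F1, j1) != (F2, j2) &
      forall F j, j < m F -> side F j u v -> (F, j) = (F1, j1) \/ (F, j) = (F2, j2)].

Definition triangle (C : {set V}) :=
  exists a b c, [/\ adj a b, adj b c, adj a c & C = [set a; b; c]].

(** Meant for faces of size 3, where any three consecutive corners give the same set ([vset3]). *)
Definition vset F : {set V} := [set w F 0; w F 1; w F 2].

Definition facial (C : {set V}) := exists2 F, m F = 3 & C = vset F.

Hypothesis two_sided : forall u v, adj u v -> exists F1 j1 F2 j2, sides u v F1 j1 F2 j2.

Lemma adj_neq u v : adj u v -> u != v.
Proof. by apply: contraTneq => ->; rewrite adjI. Qed.

Lemma adjS u v : adj u v -> adj v u.
Proof. by rewrite adjC. Qed.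

Lemma w_modn F j : w F (j %% m F) = w F j.
Proof.
rewrite {2}(divn_eq j (m F)); elim: (j %/ m F) => [|k ih]; first by rewrite mul0n.
by rewrite mulSn -addnA addnC wper.
Qed.

Lemma w_eqmod F j k : j = k %[mod m F] -> w F j = w F k.
Proof. by move=> e; rewrite -w_modn e w_modn. Qed.

Lemma w_modnS F j : w F (j %% m F).+1 = w F j.+1.
Proof. by apply: w_eqmod; rewrite -addn1 modnDml addn1. Qed.

Lemma side_modn F j u v : side F (j %% m F) u v = side F j u v.
Proof. by rewrite /side w_modn w_modnS. Qed.

Lemma sideC F j u v : side F j u v = side F j v u.
Proof. by rewrite /side orbC. Qed.

Lemma side_adj F j u v : side F j u v -> adj u v.
Proof.
by case/orP=> /andP[/eqP<- /eqP<-]; [|apply: adjS]; exact: wadj1.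
Qed.

Lemma sides_mem u v F1 j1 F2 j2 F j : sides u v F1 j1 F2 j2 -> side F j u v ->
  (F, j %% m F) = (F1, j1) \/ (F, j %% m F) = (F2, j2).
Proof.
case=> _ _ _ _ h s; apply: h; last by rewrite side_modn.
by rewrite ltn_mod (leq_trans _ (m3 F)).
Qed.

Lemma sides_face u v F1 j1 F2 j2 F j : sides u v F1 j1 F2 j2 -> side F j u v ->
  F = F1 \/ F = F2.
Proof. by move=> h /(sides_mem h)[[-> _]|[-> _]]; [left|right]. Qed.

Lemma sidesC u v F1 j1 F2 j2 : sides u v F1 j1 F2 j2 -> sides u v F2 j2 F1 j1.
Proof.
case=> [[l1 l2]] s1 s2 n h; split; rewrite 1?eq_sym// => F j jm /h h'.
by case: (h' jm); [right|left].
Qed.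

Lemma in_set3 (a b c t : V) : t \in [set a; b; c] -> [\/ t = a, t = b | t = c].
Proof.
rewrite !inE -orbA => /or3P[] /eqP; [exact: Or31|exact: Or32|exact: Or33].
Qed.

Lemma walk_triangle F j : triangle [set w F j; w F j.+1; w F j.+2].
Proof. by exists (w F j), (w F j.+1), (w F j.+2); split. Qed.

Lemma vset3 F j : m F = 3 -> vset F = [set w F j; w F j.+1; w F j.+2].
Proof.
move=> mF; have h k : w F (j + k) = w F ((j %% 3 + k) %% 3).
  by apply: w_eqmod; rewrite mF modn_mod modnDml.
have := h 0; have := h 1; have := h 2; rewrite addn0 addn1 addn2.
have : j %% 3 < 3 by rewrite ltn_mod.
case: (j %% 3) => [|[|[|//]]] _ /= -> -> ->; rewrite /vset //; apply/setP => z;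
  by rewrite !inE; do 3?[case: (z == _)].
Qed.

Lemma side_vset F j u v : m F = 3 -> side F j u v -> (u \in vset F) && (v \in vset F).
Proof.
move=> /(vset3 j) ->; rewrite !inE.
by case/orP=> /andP[/eqP-> /eqP->]; rewrite !eqxx ?orbT.
Qed.

Lemma vset_side F u v : m F = 3 -> u != v -> u \in vset F -> v \in vset F ->
  exists j, side F j u v.
Proof.
move=> mF uv; rewrite !inE -!orbA.
have w3 : w F 3 = w F 0 by rewrite -(wper F 0) mF.
move=> /or3P[] /eqP e1 /or3P[] /eqP e2; rewrite ?e1 ?e2 ?eqxx// in uv *;
  [exists 0|exists 2|exists 0|exists 1|exists 2|exists 1]; rewrite /side ?w3 !eqxx ?orbT//.
Qed.

Lemma side3_inj F j k u v : m F = 3 -> j < 3 -> k < 3 ->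
  side F j u v -> side F k u v -> j = k.
Proof.
move=> mF.
have w3 : w F 3 = w F 0 by rewrite -(wper F 0) mF.
have n01 := adj_neq (wadj1 F 0); have n12 := adj_neq (wadj1 F 1).
have n02 := adj_neq (wadj2 F 0).
case: j => [|[|[|//]]] _; case: k => [|[|[|//]]] _ //; rewrite /side ?w3;
  move=> /orP[] /andP[/eqP <- /eqP <-] /orP[] /andP[/eqP e1 /eqP e2];
  move: n01 n12 n02; rewrite ?e1 ?e2 ?eqxx//; rewrite -?e1 -?e2 ?eqxx//.
Qed.

Lemma triangle_third F j x y : m F = 3 -> side F j x y -> vset F = [set x; y; w F j.+2].
Proof.
move=> mF; rewrite (vset3 j mF) => /orP[] /andP[/eqP-> /eqP->] //.
by rewrite [in LHS]setUC [in RHS]setUC; congr (_ :|: _); rewrite setUC.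
Qed.

Lemma triangle_mem3 (x y z t : V) : t != x -> t != y -> t \in [set x; y; z] -> t = z.
Proof. by move=> tx ty; rewrite !inE (negbTE tx) (negbTE ty) => /eqP. Qed.

(** The counterpart of [contractible] for 3-cycles given by their vertices; [contractible_pairP]
    passes from one to the other. *)
Definition contractible_pair x y := exists z1 z2,
  [/\ z1 != z2, facial [set x; y; z1], facial [set x; y; z2] &
      forall C, triangle C -> x \in C -> y \in C -> C = [set x; y; z1] \/ C = [set x; y; z2]].

(** Two corners glued along both of their edges fill a neighbourhood of the apex and leave no room
    for a third edge there. On a surface this is [corner_degree]. *)
Hypothesis corner : forall F1 j1 F2 j2, F1 != F2 ->
  w F1 j1.+1 = w F2 j2.+1 ->
  (w F1 j1 = w F2 j2 /\ w F1 j1.+2 = w F2 j2.+2 \/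
   w F1 j1 = w F2 j2.+2 /\ w F1 j1.+2 = w F2 j2) ->
  forall y, adj (w F1 j1.+1) y -> y = w F1 j1 \/ y = w F1 j1.+2.

Definition twin_faces x y := exists F1 F2,
  [/\ F1 != F2, m F1 = 3, m F2 = 3, vset F1 = vset F2 & (x \in vset F1) && (y \in vset F1)].

(** The hard case is a face [F2] of size at least 4 across from the triangular face [F1]. Every
    3-cycle through the edge is then [x y z], so the walk of [F2] reads [z p q z] around the edge
    [p q]. Its corner at [p] is also a corner of [F1], hence [p] has degree two and the vertex of
    [F2] before this stretch is [q]. Now the edge [q z] has two sides on [F2] and one on [F1], which
    is one too many. *)
Lemma facial_edge_aux x y F1 j1 F2 j2 :
  (forall C, triangle C -> x \in C -> y \in C -> facial C) ->
  sides x y F1 j1 F2 j2 -> m F1 = 3 -> contractible_pair x y \/ twin_faces x y.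
Proof.
move=> fac xyS mF1; have [[l1 l2] s1 s2 n12 _] := xyS.
have xy : x != y by exact/adj_neq/(side_adj s1).
have faceE C : triangle C -> x \in C -> y \in C ->
    exists2 F, F = F1 \/ F = F2 & m F = 3 /\ C = vset F.
  move=> tC xC yC; have [F mF CF] := fac C tC xC yC.
  rewrite CF in xC yC; have [j sj] := vset_side mF xy xC yC.
  by exists F => //; exact: sides_face xyS sj.
have v1 := triangle_third mF1 s1.
have f1 : facial [set x; y; w F1 j1.+2] by exists F1.
have [mF2|mF2] := eqVneq (m F2) 3.
  have v2 := triangle_third mF2 s2.
  have [v12|v12] := eqVneq (vset F1) (vset F2).
    right; exists F1, F2; split=> //; last exact: side_vset s1.
    apply: contraNneq n12 => F12; rewrite F12 in l1 s1 *; rewrite mF2 in l1 l2.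
    by rewrite (side3_inj mF2 l1 l2 s1 s2).
  left; exists (w F1 j1.+2), (w F2 j2.+2); split => //.
  - by apply: contraNneq v12 => z12; rewrite v1 v2 z12.
  - by exists F2.
  - by move=> C tC xC yC; have [F [->|->] [mF ->]] := faceE C tC xC yC; [left|right].
have F12 : F1 != F2 by apply: contraNneq mF2 => <-; rewrite mF1.
have tri1 C : triangle C -> x \in C -> y \in C -> C = [set x; y; w F1 j1.+2].
  move=> tC xC yC; have [F [->|->] [mF ->]] := faceE C tC xC yC; first by [].
  by rewrite mF eqxx in mF2.
set z := w F1 j1.+2 in tri1 v1 f1 *.
(* The index two before [j2] modulo [m F2], kept in [nat]. *)
pose i := j2 + (m F2 - 2).
have m2 := m3 F2.
have wi2 k : w F2 (i + 2 + k) = w F2 (j2 + k).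
  by rewrite -(wper F2 (j2 + k)); congr (w F2 _); rewrite /i -(addnA j2) subnK ?(ltnW m2)// addnAC.
have e2 : w F2 i.+2 = w F2 j2 by have := wi2 0; rewrite !addn0 addn2.
have e3 : w F2 i.+3 = w F2 j2.+1 by have := wi2 1; rewrite !addn1 addn2.
have e4 : w F2 i.+4 = w F2 j2.+2 by have := wi2 2; rewrite !addn2.
have pq : (w F2 i.+2 = x /\ w F2 i.+3 = y) \/ (w F2 i.+2 = y /\ w F2 i.+3 = x).
  by rewrite e2 e3; case/orP: s2 => /andP[/eqP-> /eqP->]; [left|right].
have zxy t : adj t (w F2 i.+2) -> adj t (w F2 i.+3) -> t \in [set x; y; z] -> t = z.
  move=> /adj_neq n1 /adj_neq n2.
  by case: pq => -[pE qE]; rewrite pE qE in n1 n2; exact: triangle_mem3.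
(* The triples of the walk just before and just after contain the edge, so both have third vertex
   [z]. *)
have a_z : w F2 i.+1 = z.
  apply: zxy; [exact: wadj1|exact: wadj2|].
  rewrite -(tri1 _ (walk_triangle F2 i.+1)) ?inE ?eqxx//;
    by case: pq => -[-> ->]; rewrite eqxx ?orbT.
have b_z : w F2 i.+4 = z.
  apply: zxy; [exact/adjS/wadj2|exact/adjS/wadj1|].
  rewrite -(tri1 _ (walk_triangle F2 i.+2)) ?inE ?eqxx ?orbT//;
    by case: pq => -[-> ->]; rewrite eqxx ?orbT.
have pv : w F2 i.+2 \in vset F1 by rewrite v1 !inE; case: pq => -[-> _]; rewrite eqxx ?orbT.
have qv : w F2 i.+3 \in vset F1 by rewrite v1 !inE; case: pq => -[_ ->]; rewrite eqxx ?orbT.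
have zv : z \in vset F1 by rewrite v1 !inE eqxx ?orbT.
have pz : w F2 i.+2 != z by rewrite -a_z eq_sym adj_neq// wadj1.
have qz : w F2 i.+3 != z by rewrite -b_z adj_neq// wadj1.
have pqn : w F2 i.+2 != w F2 i.+3 by rewrite adj_neq// wadj1.
have [k kp] : exists k, w F1 k.+1 = w F2 i.+2.
  move: pv; rewrite (vset3 1 mF1) !inE -!orbA => /or3P[] /eqP e; [exists 0|exists 1|exists 2];
  by rewrite e.
have kzq : (w F2 i.+1 = w F1 k /\ w F2 i.+3 = w F1 k.+2) \/
           (w F2 i.+1 = w F1 k.+2 /\ w F2 i.+3 = w F1 k).
  rewrite a_z; move: zv qv; rewrite (vset3 k mF1) !inE kp [z == _ i.+2]eq_sym (negbTE pz) orbF.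
  rewrite [w F2 i.+3 == w F2 i.+2]eq_sym (negbTE pqn) orbF.
  move=> /orP[/eqP zk|/eqP zk] /orP[/eqP qk|/eqP qk].
  - by rewrite qk zk eqxx in qz.
  - by left.
  - by right.
  - by rewrite qk zk eqxx in qz.
have F21 : F2 != F1 by rewrite eq_sym.
have := corner F21 (esym kp) kzq (adjS (wadj2 F2 i)) => -[a'z|a'q].
  by have := adj_neq (wadj1 F2 i); rewrite a'z eqxx.
have [G1 [k1 [G2 [k2 qzS]]]] : exists G1 j1 G2 j2, sides (w F2 i.+3) z G1 j1 G2 j2.
  by apply: two_sided; rewrite -b_z wadj1.
have [k' sk'] := vset_side mF1 qz qv zv.
have si : side F2 i (w F2 i.+3) z by rewrite /side a'q a_z !eqxx.
have si3 : side F2 i.+3 (w F2 i.+3) z by rewrite /side b_z !eqxx.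
(* Three sides of one edge are known, [k'] on [F1] and [i], [i.+3] on [F2]. The last two must
   coincide modulo [m F2], which then divides 3. *)
have key : i %% m F2 = i.+3 %% m F2.
  case: (sides_mem qzS sk') => -[G1E _]; case: (sides_mem qzS si) => -[G2E i1];
  case: (sides_mem qzS si3) => -[G3E i2]; rewrite ?i1 ?i2 //;
  by move: F12; rewrite ?G1E ?G2E ?G3E ?eqxx// -?G2E -?G3E ?G1E ?eqxx.
have : m F2 %| 3.
  have /eqP := key; rewrite -{1}[i]addn0 -[i.+3]addn3 eqn_modDl mod0n eq_sym.
  by rewrite -/(dvdn _ _).
by move=> /dvdn_leq - /(_ isT) m2'; case/eqP: mF2; apply/eqP; rewrite eqn_leq m2'.
Qed.

(** Three consecutive vertices of a face at the edge form a 3-cycle through it; being facial, it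
    puts a triangular face on one of the two sides. *)
Lemma facial_edge x y : adj x y ->
  (forall C, triangle C -> x \in C -> y \in C -> facial C) ->
  contractible_pair x y \/ twin_faces x y.
Proof.
move=> axy fac; have [F1 [j1 [F2 [j2 xyS]]]] := two_sided axy.
have [_ s1 s2 _ _] := xyS.
have /andP[xD yD] : (x \in [set w F1 j1; w F1 j1.+1; w F1 j1.+2]) &&
                    (y \in [set w F1 j1; w F1 j1.+1; w F1 j1.+2]).
  by case/orP: s1 => /andP[/eqP <- /eqP <-]; rewrite !inE !eqxx ?orbT.
have [F mF CF] := fac _ (walk_triangle F1 j1) xD yD; rewrite CF in xD yD.
have [j sj] := vset_side mF (adj_neq axy) xD yD.
case: (sides_face xyS sj) => FE; rewrite FE in mF.
  exact: facial_edge_aux xyS mF.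
exact: facial_edge_aux (sidesC xyS) mF.
Qed.

(* [X] and [I] are the sets of faces and of vertices surrounded by the 3-cycle [C]. *)
Definition region (C : {set V}) (X : {set FT}) (I : {set V}) :=
  [/\ triangle C,
      forall u v F1 j1 F2 j2, sides u v F1 j1 F2 j2 ->
        (F1 \in X) (+) (F2 \in X) = (u \in C) && (v \in C),
      forall x, x \in I -> x \notin C,
      forall x y, x \in I -> adj x y ->
        ((y \in I) || (y \in C)) /\ forall F j, side F j x y -> F \in X &
      forall F j, F \in X -> (w F j \in I) || (w F j \in C)].

(** The sets of faces with empty boundary mod 2. *)
Definition balanced (Y : {set FT}) :=
  forall u v F1 j1 F2 j2, sides u v F1 j1 F2 j2 -> (F1 \in Y) = (F2 \in Y).

Lemma triangle_edge C x : triangle C -> x \in C ->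
  exists y z, [/\ adj x y, adj x z, adj y z & C = [set x; y; z]].
Proof.
move=> [a [b [c [ab bc ac ->]]]]; rewrite !inE -orbA => /or3P[] /eqP->.
- by exists b, c.
- exists a, c; split; rewrite // 1?adjC//.
  by rewrite [[set a; b]]setUC.
- exists a, b; split; rewrite // 1?adjC//.
  by rewrite setUC setUA.
Qed.

(** All corners of a face in [X] lie on [C] and consecutive triples are distinct, so its walk runs
    around [C] with period 3. If it went around more than once, both sides of an edge of [C] would
    belong to this face, whereas exactly one of them is in [X]. *)
Lemma empty_region_facial C X : region C X set0 -> facial C.
Proof.
move=> [tC XC _ _ XI].
have [x xC] : exists x, x \in C.
  by have [a [b [c [_ _ _ ->]]]] := tC; exists a; rewrite !inE eqxx.
have [a [b [xa xb ab CE]]] := triangle_edge tC xC.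
have [F1 [j1 [F2 [j2 xaS]]]] := two_sided xa.
have [F [j [sj FX]]] : exists F j, side F j x a /\ F \in X.
  have := XC _ _ _ _ _ _ xaS; have [_ s1 s2 _ _] := xaS.
  rewrite CE !inE !eqxx ?orbT/=.
  by case: (boolP (F1 \in X)) => [? _|_ /= ?]; [exists F1, j1|exists F2, j2].
have wC k : w F k \in C by have := XI F k FX; rewrite inE.
have cC : #|C| = 3 by rewrite CE -setUA !cardsU1 cards1 !inE
  (negbTE (adj_neq xa)) (negbTE (adj_neq xb)) (negbTE (adj_neq ab)).
have CEk k : C = [set w F k; w F k.+1; w F k.+2].
  apply/esym/eqP; rewrite eqEcard cC; apply/andP; split.
    by apply/subsetP => z; rewrite !inE -orbA => /or3P[] /eqP->.
  rewrite -setUA !cardsU1 cards1 !inE.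
  by rewrite (negbTE (adj_neq (wadj1 F k))) (negbTE (adj_neq (wadj2 F k)))
    (negbTE (adj_neq (wadj1 F k.+1))).
have w3 k : w F k.+3 = w F k.
  have := wC k.+3; rewrite (CEk k) !inE -orbA => /or3P[] /eqP// e.
    by have := adj_neq (wadj2 F k.+1); rewrite e eqxx.
  by have := adj_neq (wadj1 F k.+2); rewrite e eqxx.
exists F; last exact: CEk.
case: (eqVneq (m F) 3) => // mF; exfalso.
have sj3 : side F j.+3 x a by rewrite /side !w3.
have neq : j %% m F != j.+3 %% m F.
  apply: contra mF; rewrite -{1}[j]addn0 -[j.+3]addn3 eqn_modDl mod0n eq_sym.
  by move=> /dvdn_leq - /(_ isT) h; rewrite eqn_leq h m3.
have := XC _ _ _ _ _ _ xaS; rewrite CE !inE !eqxx ?orbT/=.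
by case: (sides_mem xaS sj) => -[e1 e2]; case: (sides_mem xaS sj3) => -[e3 e4];
  rewrite ?e2 ?e4 ?eqxx// in neq; rewrite -e1 -e3 FX.
Qed.

(* Each face of [Y] enters and leaves [a] equally often. *)
Lemma boundary_even (Y : {set FT}) a b c F1 j1 F2 j2 G1 k1 G2 k2 :
  b != c -> sides a b F1 j1 F2 j2 -> sides a c G1 k1 G2 k2 ->
  (forall d H1 i1 H2 i2, d != b -> d != c -> sides a d H1 i1 H2 i2 ->
    (H1 \in Y) = (H2 \in Y)) ->
  (F1 \in Y) (+) (F2 \in Y) = (G1 \in Y) (+) (G2 \in Y).
Proof.
move=> bc abS acS rest.
pose M := \max_F m F.
have mM F : m F <= M by exact: leq_bigmax.
pose P (p : FT * 'I_M) := (p.1 \in Y) && (p.2 < m p.1).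
pose n d := \sum_(p | P p) (side p.1 p.2 a d : nat).
have nE d H1 i1 H2 i2 : sides a d H1 i1 H2 i2 -> odd (n d) = (H1 \in Y) (+) (H2 \in Y).
  move=> [[l1 l2] s1 s2 n12 u].
  have i1M := leq_trans l1 (mM H1); have i2M := leq_trans l2 (mM H2).
  pose p1 : FT * 'I_M := (H1, Ordinal i1M); pose p2 : FT * 'I_M := (H2, Ordinal i2M).
  have p12 : p2 != p1.
    by apply: contraNneq n12 => -[-> e]; apply/eqP; congr (_, _); rewrite e.
  rewrite /n big_mkcond (bigD1 p1)//= (bigD1 p2)//= big1 ?addn0.
    by rewrite /P/= l1 l2 s1 s2 !andbT oddD; case: (_ \in _); case: (_ \in _).
  move=> [F j] /andP[] /= np1 np2; case: ifP => // /andP[/= FY jm].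
  case: (boolP (side _ _ _ _)) => // /(u F j jm)[[FE jE]|[FE jE]].
    by case/eqP: np1; congr (_, _) => //; exact: val_inj.
  by case/eqP: np2; congr (_, _) => //; exact: val_inj.
(* The sum counts the steps of walks of [Y] that leave or enter [a], and a closed walk leaves [a] as
   often as it enters it. *)
have total : odd (\sum_d n d) = false.
  rewrite /n exchange_big/=.
  have -> : \sum_(p | P p) \sum_d (side p.1 p.2 a d : nat) =
            \sum_(p | P p) ((w p.1 p.2 == a) + (w p.1 p.2.+1 == a)).
    apply: eq_bigr => -[F j] _ /=; rewrite /side.
    have nn := adj_neq (wadj1 F j).
    have [wa|wa] := eqVneq (w F j) a.
      rewrite -wa eq_sym (negbTE nn) addn0 (bigD1 (w F j.+1))//= eqxx big1// => d dn.
      by rewrite eq_sym (negbTE dn) andbF.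
    have [wa'|wa'] := eqVneq (w F j.+1) a.
      by rewrite (bigD1 (w F j))//= eqxx big1// => d dn; rewrite eq_sym (negbTE dn).
    by rewrite big1// => d _; rewrite andbF.
  rewrite big_split/= oddD.
  have pairE (f : FT -> nat -> nat) : \sum_(p | P p) f p.1 p.2 =
      \sum_(F in Y) \sum_(j < m F) f F j.
    rewrite -(pair_big_dep (mem Y) (fun F (j : 'I_M) => j < m F) (fun F j => f F j))/=.
    by apply: eq_bigr => F _; rewrite (big_ord_widen_cond _ predT _ (mM F)).
  rewrite (pairE (fun F j => w F j == a)) (pairE (fun F j => w F j.+1 == a)).
  rewrite (_ : \sum_(F in Y) \sum_(j < m F) (w F j.+1 == a) =
               \sum_(F in Y) \sum_(j < m F) (w F j == a)) ?addbb//.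
  apply: eq_bigr => F _; have := m3 F; case E : (m F) => [//|k] _.
  rewrite big_ord_recr big_ord_recl/= addnC; congr (_ + _).
  by rewrite -E -(wper F 0) add0n.
move: total; rewrite (big_morph odd oddD (erefl : odd 0 = false)).
rewrite (bigD1 b)//= (bigD1 c) 1?eq_sym//= big1 ?addbF => [|d /andP[db dc]].
  by rewrite (nE _ _ _ _ _ abS) (nE _ _ _ _ _ acS); do 4?[case: (_ \in _)].
have [ad|ad] := boolP (adj a d).
  have [H1 [i1 [H2 [i2 adS]]]] := two_sided ad.
  by rewrite (nE _ _ _ _ _ adS) (rest _ _ _ _ _ db dc adS) addbb.
rewrite /n big1// => p _; apply/eqP; rewrite eqb0.
by apply: contra ad => /side_adj.
Qed.

Variable X0 : {set FT}.
(** Proved for an embedded disk in [disk_balanced]. It means that a set of faces in [X0] is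
    determined by its boundary mod 2. *)
Hypothesis balanced0 : forall Y : {set FT}, Y \subset X0 -> balanced Y -> Y = set0.

(** The set of faces in [Z] but not in [X] has boundary on [C] only: an edge of [D] that does not
    join two vertices of [C] has an end in [I], so both faces at it are in [X]. The inclusion is
    strict because the edge [x y] of [D] has both faces in [X] and only one in [Z]. *)
Lemma region_sub C X I D Z J x :
  region C X I -> region D Z J -> X \subset X0 -> Z \subset X0 ->
  x \in I -> x \in D -> Z \proper X.
Proof.
move=> [tC XC IC IX XI] [tD ZD _ _ _] sX sZ xI xD.
have [y [z [xy xz yz DE]]] := triangle_edge tD xD.
have DIC t : t \in D -> (t \in I) || (t \in C).
  rewrite DE !inE -orbA => /or3P[] /eqP->; rewrite ?xI//.
    by have [] := IX x y xI xy.
  by have [] := IX x z xI xz.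
have [F1 [j1 [F2 [j2 xyS]]]] := two_sided xy; have [_ s1 s2 _ _] := xyS.
have F1X : F1 \in X by have [_ h] := IX x y xI xy; exact: h s1.
have F2X : F2 \in X by have [_ h] := IX x y xI xy; exact: h s2.
pose Y := Z :\: X.
have bdY u v G1 k1 G2 k2 : sides u v G1 k1 G2 k2 -> ~~ ((u \in C) && (v \in C)) ->
    (G1 \in Y) = (G2 \in Y).
  move=> uvS nC; have := XC _ _ _ _ _ _ uvS; have := ZD _ _ _ _ _ _ uvS.
  rewrite (negbTE nC) !inE; have [_ s1' s2' _ _] := uvS.
  case: (boolP ((u \in D) && (v \in D))) => [/andP[uD vD]|_].
    have [G1X G2X] : G1 \in X /\ G2 \in X.
      move: nC; rewrite negb_and => /orP[nu|nv].
        have uI : u \in I by have := DIC u uD; rewrite (negbTE nu) orbF.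
        by have [_ h] := IX u v uI (side_adj s1'); split; [exact: h s1'|exact: h s2'].
      have vI : v \in I by have := DIC v vD; rewrite (negbTE nv) orbF.
      have [_ h] := IX v u vI (adjS (side_adj s1')).
      by split; [apply: (h _ k1)|apply: (h _ k2)]; rewrite sideC.
    by rewrite G1X G2X.
  by do 4?[case: (_ \in _)].
have YX0 : Y \subset X0 by apply: subset_trans sZ; exact: subsetDl.
have Y0 : Y = set0.
  have [a [b [c [ab bc ac CE]]]] := tC.
  (* Evenness at a vertex of [C] compares the two edges of [C] that meet there, so all three edges
     of [C] have the same status for [Y]. *)
  have tabs p q r : adj p q -> adj p r -> adj q r -> C = [set p; q; r] ->
    forall G1 k1 G2 k2 H1 i1 H2 i2, sides p q G1 k1 G2 k2 -> sides p r H1 i1 H2 i2 ->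
    (G1 \in Y) (+) (G2 \in Y) = (H1 \in Y) (+) (H2 \in Y).
    move=> pq pr qr Cpqr G1 k1 G2 k2 H1 i1 H2 i2 pqS prS.
    apply: (boundary_even (adj_neq qr) pqS prS) => d K1 l1 K2 l2 dq dr pdS.
    have [_ s _ _ _] := pdS; have dp := adj_neq (adjS (side_adj s)).
    by apply: (bdY _ _ _ _ _ _ pdS); rewrite Cpqr !inE negb_and (negbTE dp) (negbTE dq) (negbTE dr) orbT.
  have [G1 [k1 [G2 [k2 abS]]]] := two_sided ab.
  have [H1 [i1 [H2 [i2 acS]]]] := two_sided ac.
  have [K1 [l1 [K2 [l2 bcS]]]] := two_sided bc.
  have e1 := tabs a b c ab ac bc CE _ _ _ _ _ _ _ _ abS acS.
  have baS : sides b a G1 k1 G2 k2.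
    by case: abS => h1 h2 h3 h4 h5; split; rewrite 1?sideC// => F j jm; rewrite sideC; exact: h5.
  have CE' : C = [set b; a; c] by rewrite CE [[set a; b]]setUC.
  have e2 := tabs b a c (adjS ab) bc ac CE' _ _ _ _ _ _ _ _ baS bcS.
  have dC u v L1 h1 L2 h2 : sides u v L1 h1 L2 h2 -> u \in C -> v \in C ->
      (L1 \in Y) (+) (L2 \in Y) = (G1 \in Y) (+) (G2 \in Y).
    move=> uvS; have [_ sL1 sL2 _ _] := uvS; have uv := adj_neq (side_adj sL1).
    have same p q M1 g1 M2 g2 : sides p q M1 g1 M2 g2 ->
        (u = p /\ v = q) \/ (u = q /\ v = p) ->
        (L1 \in Y) (+) (L2 \in Y) = (M1 \in Y) (+) (M2 \in Y).
      move=> pqS uvpq; have [[lh1 lh2] _ _ nL _] := uvS; have [_ _ _ _ hh] := pqS.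
      have t1 : side L1 h1 p q by case: uvpq sL1 => -[-> ->]; rewrite // sideC.
      have t2 : side L2 h2 p q by case: uvpq sL2 => -[-> ->]; rewrite // sideC.
      case: (hh _ _ lh1 t1) => -[E1 E2]; case: (hh _ _ lh2 t2) => -[E3 E4];
        rewrite E1 E2 E3 E4 ?eqxx// in nL *.
      by rewrite addbC.
    rewrite CE => /in_set3[] eu /in_set3[] ev;
      move: uv; rewrite eu ev ?eqxx//= => _.
    - by apply: (same _ _ _ _ _ _ abS); left.
    - by rewrite e1; apply: (same _ _ _ _ _ _ acS); left.
    - by apply: (same _ _ _ _ _ _ abS); right.
    - by rewrite e2; apply: (same _ _ _ _ _ _ bcS); left.
    - by rewrite e1; apply: (same _ _ _ _ _ _ acS); right.
    - by rewrite e2; apply: (same _ _ _ _ _ _ bcS); right.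
  (* If no edge of [C] is in the boundary of [Y], then [Y] is balanced. If all three are, then [X]
     and [Y] are disjoint with the same boundary, so their union is balanced, yet it contains
     [F1]. *)
  case E : ((G1 \in Y) (+) (G2 \in Y)) in dC; last first.
    apply: balanced0 => // u v L1 h1 L2 h2 uvS.
    have [/andP[uC vC]|nC] := boolP ((u \in C) && (v \in C)); last exact: bdY uvS nC.
    by have := dC _ _ _ _ _ _ uvS uC vC; do 4?[case: (_ \in _)].
  have : X :|: Y = set0.
    apply: balanced0; first by rewrite subUset sX YX0.
    move=> u v L1 h1 L2 h2 uvS.
    have := XC _ _ _ _ _ _ uvS.
    have [/andP[uC vC]|nC] := boolP ((u \in C) && (v \in C)).
      have := dC _ _ _ _ _ _ uvS uC vC; rewrite !inE.
      by do 4?[case: (_ \in _)].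
    have := bdY _ _ _ _ _ _ uvS nC; rewrite !inE.
    by do 4?[case: (_ \in _)].
  by move=> /setP/(_ F1); rewrite !inE F1X.
rewrite properE; apply/andP; split.
  by rewrite -setD_eq0; apply/eqP.
apply/subsetPn; have := ZD _ _ _ _ _ _ xyS.
rewrite DE !inE !eqxx ?orbT/=.
by case: (boolP (F1 \in Z)) => [F1Z /= F2Z|F1Z _]; [exists F2|exists F1].
Qed.

(** The induction on the number of faces realizes the choice of a smallest 3-cycle: by [region_sub],
    every 3-cycle through a surrounded vertex [x] has a smaller region, hence surrounds no vertex
    and is facial, so that [facial_edge] applies to an edge at [x]. *)
Lemma interior_empty (C0 : {set V}) (I0 : {set V}) :
  region C0 X0 I0 ->
  (forall x C, x \in I0 -> triangle C -> x \in C ->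
    exists X I, [/\ region C X I, X \subset X0 & I \subset I0]) ->
  (forall x, exists y, adj x y) ->
  (forall x y, adj x y -> ~ contractible_pair x y) -> I0 = set0.
Proof.
move=> reg0 regs nbr ncontr.
suff h n (C : {set V}) (X : {set FT}) (I : {set V}) : #|X| <= n -> region C X I -> X \subset X0 -> I \subset I0 -> I = set0.
  exact: (h #|X0| C0 X0 I0).
elim: n C X I => [|n ih] C X I Xn reg sX sI; apply/eqP; apply/negPn/negP.
  move=> /set0Pn[x xI]; have [y xy] := nbr x.
  have [F1 [j1 [F2 [j2 xyS]]]] := two_sided xy; have [_ s1 _ _ _] := xyS.
  have [_ _ _ IX _] := reg; have [_ /(_ _ _ s1) F1X] := IX x y xI xy.
  by move: Xn; rewrite leqn0 cards_eq0 => /eqP X0'; rewrite X0' inE in F1X.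
move=> /set0Pn[x xI]; have [y xy] := nbr x.
have fac D : triangle D -> x \in D -> facial D.
  move=> tD xD; have [Z [J [regD sZ sJ]]] := regs x D (subsetP sI x xI) tD xD.
  have /proper_card ZX := region_sub reg regD sX sZ xI xD.
  apply: (@empty_region_facial _ Z).
  by rewrite -(ih D Z J)// -ltnS (leq_trans ZX).
have [|/ncontr//|] := @facial_edge x y xy; first by move=> D tD xD _; exact: fac.
move=> [F1 [F2 [F12 mF1 mF2 v12 /andP[xv yv]]]].
have xyn := adj_neq xy.
have [_ _ _ IX _] := reg.
have F1X : F1 \in X.
  by have [j s] := vset_side mF1 xyn xv yv; have [_ /(_ _ _ s)] := IX x y xI xy.
have F2X : F2 \in X.
  rewrite v12 in xv yv.
  by have [j s] := vset_side mF2 xyn xv yv; have [_ /(_ _ _ s)] := IX x y xI xy.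
(* Twin faces have the same three edges, so together they have no boundary. *)
have : [set F1; F2] = set0.
  apply: balanced0.
    by apply/subsetP => F; rewrite !inE => /orP[] /eqP->; exact: (subsetP sX).
  have one u v G1 k1 G2 k2 : sides u v G1 k1 G2 k2 ->
      G1 \in [set F1; F2] -> G2 \in [set F1; F2].
    move=> uvS; have [_ s1 _ _ _] := uvS; have uv := adj_neq (side_adj s1).
    rewrite !inE => /orP[] /eqP G1E; rewrite G1E in s1.
      have /andP[uv1 uv2] := side_vset mF1 s1; rewrite v12 in uv1 uv2.
      have [k sk] := vset_side mF2 uv uv1 uv2.
      by case: (sides_face uvS sk) => E; rewrite -?E ?eqxx ?orbT//; rewrite -E eq_sym -G1E E eqxx in F12 || rewrite E G1E eqxx in F12.
    have /andP[uv1 uv2] := side_vset mF2 s1; rewrite -v12 in uv1 uv2.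
    have [k sk] := vset_side mF1 uv uv1 uv2.
    by case: (sides_face uvS sk) => E; rewrite -?E ?eqxx ?orbT//; rewrite E G1E eqxx in F12.
  move=> u v G1 k1 G2 k2 uvS; apply/idP/idP; first exact: one uvS.
  exact: one (sidesC uvS).
by move=> /setP/(_ F1); rewrite !inE eqxx.
Qed.

End Comb.

From mathcomp Require Import all_order all_algebra.
From mathcomp Require Import all_classical all_reals all_analysis.
From mathcomp Require Import ring lra.

Import Order.TTheory GRing.Theory Num.Theory.
Import numFieldNormedType.Exports.

Local Open Scope classical_set_scope.
Local Open Scope ring_scope.

(** * Continuity on a subset *)

(** A filter form of continuity within [A] ([cont_onP]): the domain stays the ambient space, so the
    set can be changed freely. *)
Definition cont_on (T U : topologicalType) (A : set T) (f : T -> U) :=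
  forall x, A x -> f y @[y --> within A (nbhs x)] --> f x.

Definition inj_on (T U : Type) (A : set T) (f : T -> U) :=
  forall x y, A x -> A y -> f x = f y -> x = y.

Lemma cont_onP (T U : topologicalType) (A : set T) (f : T -> U) :
  {within A, continuous f} <-> cont_on A f.
Proof. exact: subspace_continuousP. Qed.

Lemma inj_onP (T U : Type) (A : set T) (f : T -> U) :
  {in A &, injective f} <-> inj_on A f.
Proof.
split=> [fI x y Ax Ay|fI x y]; first by apply: fI; rewrite inE.
by rewrite !inE => Ax Ay; exact: fI.
Qed.

Lemma inj_onS (T U : Type) (A B : set T) (f : T -> U) :
  A `<=` B -> inj_on B f -> inj_on A f.
Proof. by move=> AB fB x y Ax Ay; apply: fB; exact: AB. Qed.

Section ContOn.
Variables (T U V : topologicalType).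
Implicit Types (A B : set T) (f : T -> U).

Lemma cont_onS A B f : A `<=` B -> cont_on B f -> cont_on A f.
Proof. by move=> AB /cont_onP fB; apply/cont_onP; apply: continuous_subspaceW fB. Qed.

Lemma cont_on_near A f x (N : set U) : cont_on A f -> A x -> nbhs (f x) N ->
  \forall y \near x, A y -> N (f y).
Proof. by move=> fA Ax Nfx; have := fA x Ax N Nfx; rewrite /= /within nbhs_simpl. Qed.

Lemma near_cont_on A f :
  (forall x N, A x -> nbhs (f x) N -> \forall y \near x, A y -> N (f y)) ->
  cont_on A f.
Proof. by move=> fA x Ax N Nfx; have := fA x N Ax Nfx. Qed.

Lemma continuous_cont_on A f : continuous f -> cont_on A f.
Proof.
by move=> cf; apply: near_cont_on => x N _ /cf; apply: (@filterS _ (nbhs x) _) => y.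
Qed.

End ContOn.

Section ContOn2.
Variables (T U V : topologicalType).
Implicit Types (A B : set T) (f : T -> U).

Lemma cont_on_comp A (B : set U) f (g : U -> V) :
  (forall x, A x -> B (f x)) -> cont_on A f -> cont_on B g ->
  cont_on A (fun x => g (f x)).
Proof.
move=> AB fA gB; apply: near_cont_on => x N Ax Ng.
have /(cont_on_near fA Ax) := cont_on_near gB (AB _ Ax) Ng.
by apply: filterS => y h Ay; apply: h => //; exact: AB.
Qed.

Lemma cont_on_pair A f (g : T -> V) :
  cont_on A f -> cont_on A g -> cont_on A (fun x => (f x, g x)).
Proof. by move=> fA gA x Ax; apply: cvg_pair; [exact: fA|exact: gA]. Qed.

Lemma cont_on_fst A (f : T -> U * V) : cont_on A f -> cont_on A (fun x => (f x).1).
Proof. by move=> fA x Ax; apply: (cvg_comp f fst (fA x Ax)); exact: cvg_fst. Qed.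

Lemma cont_on_snd A (f : T -> U * V) : cont_on A f -> cont_on A (fun x => (f x).2).
Proof. by move=> fA x Ax; apply: (cvg_comp f snd (fA x Ax)); exact: cvg_snd. Qed.

Lemma cont_on_id A : cont_on A id.
Proof. by apply: continuous_cont_on => x. Qed.

Lemma cont_on_cst A (c : U) : cont_on A (fun=> c).
Proof. by apply: continuous_cont_on => x; exact: cvg_cst. Qed.

Lemma eq_cont_on A f g : (forall x, A x -> f x = g x) -> cont_on A f -> cont_on A g.
Proof.
move=> fg fA; apply: near_cont_on => x N Ax; rewrite -fg// => /(cont_on_near fA Ax).
by apply: filterS => y h Ay; rewrite -fg//; exact: h.
Qed.

Lemma cont_onU A B f : closed A -> closed B -> cont_on A f -> cont_on B f ->
  cont_on (A `|` B) f.
Proof.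
by move=> cA cB /cont_onP fA /cont_onP fB; apply/cont_onP; exact: withinU_continuous.
Qed.

Lemma cont_on_compact A f : cont_on A f -> compact A -> compact (f @` A).
Proof. by move=> /cont_onP fA; exact: continuous_compact. Qed.

Lemma cont_on_connected A f : cont_on A f -> connected A -> connected (f @` A).
Proof. by move=> /cont_onP fA cA; exact: connected_continuous_connected. Qed.

Lemma cont_on_open A f (N : set U) : open A -> cont_on A f -> open N ->
  open (A `&` f @^-1` N).
Proof.
move=> oA fA oN; rewrite openE => x [Ax Nfx].
have := cont_on_near fA Ax (open_nbhs_nbhs (conj oN Nfx)).
by apply: filterS2 (open_nbhs_nbhs (conj oA Ax)) => y Ay /(_ Ay).
Qed.

End ContOn2.

(** The predicate is arbitrary: membership of a disk, the sign of a function and the existence of a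
    square root are all carried along connected sets in this way. *)
Lemma connected_locally_constant (T : topologicalType) (A : set T) (P : T -> Prop) :
  connected A ->
  (forall x, A x -> \forall y \near x, A y -> (P y <-> P x)) ->
  forall x y, A x -> A y -> P x -> P y.
Proof.
move=> cA locP x y Ax Ay Px.
suff AE : A = A `&` P by move: Ay; rewrite AE => -[].
have Alo : A `&` P = A `&` [set z | A z -> P z]^°.
  apply/seteqP; split=> z [Az Pz]; split=> //.
    by have := locP z Az; apply: filterS => t /[swap] At /(_ At) ->.
  by have := nbhs_singleton Pz; exact.
have Alc : A `&` P = A `&` ~` [set z | A z -> ~ P z]^°.
  apply/seteqP; split=> z [Az Pz]; split=> //.
    by move=> /nbhs_singleton/(_ Az).
  apply: contrapT => nPz; apply: Pz; have := locP z Az.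
  by apply: filterS => t /[swap] At /(_ At) ->.
apply/esym/cA; first by exists x.
- by exists [set z | A z -> P z]^° => //; exact: open_interior.
- by exists (~` [set z | A z -> ~ P z]^°) => //; exact/open_closedC/open_interior.
Qed.

(** Compact subsets of [K] have compact, hence closed, images. The point [x0] is the value of the
    inverse off the image. *)
Lemma compact_inverse (T U : topologicalType) (x0 : T) (K : set T) (f : T -> U) : hausdorff_space U -> compact K -> cont_on K f -> inj_on K f ->
  exists2 g : U -> T, (forall x, K x -> g (f x) = x) & cont_on (f @` K) g.
Proof.
move=> hU cK fK fI.
pose g y := if pselect (exists x, K x /\ f x = y) is left h then projT1 (cid h) else x0.
have gf x : K x -> g (f x) = x.
  rewrite /g => Kx; case: pselect => [h|[]]; last by exists x.
  by case: cid => z /= [Kz fz]; exact: fI.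
exists g => //; apply: near_cont_on => _ N [x Kx <-]; rewrite gf// nbhsE => -[W [oW Wx] WN].
have cKW : compact (K `&` ~` W) by apply: compact_closedI => //; exact: open_closedC.
have cl : closed (f @` (K `&` ~` W)).
  apply: compact_closed => //; apply: cont_on_compact cKW.
  by apply: cont_onS fK => z [].
have : nbhs (f x) (~` (f @` (K `&` ~` W))).
  apply: open_nbhs_nbhs; split; first exact: closed_openC.
  by move=> [z [Kz nWz] /fI zx]; apply: nWz; rewrite zx.
apply: filterS => y h [z Kz zy]; rewrite -zy in h *; rewrite gf//; apply: WN.
by apply: contrapT => nWz; apply: h; exists z.
Qed.

Lemma small_pos (R : realType) (r : R) : 0 < r -> exists e, [/\ 0 < e, e < r & e < 1].
Proof.
move=> r0; exists (Num.min r 1 / 2).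
have h1 : Num.min r 1 <= r by rewrite ge_min lexx.
have h2 : Num.min r 1 <= 1 by rewrite ge_min lexx orbT.
have h3 : 0 < Num.min r 1 by rewrite lt_min r0 ltr01.
by split; lra.
Qed.

Section RealFun.
Variables (R : realType) (T : topologicalType) (A : set T).
Implicit Types f g : T -> R.

Lemma cont_onD f g : cont_on A f -> cont_on A g -> cont_on A (fun x => f x + g x).
Proof. by move=> fA gA x Ax; apply: cvgD; [exact: fA|exact: gA]. Qed.
Lemma cont_onB f g : cont_on A f -> cont_on A g -> cont_on A (fun x => f x - g x).
Proof. by move=> fA gA x Ax; apply: cvgB; [exact: fA|exact: gA]. Qed.
Lemma cont_onN f : cont_on A f -> cont_on A (fun x => - f x).
Proof. by move=> fA x Ax; apply: cvgN; exact: fA. Qed.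
Lemma cont_onM f g : cont_on A f -> cont_on A g -> cont_on A (fun x => f x * g x).
Proof. by move=> fA gA x Ax; apply: cvgM; [exact: fA|exact: gA]. Qed.
Lemma cont_onX f n : cont_on A f -> cont_on A (fun x => f x ^+ n).
Proof.
move=> fA; elim: n => [|n ih]; first exact: cont_on_cst.
by apply: (@eq_cont_on _ _ _ (fun x => f x * f x ^+ n)) => [x _|]; [rewrite exprS|exact: cont_onM].
Qed.
Lemma cont_onV f : (forall x, A x -> f x != 0) -> cont_on A f -> cont_on A (fun x => (f x)^-1).
Proof. by move=> f0 fA x Ax; apply: cvgV; [exact: f0|exact: fA]. Qed.
Lemma cont_on_sqrt f : cont_on A f -> cont_on A (fun x => Num.sqrt (f x)).
Proof.
move=> fA; apply: (@cont_on_comp _ _ _ A setT) => //.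
by apply: continuous_cont_on; exact: sqrt_continuous.
Qed.
End RealFun.

(** * Square roots of plane-valued functions *)

Section Sqrt.
Variable R : realType.
Local Notation plane := (R * R)%type.

(* The plane is identified with the complex numbers. *)
Definition csquare (z : plane) : plane := (z.1 ^+ 2 - z.2 ^+ 2, 2 * (z.1 * z.2)).
Definition dotp (a b : plane) : R := a.1 * b.1 + a.2 * b.2.

Definition has_sqrt (T : topologicalType) (K : set T) (h : T -> plane) :=
  exists2 s : T -> plane, cont_on K s & forall x, K x -> csquare (s x) = h x.

Lemma cont_on_dotp (T : topologicalType) (K : set T) (f g : T -> plane) :
  cont_on K f -> cont_on K g -> cont_on K (fun x => dotp (f x) (g x)).
Proof.
move=> fK gK; apply: cont_onD; apply: cont_onM;
  (exact: cont_on_fst || exact: cont_on_snd).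
Qed.

Lemma cont_on_csq (T : topologicalType) (K : set T) (f : T -> plane) :
  cont_on K f -> cont_on K (fun x => csquare (f x)).
Proof.
move=> fK; have f1 := cont_on_fst fK; have f2 := cont_on_snd fK.
apply: cont_on_pair; first by apply: cont_onB; exact: cont_onX.
by apply: cont_onM; [exact: cont_on_cst|exact: cont_onM].
Qed.

(* With w = h * conj (s^2), the vector w + |w| bisects the angle between w and
   the positive axis, so that s * (w + |w|) is a positive multiple of a root of h. *)
Lemma has_sqrt_approx (T : topologicalType) (K : set T) (s h : T -> plane) :
  cont_on K s -> cont_on K h -> (forall x, K x -> 0 < dotp (csquare (s x)) (h x)) ->
  has_sqrt K h.
Proof.
move=> sK hK sh.
pose w1 x := dotp (csquare (s x)) (h x).
pose b x := (h x).2 * (csquare (s x)).1 - (h x).1 * (csquare (s x)).2.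
pose r x := Num.sqrt (w1 x ^+ 2 + b x ^+ 2).
pose a x := w1 x + r x.
pose n x := (s x).1 ^+ 2 + (s x).2 ^+ 2.
pose q x := Num.sqrt (2 * a x).
pose k x := (n x * q x)^-1.
have s1 := cont_on_fst sK; have s2 := cont_on_snd sK.
have h1 := cont_on_fst hK; have h2 := cont_on_snd hK.
have sqK := cont_on_csq sK.
have c1 := cont_on_fst sqK; have c2 := cont_on_snd sqK.
have w1K : cont_on K w1 by exact: cont_on_dotp.
have bK : cont_on K b by apply: cont_onB; exact: cont_onM.
have rK : cont_on K r by apply: cont_on_sqrt; apply: cont_onD; exact: cont_onX.
have aK : cont_on K a by exact: cont_onD.
have nK : cont_on K n by apply: cont_onD; exact: cont_onX.
have qK : cont_on K q by apply: cont_on_sqrt; apply: cont_onM => //; exact: cont_on_cst.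
have a0 x : K x -> 0 < a x.
  by move=> Kx; rewrite /a ltr_wpDr ?sqrtr_ge0//; exact: sh.
have q0 x : K x -> q x != 0.
  by move=> Kx; rewrite gt_eqF// sqrtr_gt0 mulr_gt0// a0.
have n0 x : K x -> n x != 0.
  move=> Kx; apply/eqP => nx; have := sh x Kx.
  have [z1 z2] : (s x).1 = 0 /\ (s x).2 = 0.
    by move: nx; rewrite /n; split; nra.
  by rewrite /dotp /csquare z1 z2/= expr0n/= !(mul0r, mulr0, subr0, addr0) ltxx.
have kK : cont_on K k.
  by apply: cont_onV => [x Kx|]; [rewrite mulf_neq0// ?n0 ?q0|exact: cont_onM].
exists (fun x => (k x * ((s x).1 * a x - (s x).2 * b x),
                  k x * ((s x).1 * b x + (s x).2 * a x))).
  apply: cont_on_pair; apply: cont_onM => //; first by apply: cont_onB; exact: cont_onM.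
  by apply: cont_onD; exact: cont_onM.
move=> x Kx; have ax := a0 x Kx; have qx := q0 x Kx; have nx := n0 x Kx.
have r2 : r x ^+ 2 = w1 x ^+ 2 + b x ^+ 2.
  by rewrite /r sqr_sqrtr// addr_ge0// sqr_ge0.
have q2 : q x ^+ 2 = 2 * a x by rewrite /q sqr_sqrtr// mulr_ge0// ltW.
have k2 : k x ^+ 2 = (n x ^+ 2 * (2 * a x))^-1 by rewrite /k -q2 exprVn exprMn.
have nn : n x ^+ 2 * (2 * a x) != 0 by rewrite mulf_neq0 ?expf_neq0// mulf_neq0// gt_eqF.
have ab : a x ^+ 2 - b x ^+ 2 = 2 * a x * w1 x.
  transitivity (w1 x ^+ 2 + 2 * w1 x * r x + r x ^+ 2 - b x ^+ 2); first by rewrite /a; ring.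
  by rewrite r2 /a; ring.
rewrite [RHS]surjective_pairing /csquare/=; congr pair.
  transitivity (k x ^+ 2 * ((n x ^+ 2 * (2 * a x)) * (h x).1)); last first.
    by rewrite k2 mulKf.
  transitivity (k x ^+ 2 * (((s x).1 ^+ 2 - (s x).2 ^+ 2) * (a x ^+ 2 - b x ^+ 2)
     - 4 * (s x).1 * (s x).2 * a x * b x)); first by ring.
  by congr *%R; rewrite ab /w1 /b /n /dotp /csquare/=; ring.
transitivity (k x ^+ 2 * ((n x ^+ 2 * (2 * a x)) * (h x).2)); last first.
  by rewrite k2 mulKf.
transitivity (k x ^+ 2 * (((s x).1 ^+ 2 - (s x).2 ^+ 2) * (2 * a x * b x)
   + 2 * (s x).1 * (s x).2 * (a x ^+ 2 - b x ^+ 2))); first by ring.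
by congr *%R; rewrite ab /w1 /b /n /dotp /csquare/=; ring.
Qed.

Lemma has_sqrtS (T : topologicalType) (A B : set T) (h : T -> plane) :
  A `<=` B -> has_sqrt B h -> has_sqrt A h.
Proof.
by move=> AB [s sB sh]; exists s => [|x /AB]; [exact: cont_onS sB|exact: sh].
Qed.

Lemma eq_has_sqrt (T : topologicalType) (A : set T) (h g : T -> plane) :
  (forall x, A x -> h x = g x) -> has_sqrt A h -> has_sqrt A g.
Proof. by move=> hg [s sA sh]; exists s => // x Ax; rewrite sh// hg. Qed.

Lemma dotp_gt0 (a : plane) : a <> 0 -> 0 < dotp a a.
Proof.
move=> a0; have [a1|a1] := eqVneq a.1 0.
  have a2 : a.2 != 0 by apply/eqP => a2; apply: a0; rewrite [a]surjective_pairing a1 a2.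
  by rewrite /dotp a1 mul0r add0r -expr2 exprn_even_gt0.
by rewrite /dotp ltr_pwDl// -?expr2 ?sqr_ge0// exprn_even_gt0.
Qed.

(** Acute angles are what [has_sqrt_approx] needs to carry a root from one function to a nearby
    one. *)
Lemma near_dotp_gt0 (a : plane) : a <> 0 ->
  exists2 N, nbhs a N & forall x y, N x -> N y -> 0 < dotp x y.
Proof.
move=> a0; pose d (p : plane * plane) := dotp p.1 p.2.
have dc : cont_on setT d.
  by apply: cont_on_dotp; [apply: cont_on_fst|apply: cont_on_snd]; exact: cont_on_id.
have : nbhs (d (a, a)) [set x | 0 < x].
  by apply: open_nbhs_nbhs; split; [exact: open_gt|exact: dotp_gt0].
move=> /(cont_on_near dc I)[[N M] /= [Na Ma] NM].
exists (N `&` M) => [|x y [Nx _] [_ My]]; first exact: filterI.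
by have := NM (x, y); apply.
Qed.

Lemma has_sqrt_cst (T : topologicalType) (K : set T) (a : plane) : a <> 0 ->
  has_sqrt K (fun=> a).
Proof.
(* A suitable [s] is found among the complex numbers 1, i, 1 + i and 1 - i, whose squares point
   along the four half axes. *)
move=> a0; suff [s sa] : exists s, 0 < dotp (csquare s) a.
  by apply: (@has_sqrt_approx _ _ (fun=> s)) => //; exact: cont_on_cst.
have [a1|a1|a1] := ltrgt0P a.1.
- by exists (1, 0); rewrite /dotp/=; nra.
- by exists (0, 1); rewrite /dotp/=; nra.
- have [a2|a2|a2] := ltrgt0P a.2.
  + by exists (1, 1); rewrite /dotp/= a1; nra.
  + by exists (1, -1); rewrite /dotp/= a1; nra.
  + by case: a0; rewrite [a]surjective_pairing a1 a2.
Qed.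

Definition itv01 : set R := `[0, 1]%classic.

Lemma itv01E (t : R) : itv01 t = (0 <= t <= 1).
Proof. by rewrite /itv01 /= in_itv. Qed.

(** Having a root is locally constant in the time [t]: by compactness of [K], the values at two
    close times make an acute angle at every point, so a root for one time approximates a root for
    the other. *)
Lemma has_sqrt_homotopy (T : topologicalType) (K : set T) (H : R * T -> plane) :
  compact K -> cont_on (itv01 `*` K) H ->
  (forall t x, itv01 t -> K x -> H (t, x) <> 0) ->
  has_sqrt K (fun x => H (0, x)) -> has_sqrt K (fun x => H (1, x)).
Proof.
move=> cK HK H0.
have sliceK t : itv01 t -> cont_on K (fun x => H (t, x)).
  move=> t01; apply: (@cont_on_comp _ _ _ K (itv01 `*` K)) => //.
  by apply: cont_on_pair; [exact: cont_on_cst|exact: cont_on_id].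
apply: (@connected_locally_constant _ itv01 (fun t => has_sqrt K (fun x => H (t, x)))).
- exact: segment_connected.
- move=> t t01.
  have cov : \forall u \near t, K `<=` (fun x => itv01 u -> K x -> 0 < dotp (H (u, x)) (H (t, x))).
    have /compact_near_coveringP/(_ R (nbhs t)
      (fun u x => itv01 u -> K x -> 0 < dotp (H (u, x)) (H (t, x)))) := cK.
    apply=> x Kx.
    have [N NH Npos] := near_dotp_gt0 (H0 t x t01 Kx).
    have [[U V] /= [Ut Vx] UV] := @cont_on_near _ _ _ _ (t, x) _ HK (conj t01 Kx) NH.
    exists (V, U) => //= -[y u] /= [Vy Uu] u01 Ky; apply: Npos.
      by apply: (UV (u, y)).
    by apply: (UV (t, y)) => //; split=> //; exact: nbhs_singleton Ut.
  apply: filterS cov => u cov u01; split=> -[s sK sh].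
    apply: (has_sqrt_approx sK (sliceK _ t01)) => x Kx.
    by rewrite sh//; exact: cov.
  apply: (has_sqrt_approx sK (sliceK _ u01)) => x Kx.
  by rewrite sh// /dotp mulrC [X in _ + X]mulrC; exact: cov.
- by rewrite itv01E lexx ler01.
- by rewrite itv01E lexx ler01.
Qed.

(** The contraction is a homotopy from a nonzero constant to [h]. *)
Lemma has_sqrt_contractible (T : topologicalType) (K : set T) (c : R * T -> T)
    (x0 : T) (h : T -> plane) :
  compact K -> cont_on (itv01 `*` K) c ->
  (forall t x, itv01 t -> K x -> K (c (t, x))) ->
  (forall x, K x -> c (0, x) = x0 /\ c (1, x) = x) ->
  cont_on K h -> (forall x, K x -> h x <> 0) -> has_sqrt K h.
Proof.
move=> cK cc cKK c01 hK h0.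
have [K0|/set0P[x Kx]] := eqVneq K set0.
  by rewrite K0; exists (fun=> 0) => [x|x].
have z01 : itv01 0 by rewrite itv01E lexx ler01.
have Kx0 : K x0 by rewrite -(c01 x Kx).1; exact: cKK.
apply: (@eq_has_sqrt _ _ (fun x => h (c (1, x)))) => [y Ky|].
  by rewrite (c01 y Ky).2.
apply: (@has_sqrt_homotopy _ _ (fun p => h (c p))) => //.
- by apply: (@cont_on_comp _ _ _ _ K) => // -[t y] [/= t01 Ky]; exact: cKK.
- by move=> t y t01 Ky; apply: h0; exact: cKK.
- apply: (@eq_has_sqrt _ _ (fun=> h x0)) => [y Ky|]; first by rewrite (c01 y Ky).1.
  by apply: has_sqrt_cst; exact: h0.
Qed.

Lemma has_sqrt_image (T U : topologicalType) (x0 : T) (K : set T)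
    (f : T -> U) (h : U -> plane) :
  hausdorff_space U -> compact K -> cont_on K f -> inj_on K f ->
  has_sqrt K (fun x => h (f x)) -> has_sqrt (f @` K) h.
Proof.
move=> hU cK fK fI [s sK sh].
have [g gf gK] := compact_inverse x0 hU cK fK fI.
exists (fun y => s (g y)) => [|_ [x Kx <-]]; last by rewrite gf// sh.
by apply: (@cont_on_comp _ _ _ _ K) => // _ [x Kx <-]; rewrite gf.
Qed.

End Sqrt.

(** * Parity of winding numbers in the plane *)

Section Planar.
Variable R : realType.
Local Notation plane := (R * R)%type.
Local Notation odisk := (@open_disk R).
Local Notation cdisk := (@closed_disk R).
Local Notation circle := (@unit_circle R).

Definition norm2 (z : plane) : R := z.1 ^+ 2 + z.2 ^+ 2.

Lemma cont_on_norm2 (T : topologicalType) (K : set T) (f : T -> plane) :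
  cont_on K f -> cont_on K (fun x => norm2 (f x)).
Proof.
by move=> fK; apply: cont_onD; apply: cont_onX; [exact: cont_on_fst|exact: cont_on_snd].
Qed.

Lemma cont_on_subp (T : topologicalType) (K : set T) (f g : T -> plane) :
  cont_on K f -> cont_on K g -> cont_on K (fun x => f x - g x).
Proof.
move=> fK gK; have := cont_on_pair (cont_onB (cont_on_fst fK) (cont_on_fst gK))
  (cont_onB (cont_on_snd fK) (cont_on_snd gK)).
by apply: eq_cont_on => x _.
Qed.

Lemma cont_on_addp (T : topologicalType) (K : set T) (f g : T -> plane) :
  cont_on K f -> cont_on K g -> cont_on K (fun x => f x + g x).
Proof.
move=> fK gK; have := cont_on_pair (cont_onD (cont_on_fst fK) (cont_on_fst gK))
  (cont_onD (cont_on_snd fK) (cont_on_snd gK)).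
by apply: eq_cont_on => x _.
Qed.

Lemma cont_on_scalep (T : topologicalType) (K : set T) (c : T -> R) (f : T -> plane) :
  cont_on K c -> cont_on K f -> cont_on K (fun x => c x *: f x).
Proof.
move=> cK fK; have := cont_on_pair (cont_onM cK (cont_on_fst fK))
  (cont_onM cK (cont_on_snd fK)).
by apply: eq_cont_on => x _.
Qed.

Lemma norm2_ge0 z : 0 <= norm2 z.
Proof. by rewrite addr_ge0// sqr_ge0. Qed.

Lemma norm2Z a z : norm2 (a *: z) = a ^+ 2 * norm2 z.
Proof. by rewrite /norm2/= !exprMn mulrDr. Qed.

Lemma norm2N z : norm2 (- z) = norm2 z.
Proof. by rewrite /norm2/= !sqrrN. Qed.

Lemma norm2_eq0 z : norm2 z = 0 -> z = 0.
Proof.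
move=> z0; rewrite [z]surjective_pairing; congr pair; rewrite /norm2 in z0; nra.
Qed.

Lemma disk_bound z : cdisk z -> (-1 <= z.1 <= 1) /\ (-1 <= z.2 <= 1).
Proof. by rewrite /closed_disk/= => z1; split; apply/andP; split; nra. Qed.

Lemma circle_cdisk : circle `<=` cdisk.
Proof. by move=> z; rewrite /unit_circle /closed_disk/= => ->. Qed.

Lemma odisk_cdisk : odisk `<=` cdisk.
Proof. by move=> z; rewrite /open_disk /closed_disk/= => /ltW. Qed.

Lemma odisk0 : odisk 0.
Proof. by rewrite /open_disk/= expr0n/= addr0 ltr01. Qed.

Lemma cdisk_star t z : itv01 t -> cdisk z -> cdisk (t *: z).
Proof.
rewrite itv01E => /andP[t0 t1]; rewrite /closed_disk /= -/(norm2 z) -/(norm2 (t *: z)).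
by rewrite norm2Z => /(le_trans _); apply; rewrite ler_piMl ?norm2_ge0// exprn_ile1.
Qed.

Lemma odisk_star t z : itv01 t -> odisk z -> odisk (t *: z).
Proof.
rewrite itv01E => /andP[t0 t1]; rewrite /open_disk /= -/(norm2 z) -/(norm2 (t *: z)).
by rewrite norm2Z => /(le_lt_trans _); apply; rewrite ler_piMl ?norm2_ge0// exprn_ile1.
Qed.

Lemma open_odisk : open odisk.
Proof.
have := cont_on_open openT (cont_on_norm2 (@cont_on_id _ setT)) (@open_lt R 1).
by rewrite setTI.
Qed.

Lemma closed_norm2 (A : set R) : closed A -> closed (norm2 @^-1` A).
Proof.
move=> cA; rewrite -[X in closed X]setCK; apply: open_closedC.
have := cont_on_open openT (cont_on_norm2 (@cont_on_id _ setT)) (closed_openC cA).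
by rewrite setTI preimage_setC.
Qed.

Lemma closed_cdisk : closed cdisk.
Proof. exact: (closed_norm2 (@closed_le R 1)). Qed.

Lemma closed_circle : closed circle.
Proof. exact: (closed_norm2 (@closed_eq R 1)). Qed.

Lemma compact_cdisk : compact cdisk.
Proof.
apply: (@subclosed_compact _ _ ([set` `[-1 : R, 1]] `*` [set` `[-1 : R, 1]])).
- exact: closed_cdisk.
- by apply: compact_setX; exact: segment_compact.
- by move=> z /disk_bound[z1 z2]; split; rewrite /= in_itv.
Qed.

Lemma compact_circle : compact circle.
Proof. by apply: (subclosed_compact closed_circle compact_cdisk); exact: circle_cdisk. Qed.

Lemma hausdorff_plane : hausdorff_space plane.
Proof. exact: norm_hausdorff. Qed.

(* If [K] is a simple closed curve avoiding [q], this says that its winding number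
   around [q] is even. *)
Definition even_around (K : set plane) (q : plane) := has_sqrt K (fun z => z - q).

Lemma even_aroundS K L q : K `<=` L -> even_around L q -> even_around K q.
Proof. exact: has_sqrtS. Qed.

Lemma cont_on_subq K q : cont_on K (fun z : plane => z - q).
Proof. by apply: cont_on_subp; [exact: cont_on_id|exact: cont_on_cst]. Qed.

(** For [p] close to [q], the vectors [z - p] and [z - q] make an acute angle for all [z] in the
    compact set [K]. *)
Lemma even_around_near K q : compact K -> ~ K q ->
  \forall p \near q, ~ K p -> (even_around K p <-> even_around K q).
Proof.
move=> cK Kq.
have cov : \forall p \near q, K `<=` (fun z => K z -> 0 < dotp (z - p) (z - q)).
  have /compact_near_coveringP/(_ plane (nbhs q)
    (fun p z => K z -> 0 < dotp (z - p) (z - q))) := cK.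
  apply=> z Kz.
  have zq : z - q <> 0 by move/eqP; rewrite subr_eq0 => /eqP zq; apply: Kq; rewrite -zq.
  have [N NH Npos] := near_dotp_gt0 zq.
  have cc : cont_on setT (fun p : plane * plane => p.1 - p.2).
    by apply: cont_on_subp; [apply: cont_on_fst|apply: cont_on_snd]; exact: cont_on_id.
  have [[U V] /= [Uz Vq] UV] := @cont_on_near _ _ _ _ (z, q) _ cc I NH.
  exists (U, V) => //= -[y p] /= [Uy Vp] Ky; apply: Npos; first exact: (UV (y, p)).
  by apply: (UV (y, q)) => //; split=> //; exact: nbhs_singleton Vq.
apply: filterS cov => p cov nKp; split=> -[s sK sh].
  apply: (has_sqrt_approx sK (@cont_on_subq K q)) => x Kx.
  by rewrite sh//; exact: cov.
apply: (has_sqrt_approx sK (@cont_on_subq K p)) => x Kx.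
by rewrite sh// /dotp mulrC [X in _ + X]mulrC; exact: cov.
Qed.

Lemma even_around_connected K A p q : compact K -> connected A ->
  (forall z, A z -> ~ K z) -> A p -> A q -> even_around K p -> even_around K q.
Proof.
move=> cK cA AK Ap Aq; apply: (connected_locally_constant cA) Ap Aq => z Az.
by apply: filterS (even_around_near cK (AK z Az)) => y h Ay; apply: h; exact: AK.
Qed.

(** Shrinking [K] to the origin never hits [q]: a point [t *: z] of norm at least 1 with [z] in the
    unit disk and [t] at most 1 has [t = 1], and then it lies on [K]. *)
Lemma even_around_outside K q : compact K -> K `<=` cdisk -> ~ K q -> 1 <= norm2 q ->
  even_around K q.
Proof.
move=> cK Kd Kq q1; rewrite /even_around.
apply: (@eq_has_sqrt _ _ _ (fun z : plane => 1 *: z - q)) => [z _|]; first by rewrite scale1r.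
apply: (@has_sqrt_homotopy _ _ _ (fun p : R * plane => p.1 *: p.2 - q)) => //.
- apply: cont_on_subp; last exact: cont_on_cst.
  by apply: cont_on_scalep; [apply: cont_on_fst|apply: cont_on_snd]; exact: cont_on_id.
- move=> t z; rewrite itv01E => /andP[t0 t1] Kz /= /eqP; rewrite subr_eq0 => /eqP zq.
  have z1 : norm2 z <= 1 := Kd z Kz.
  move: q1; rewrite -zq norm2Z => q1.
  have t2 : t = 1 by have := norm2_ge0 z; nra.
  by apply: Kq; rewrite -zq t2 scale1r.
- apply: (@eq_has_sqrt _ _ _ (fun=> - q)) => [z _|]; first by rewrite scale0r sub0r.
  apply: has_sqrt_cst => /eqP; rewrite oppr_eq0 => /eqP q0.
  by move: q1; rewrite q0 /norm2/= expr0n/= addr0 lt_geF// ltr01.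
Qed.

(** A set that is star-shaped about 0 contracts, so a nowhere zero function on it has a root, which
    the inverse of [f] carries to the image. *)
Lemma even_around_disk_image (Z : set plane) (f : plane -> plane) q :
  compact Z -> (forall t z, itv01 t -> Z z -> Z (t *: z)) ->
  cont_on Z f -> inj_on Z f -> ~ (f @` Z) q -> even_around (f @` Z) q.
Proof.
move=> cZ sZ fZ fI fq; rewrite /even_around; apply: (@has_sqrt_image R _ _ (0 : plane) Z f) => //.
apply: (@has_sqrt_contractible _ _ _ (fun p : R * plane => p.1 *: p.2) 0) => //.
- by apply: cont_on_scalep; [apply: cont_on_fst|apply: cont_on_snd]; exact: cont_on_id.
- by move=> x Zx /=; rewrite scale0r scale1r.
- by apply: cont_on_subp => //; exact: cont_on_cst.
- by move=> x Zx /eqP; rewrite subr_eq0 => /eqP xq; apply: fq; exists x.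
Qed.

Lemma even_around_path_image (f : R -> plane) q :
  cont_on (@itv01 R) f -> inj_on (@itv01 R) f -> ~ (f @` (@itv01 R)) q ->
  even_around (f @` (@itv01 R)) q.
Proof.
move=> fZ fI fq; rewrite /even_around; apply: (@has_sqrt_image R _ _ (0 : R) (@itv01 R) f) => //.
  exact: segment_compact.
apply: (@has_sqrt_contractible _ _ _ (fun p : R * R => p.1 * p.2) 0) => //.
- exact: segment_compact.
- by apply: cont_onM; [apply: cont_on_fst|apply: cont_on_snd]; exact: cont_on_id.
- move=> t x; rewrite !itv01E => /andP[t0 t1] /andP[x0 x1] /=.
  by rewrite mulr_ge0//= mulr_ile1.
- by move=> x Zx /=; rewrite mul0r mul1r.
- by apply: cont_on_subp => //; exact: cont_on_cst.
- by move=> x Zx /eqP; rewrite subr_eq0 => /eqP xq; apply: fq; exists x.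
Qed.

(* An odd map of the circle has no square root g: g (- c) would be i * g c or
   - i * g c, with a constant sign, and applying this twice gives g c = - g c. *)
Lemma odd_no_sqrt (h : plane -> plane) :
  (forall c, circle c -> h c <> 0) ->
  (forall c, circle c -> h (- c) = - h c) -> ~ has_sqrt circle h.
Proof.
move=> h0 hodd [g gK gh].
pose e (t : R) : plane := (cos t, sin t).
have eC t : circle (e t) by rewrite /unit_circle/= cos2Dsin2.
have NC c : circle c -> circle (- c).
  by rewrite /unit_circle/= -/(norm2 c) -/(norm2 (- c)) norm2N.
have ec : cont_on setT e.
  apply: cont_on_pair; apply: continuous_cont_on.
    exact: continuous_cos.
  exact: continuous_sin.
pose a t := g (e t); pose b t := g (- e t).
have ac : cont_on setT a.
  by apply: (@cont_on_comp _ _ _ _ circle) => // t _; exact: eC.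
have bc : cont_on setT b.
  apply: (@cont_on_comp _ _ _ _ circle) => //; first by move=> t _; exact/NC/eC.
  apply: (@eq_cont_on _ _ _ (fun t => 0 - e t)) => [t _|]; first by rewrite sub0r.
  by apply: cont_on_subp => //; exact: cont_on_cst.
(* The cross product of the roots at two antipodal points. It never vanishes, because [b t] is i or
   - i times [a t]; but a half turn exchanges [a] and [b] and so reverses its sign. *)
pose k t := (a t).1 * (b t).2 - (a t).2 * (b t).1.
have kc : cont_on setT k.
  by apply: cont_onB; apply: cont_onM; (exact: cont_on_fst || exact: cont_on_snd).
have k0 t : k t != 0.
  have := gh _ (NC _ (eC t)); rewrite hodd; last exact: eC.
  rewrite -(gh _ (eC t)) -/(a t) -/(b t) => -[]; rewrite /csquare/= => e1 e2.
  have : 0 < norm2 (a t).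
    rewrite lt_neqAle norm2_ge0 andbT eq_sym; apply/eqP => /norm2_eq0 at0.
    have := gh _ (eC t); rewrite -/(a t) at0 /csquare/= expr0n/= mul0r mulr0 subrr => /esym.
    exact: h0.
  rewrite /norm2 /k => n0; apply/eqP => k0.
  have : ((a t).1 * (b t).1 + (a t).2 * (b t).2) ^+ 2 +
         ((a t).1 ^+ 2 + (a t).2 ^+ 2) ^+ 2 =
         ((a t).1 * (b t).2 - (a t).2 * (b t).1) ^+ 2.
    have -> : ((a t).1 * (b t).1 + (a t).2 * (b t).2) ^+ 2 =
      ((a t).1 * (b t).2 - (a t).2 * (b t).1) ^+ 2 +
      (((b t).1 ^+ 2 - (b t).2 ^+ 2) * ((a t).1 ^+ 2 - (a t).2 ^+ 2) +
       (2 * ((b t).1 * (b t).2)) * (2 * ((a t).1 * (a t).2))) by ring.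
    by rewrite e1 e2; ring.
  rewrite k0 expr0n/=; have := sqr_ge0 ((a t).1 * (b t).1 + (a t).2 * (b t).2); nra.
have kpi t : k (t + pi) = - k t.
  have epi : e (t + pi) = - e t by rewrite /e cosDpi sinDpi.
  by rewrite /k /a /b epi opprK; ring.
have const s t : s \in `[0, pi] -> t \in `[0, pi] -> 0 < k s -> 0 < k t.
  apply: (@connected_locally_constant _ `[0, pi]%classic (fun u => 0 < k u)).
    exact: segment_connected.
  move=> u _; have [ku|ku] := ltP 0 (k u).
    have := cont_on_near kc I (open_nbhs_nbhs (conj (@open_gt R 0) ku)).
    by apply: filterS => v /(_ I) /= kv _; rewrite kv.
  have ku' : k u < 0 by rewrite lt_neqAle k0.
  have := cont_on_near kc I (open_nbhs_nbhs (conj (@open_lt R 0) ku')).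
  by apply: filterS => v /(_ I) /= kv _; rewrite (lt_gtF kv).
have z0 : (0 : R) \in `[0, pi] by rewrite in_itv/= lexx pi_ge0.
have zpi : (pi : R) \in `[0, pi] by rewrite in_itv/= lexx pi_ge0.
have := kpi 0; rewrite add0r => kp.
have [k00|k00] := ltP 0 (k 0).
  by have := const _ _ z0 zpi k00; rewrite kp oppr_gt0 => /(lt_trans k00); rewrite ltxx.
have k00' : 0 < k pi by rewrite kp oppr_gt0 lt_neqAle k0.
by have := const _ _ zpi z0 k00'; rewrite ltNge k00.
Qed.

(* Borsuk's homotopy f (c / (1 + t)) - f (- t c / (1 + t)) joins f c - f 0 to an odd
   map, and it does not vanish since f is injective. *)
Lemma odd_around_center (f : plane -> plane) : cont_on cdisk f -> inj_on cdisk f ->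
  ~ even_around (f @` circle) (f 0).
Proof.
move=> fc fI [s sK sh].
pose H (p : R * plane) := f ((1 + p.1)^-1 *: p.2) - f (- (p.1 / (1 + p.1)) *: p.2).
have d1 t c : itv01 t -> circle c -> cdisk ((1 + t)^-1 *: c).
  rewrite itv01E => /andP[t0 t1] /circle_cdisk; apply: cdisk_star.
  by rewrite itv01E invr_ge0 addr_ge0//= invf_le1 ?ltr_pwDl// lerDl.
have d2 t c : itv01 t -> circle c -> cdisk (- (t / (1 + t)) *: c).
  rewrite itv01E => /andP[t0 t1] /circle_cdisk cc; rewrite scaleNr -scalerN.
  apply: cdisk_star; last by rewrite /closed_disk/= !sqrrN.
  by rewrite itv01E divr_ge0 ?addr_ge0//= ler_pdivrMr ?ltr_pwDl// mul1r lerDr.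
have tn (t : R) : itv01 t -> 1 + t != 0.
  by rewrite itv01E => /andP[t0 t1]; rewrite gt_eqF// ltr_pwDl.
have sc : has_sqrt circle (fun c => H (0, c)).
  exists (fun c => s (f c)) => [|c cc].
    apply: (@cont_on_comp _ _ _ _ (f @` circle)) => //.
    by apply: cont_onS fc; exact: circle_cdisk.
  by rewrite sh; [rewrite /H/= addr0 invr1 scale1r mul0r oppr0 scale0r|exists c].
have Hc : cont_on (@itv01 R `*` circle) H.
  have p1 : cont_on (@itv01 R `*` circle) (fun p : R * plane => p.1) by apply: cont_on_fst; exact: cont_on_id.
  have p2 : cont_on (@itv01 R `*` circle) (fun p : R * plane => p.2) by apply: cont_on_snd; exact: cont_on_id.
  have pv : cont_on (@itv01 R `*` circle) (fun p : R * plane => (1 + p.1)^-1).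
    apply: cont_onV => [p [/tn]//|]; apply: cont_onD => //; exact: cont_on_cst.
  apply: cont_on_subp.
    apply: (@cont_on_comp _ _ _ _ cdisk) => //; first by move=> p [tp cp]; exact: d1.
    exact: cont_on_scalep.
  apply: (@cont_on_comp _ _ _ _ cdisk) => //; first by move=> p [tp cp]; exact: d2.
  by apply: cont_on_scalep => //; apply: cont_onN; exact: cont_onM.
have H0 t c : itv01 t -> circle c -> H (t, c) <> 0.
  move=> t01 cc /eqP; rewrite subr_eq0 => /eqP.
  move=> /(fI _ _ (d1 _ _ t01 cc) (d2 _ _ t01 cc))/eqP; rewrite -subr_eq0 -scalerBl opprK.
  rewrite -[X in X + _]mul1r -mulrDl divff ?tn// scale1r => /eqP c0.
  by move: cc; rewrite c0 /unit_circle/= expr0n/= addr0 => /esym/eqP; rewrite oner_eq0.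
have one01 : itv01 (1 : R) by rewrite itv01E ler01 lexx.
have := has_sqrt_homotopy compact_circle Hc H0 sc.
apply: odd_no_sqrt => c cc; first exact: H0.
by rewrite /H/= opprB div1r !scaleNr !scalerN opprK.
Qed.

Lemma star_connected (Z : set plane) :
  (forall t z, itv01 t -> Z z -> Z (t *: z)) -> connected Z.
Proof.
move=> sZ.
have -> : Z = \bigcup_(z in Z) ((fun t : R => t *: z) @` (@itv01 R)).
  apply/seteqP; split=> [z Zz|z [y Zy [t t01 <-]]]; last exact: sZ.
  by exists z => //; exists 1; rewrite ?scale1r// itv01E ler01 lexx.
apply: bigcup_connected.
  by exists 0 => z Zz; exists 0; rewrite ?scale0r// itv01E ler01 lexx.
move=> z _; apply: cont_on_connected; last exact: segment_connected.
by apply: cont_on_scalep; [exact: cont_on_id|exact: cont_on_cst].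
Qed.

Lemma connected_odisk : connected odisk.
Proof. by apply: star_connected; exact: odisk_star. Qed.

Lemma odd_around_interior (f : plane -> plane) z :
  cont_on cdisk f -> inj_on cdisk f -> odisk z ->
  ~ even_around (f @` circle) (f z).
Proof.
move=> fc fI oz ev; apply: (odd_around_center fc fI).
have fo : connected (f @` odisk).
  apply: cont_on_connected connected_odisk; apply: cont_onS fc; exact: odisk_cdisk.
apply: (even_around_connected _ fo _ _ _ ev).
- apply: cont_on_compact compact_circle; apply: cont_onS fc; exact: circle_cdisk.
- move=> _ [y oy <-] [c cc cy].
  have {}cy := fI _ _ (circle_cdisk cc) (odisk_cdisk oy) cy.
  by move: oy; rewrite -cy /open_disk/= cc ltxx.
- by exists z.
- by exists 0 => //; exact: odisk0.
Qed.

(** The circle is odd around [f 0], hence around all nearby points. Around a point off the image of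
    the disk it would be even, since the whole image of the disk is. *)
Lemma disk_image_nbhs (f : plane -> plane) : cont_on cdisk f -> inj_on cdisk f ->
  nbhs (f 0) (f @` cdisk).
Proof.
move=> fc fI.
have cfc : compact (f @` circle).
  apply: cont_on_compact compact_circle; apply: cont_onS fc; exact: circle_cdisk.
have nf0 : ~ (f @` circle) (f 0).
  move=> [c cc c0]; have {}c0 := fI _ _ (circle_cdisk cc) (odisk_cdisk odisk0) c0.
  by move: cc; rewrite c0 /unit_circle/= expr0n/= addr0 => /esym/eqP; rewrite oner_eq0.
apply: filterS (even_around_near cfc nf0) => q h.
apply: contrapT => nq.
have nq' : ~ (f @` circle) q.
  by move=> [c cc cq]; apply: nq; exists c => //; exact: circle_cdisk.
apply: (odd_around_center fc fI); apply/(h nq').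
apply: (@even_aroundS _ (f @` cdisk)).
  by move=> _ [c cc <-]; exists c => //; exact: circle_cdisk.
by apply: even_around_disk_image => //; [exact: compact_cdisk|exact: cdisk_star].
Qed.

End Planar.

(** * Invariance of domain and theta curves *)

Section Domain.
Variable R : realType.
Local Notation plane := (R * R)%type.
Local Notation odisk := (@open_disk R).
Local Notation cdisk := (@closed_disk R).
Local Notation circle := (@unit_circle R).

Definition locally_disk (S : topologicalType) :=
  forall x : S, exists U : set S, [/\ open U, U x & homeomorphic U odisk].

(** A chart at [f a] moves the image of a small disk to the plane, where [disk_image_nbhs] applies;
    continuity of the chart brings the neighbourhood back to [S]. *)
Lemma invariance_of_domain (S : topologicalType) (W : set plane) (f : plane -> S) :
  locally_disk S -> open W -> cont_on W f -> inj_on W f -> open (f @` W).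
Proof.
move=> lS oW fW fI; rewrite openE => _ [a Wa <-].
have [U [oU Ufa [k [k' [/cont_onP kc _ kk' _]]]]] := lS (f a).
have oWU := cont_on_open oW fW oU.
have /nbhs_ballP[r /= r0 rW] : nbhs a (W `&` f @^-1` U) by exact: open_nbhs_nbhs.
have [h h0 rE] : exists2 h : R, 0 < h & r = h + h.
  by exists (r / 2); [rewrite divr_gt0|rewrite -splitr].
(* Half the radius keeps the image of the closed disk inside the open ball, which is a square for
   the product norm. *)
pose e z := a + h *: z.
have eW z : cdisk z -> (W `&` f @^-1` U) (e z).
  move=> /disk_bound[/andP[z1 z2] /andP[z3 z4]]; apply: rW; split => /=;
    rewrite -ball_normE /ball_/= ltr_distlC rE -[h *: _]/(h * _); apply/andP; split; nra.
have ec : cont_on cdisk e.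
  apply: cont_on_addp; first exact: cont_on_cst.
  by apply: cont_on_scalep; [exact: cont_on_cst|exact: cont_on_id].
have fec : cont_on cdisk (fun z => f (e z)).
  by apply: (@cont_on_comp _ _ _ _ W) => // z /eW[].
have gc : cont_on cdisk (fun z => k (f (e z))).
  by apply: (@cont_on_comp _ _ _ _ U) => // z /eW[].
have gI : inj_on cdisk (fun z => k (f (e z))).
  move=> x y xd yd /(congr1 k'); have [Wx Ux] := eW x xd; have [Wy Uy] := eW y yd.
  rewrite !(kk' _ _).2// => /(fI _ _ Wx Wy).
  by move=> /addrI/scalerI; apply; rewrite gt_eqF.
have := disk_image_nbhs gc gI; rewrite {1}/e scaler0 addr0.
move=> /(cont_on_near kc Ufa); apply: filterS2 (open_nbhs_nbhs (conj oU Ufa)).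
move=> y Uy /(_ Uy)[z zd zy]; have [Wz Uz] := eW z zd; exists (e z) => //.
by have := congr1 k' zy; rewrite !(kk' _ _).2.
Qed.

Lemma plane_locally_disk : locally_disk plane.
Proof.
move=> x; pose f z : plane := z - x; pose g z : plane := z + x.
have fc A : cont_on A f by exact: cont_on_subq.
have gc A : cont_on A g by apply: cont_on_addp; [exact: cont_on_id|exact: cont_on_cst].
exists (f @^-1` odisk); split.
- by have := cont_on_open openT (fc setT) (@open_odisk R); rewrite setTI.
- by rewrite /= /f subrr; exact: odisk0.
- exists f, g; split.
  + exact/cont_onP.
  + exact/cont_onP.
  + by move=> z fz; split => //; rewrite /f /g subrK.
  + by move=> z fz; split; rewrite /f /g /= addrK.
Qed.

(** Invariance of domain for the inverse of [k], read in a chart of [S]. It turns a neighbourhood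
    contained in the image of [K] into a neighbourhood contained in [K]. *)
Lemma invariance_of_domain_inverse (S : topologicalType) (K : set plane)
    (k : plane -> S) (N : set S) : hausdorff_space S -> locally_disk S ->
  compact K -> cont_on K k -> inj_on K k -> open N -> N `<=` k @` K ->
  open (K `&` k @^-1` N).
Proof.
move=> hS lS cK kc kI oN NK.
have [g gk gc] := compact_inverse (0 : plane) hS cK kc kI.
have kg y : (k @` K) y -> k (g y) = y by move=> [z Kz <-]; rewrite gk.
rewrite openE => z [Kz Nkz].
have [U [oU Ukz [u [u' [_ /cont_onP u'c uu' u'u]]]]] := lS (k z).
have oW := cont_on_open (@open_odisk R) u'c oN.
have WI : inj_on (odisk `&` u' @^-1` N) (fun v => g (u' v)).
  move=> v w [ov Nv] [ow Nw] /(congr1 k); rewrite !kg; [|exact: NK|exact: NK].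
  by move=> /(congr1 u); rewrite !(u'u _ _).2.
have Wc : cont_on (odisk `&` u' @^-1` N) (fun v => g (u' v)).
  apply: (@cont_on_comp _ _ _ _ (k @` K)) => //; first by move=> v [_ /NK].
  by apply: cont_onS u'c => v [].
have := invariance_of_domain plane_locally_disk oW Wc WI; rewrite openE => /(_ z).
have zW : ((fun v => g (u' v)) @` (odisk `&` u' @^-1` N)) z.
  exists (u (k z)); last by rewrite (uu' _ Ukz).2 gk.
  by split; [exact: (uu' _ Ukz).1|rewrite /= (uu' _ Ukz).2].
move=> /(_ zW); apply: filterS => _ [v [ov Nv] <-].
by have [y Ky yv] := NK _ Nv; split; rewrite /= -yv gk// yv.
Qed.

Lemma csq_eq (x y : plane) : csquare x = csquare y -> x = y \/ x = - y.
Proof.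
move=> -[]; rewrite [x]surjective_pairing [y]surjective_pairing/=.
move: x.1 x.2 y.1 y.2 => a b c d e1 e2.
have e3 : a * b = c * d by lra.
have : ((a - c) ^+ 2 + (b - d) ^+ 2) * ((a + c) ^+ 2 + (b + d) ^+ 2) = 0.
  have -> : ((a - c) ^+ 2 + (b - d) ^+ 2) * ((a + c) ^+ 2 + (b + d) ^+ 2) =
    (a ^+ 2 - b ^+ 2 - (c ^+ 2 - d ^+ 2)) ^+ 2 + 4 * (a * b - c * d) ^+ 2 by ring.
  by rewrite e1 e3 !subrr expr0n/= mulr0 addr0.
move=> /eqP; rewrite mulf_eq0 => /orP[/eqP h|/eqP h]; [left|right].
  have h' := @norm2_eq0 _ (a - c, b - d) h.
  have h1 : a - c = 0 := congr1 fst h'; have h2 : b - d = 0 := congr1 snd h'.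
  by congr pair; lra.
have h' := @norm2_eq0 _ (a + c, b + d) h.
have h1 : a + c = 0 := congr1 fst h'; have h2 : b + d = 0 := congr1 snd h'.
by rewrite [RHS]surjective_pairing/=; congr pair; lra.
Qed.

(** Two roots differ by a sign, which is the sign of their scalar product and cannot change on a
    connected set. *)
Lemma sqrt_unique (T : topologicalType) (A : set T) (s s' : T -> plane) a b :
  connected A -> cont_on A s -> cont_on A s' ->
  (forall x, A x -> csquare (s x) = csquare (s' x)) -> (forall x, A x -> s x <> 0) ->
  A a -> A b -> s a = s' a -> s b = s' b.
Proof.
move=> cA sA s'A ss' s0 Aa Ab sa.
have dA := cont_on_dotp sA s'A.
have dN x : dotp x (- x) = - dotp x x by rewrite /dotp/=; ring.
have dE x : A x -> 0 < dotp (s x) (s' x) <-> s x = s' x.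
  move=> Ax; split=> [|<-]; last exact/dotp_gt0/s0.
  have [//|/(congr1 -%R)] := csq_eq (ss' x Ax); rewrite opprK => <-.
  by rewrite dN oppr_gt0 => /lt_gtF; rewrite dotp_gt0//; exact: s0.
apply/dE => //; have /dE da := sa; move: (da Aa) => {}da.
apply: (@connected_locally_constant _ A (fun x => 0 < dotp (s x) (s' x))) Aa Ab da => // x Ax.
have [d0|d0] := ltP 0 (dotp (s x) (s' x)).
  have := cont_on_near dA Ax (open_nbhs_nbhs (conj (@open_gt R 0) d0)).
  by apply: filterS => y h Ay; rewrite (h Ay).
have d1 : dotp (s x) (s' x) < 0.
  have [sx|/(congr1 -%R)] := csq_eq (ss' x Ax).
    by move: d0; rewrite -sx leNgt dotp_gt0//; exact: s0.
  by rewrite opprK => <-; rewrite dN oppr_lt0; exact/dotp_gt0/s0.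
have := cont_on_near dA Ax (open_nbhs_nbhs (conj (@open_lt R 0) d1)).
by apply: filterS => y h Ay; have /= dy := h Ay; rewrite (lt_gtF dy).
Qed.

(** The properties of a simple arc on which the theta argument rests. They pass to two arcs joined
    at an end ([arclikeU]), without a parametrization of the union. *)
Definition arclike (K : set plane) :=
  [/\ compact K, connected K & forall q, ~ K q -> even_around K q].

Lemma arclike_path (f : R -> plane) : cont_on (@itv01 R) f -> inj_on (@itv01 R) f ->
  arclike (f @` (@itv01 R)).
Proof.
move=> fc fI; split.
- by apply: cont_on_compact => //; exact: segment_compact.
- by apply: cont_on_connected => //; exact: segment_connected.
- by move=> q; exact: even_around_path_image.
Qed.

Lemma glue_sqrt (T : topologicalType) (A B : set T) (sA sB h : T -> plane) :
  closed A -> closed B -> cont_on A sA -> cont_on B sB ->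
  (forall x, A x -> csquare (sA x) = h x) -> (forall x, B x -> csquare (sB x) = h x) ->
  (forall x, A x -> B x -> sA x = sB x) -> has_sqrt (A `|` B) h.
Proof.
move=> cA cB sAc sBc sAh sBh AB.
pose s x := if pselect (A x) is left _ then sA x else sB x.
have sEA x : A x -> s x = sA x by rewrite /s; case: pselect.
have sEB x : B x -> s x = sB x by rewrite /s; case: pselect => // Ax Bx; exact: AB.
exists s; last by move=> x [Ax|Bx]; [rewrite sEA// sAh|rewrite sEB// sBh].
by apply: cont_onU => //; [apply: eq_cont_on sAc|apply: eq_cont_on sBc] => x; [move=> /sEA|move=> /sEB].
Qed.

Lemma csqN (z : plane) : csquare (- z) = csquare z.
Proof. by rewrite /csquare/= !sqrrN mulrNN. Qed.

Lemma cont_on_oppp (T : topologicalType) (A : set T) (s : T -> plane) :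
  cont_on A s -> cont_on A (fun x => - s x).
Proof.
move=> sA; apply: (@eq_cont_on _ _ _ (fun x => 0 - s x)) => [x _|]; first by rewrite sub0r.
by apply: cont_on_subp => //; exact: cont_on_cst.
Qed.

Lemma compact_closed_plane (K : set plane) : compact K -> closed K.
Proof. by apply: compact_closed; exact: hausdorff_plane. Qed.

(** Roots on [A] and on [B] agree up to sign at the single common point, so after a change of sign
    they glue. *)
Lemma arclikeU A B a : arclike A -> arclike B -> A `&` B = [set a] -> arclike (A `|` B).
Proof.
move=> [cA nA eA] [cB nB eB] AB.
have [Aa Ba] : (A `&` B) a by rewrite AB.
split; first exact: compactU.
  by apply: connectedU => //; exists a; rewrite AB.
move=> q /not_orP[Aq Bq]; have [sA sAc sAh] := eA q Aq; have [sB sBc sBh] := eB q Bq.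
have clA := compact_closed_plane cA; have clB := compact_closed_plane cB.
have [ab|ab] : sA a = sB a \/ sA a = - sB a by apply: csq_eq; rewrite sAh// sBh.
  apply: (glue_sqrt clA clB sAc sBc) => // x Ax Bx.
  by have -> : x = a by have : (A `&` B) x by []; rewrite AB.
apply: (glue_sqrt clA clB sAc (cont_on_oppp sBc)) => // [x Bx|x Ax Bx].
  by rewrite csqN sBh.
by have -> : x = a by have : (A `&` B) x by []; rewrite AB.
Qed.

Lemma csq_neq0 (x : plane) : csquare x <> 0 -> x <> 0.
Proof. by move=> h x0; apply: h; rewrite x0 /csquare/= expr0n/= mul0r mulr0 subrr. Qed.

(** Each of the two roots is unique up to a global sign. They can be glued exactly when they differ
    by the same sign at both common points. *)
Lemma even_around_union A B a b q (sA sB : plane -> plane) :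
  arclike A -> arclike B -> A `&` B = [set a; b] -> ~ A q -> ~ B q ->
  cont_on A sA -> cont_on B sB ->
  (forall x, A x -> csquare (sA x) = x - q) -> (forall x, B x -> csquare (sB x) = x - q) ->
  even_around (A `|` B) q <-> (sA a = sB a <-> sA b = sB b).
Proof.
move=> [cA nA _] [cB nB _] AB Aq Bq sAc sBc sAh sBh.
have clA := compact_closed_plane cA; have clB := compact_closed_plane cB.
have [Aa Ba] : (A `&` B) a by rewrite AB; left.
have [Ab Bb] : (A `&` B) b by rewrite AB; right.
have xq X x : ~ X q -> X x -> x - q <> 0.
  by move=> Xq Xx /eqP; rewrite subr_eq0 => /eqP xq; apply: Xq; rewrite -xq.
have ABx x : A x -> B x -> x = a \/ x = b.
  by move=> Ax Bx; have : (A `&` B) x by []; rewrite AB.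
have sB0 x : B x -> sB x <> 0 by move=> Bx; apply: csq_neq0; rewrite sBh//; exact: (xq B).
have pm x : A x -> B x -> sA x = sB x \/ sA x = - sB x.
  by move=> Ax Bx; apply: csq_eq; rewrite sAh// sBh.
have Nneq x : B x -> sB x <> - sB x.
  move=> Bx e; apply: (sB0 x Bx); have e2 : sB x + sB x = 0 by rewrite {1}e addNr.
  have [e3 e4] : (sB x + sB x).1 = 0 /\ (sB x + sB x).2 = 0 by rewrite e2.
  by rewrite [LHS]surjective_pairing; congr pair; move: e3 e4 => /=; lra.
split=> [[s sc sh]|].
  have scA : cont_on A s by apply: cont_onS sc => x; left.
  have scB : cont_on B s by apply: cont_onS sc => x; right.
  have s0 x : A x \/ B x -> s x <> 0.
    move=> ABx'; apply: csq_neq0; rewrite sh//.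
    by case: ABx' => ?; [exact: (xq A)|exact: (xq B)].
  have uA x y : A x -> A y -> s x = sA x -> s y = sA y.
    apply: sqrt_unique => // z Az; last by apply: s0; left.
    by rewrite sh ?sAh//; left.
  have uB x y : B x -> B y -> s x = sB x -> s y = sB y.
    apply: sqrt_unique => // z Bz; last by apply: s0; right.
    by rewrite sh ?sBh//; right.
  have uA' x y : A x -> A y -> s x = - sA x -> s y = - sA y.
    apply: (sqrt_unique nA scA (cont_on_oppp sAc)) => z Az; last by apply: s0; left.
    by rewrite sh ?csqN ?sAh//; left.
  have pmA x : A x -> s x = sA x \/ s x = - sA x.
    by move=> Ax; apply: csq_eq; rewrite sh ?sAh//; left.
  have key x y : A x -> B x -> A y -> B y -> sA x = sB x -> sA y = sB y.
    move=> Ax Bx Ay By e; have [sx|sx] := pmA x Ax.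
      by rewrite -(uA x y)// -(uB x y)// sx.
    have sBx : s x = - sB x by rewrite sx e.
    have [sy|sy] := csq_eq (etrans (sh y (or_intror By)) (esym (sBh y By))).
      have := uB y x By Bx sy; rewrite sBx => /esym e'.
      by case: (Nneq x Bx).
    by apply: oppr_inj; rewrite -sy (uA' x y).
  by split; exact: key.
move=> e; have [ab|ab] := pselect (sA a = sB a).
  apply: (glue_sqrt clA clB sAc sBc) => // x Ax Bx.
  by have [->|->] := ABx x Ax Bx; [|exact/e].
have ab' : sA b <> sB b by move/e.
apply: (glue_sqrt clA clB sAc (cont_on_oppp sBc)) => // [x Bx|x Ax Bx].
  by rewrite csqN sBh.
have [xa|xb] := ABx x Ax Bx.
  by rewrite xa; have [] := pm a Aa Ba.
by rewrite xb; have [] := pm b Ab Bb.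
Qed.

(** At each end, the sign between the roots on [A] and [C] is the product of the signs between [A],
    [B] and between [B], [C]. So the parities of the three closed curves in the theta curve add up
    to zero mod 2. *)
Lemma theta_parity A B C a b q :
  arclike A -> arclike B -> arclike C ->
  A `&` B = [set a; b] -> B `&` C = [set a; b] -> A `&` C = [set a; b] ->
  ~ A q -> ~ B q -> ~ C q ->
  even_around (A `|` B) q <-> (even_around (B `|` C) q <-> even_around (A `|` C) q).
Proof.
move=> aA aB aC AB BC AC Aq Bq Cq.
have [cA nA /(_ q Aq)[sA sAc sAh]] := aA.
have [cB nB /(_ q Bq)[sB sBc sBh]] := aB.
have [cC nC /(_ q Cq)[sC sCc sCh]] := aC.
have HAB := even_around_union aA aB AB Aq Bq sAc sBc sAh sBh.
have HBC := even_around_union aB aC BC Bq Cq sBc sCc sBh sCh.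
have HAC := even_around_union aA aC AC Aq Cq sAc sCc sAh sCh.
have key x : A x -> B x -> C x -> (sA x = sC x <-> (sA x = sB x <-> sB x = sC x)).
  move=> Ax Bx Cx.
  have x0 : x - q <> 0.
    by move/eqP; rewrite subr_eq0 => /eqP xq; apply: Aq; rewrite -xq.
  have nn (z : plane) : csquare z = x - q -> z <> - z.
    move=> zq e; have e2 : z + z = 0 by rewrite {1}e addNr.
    have [e3 e4] : (z + z).1 = 0 /\ (z + z).2 = 0 by rewrite e2.
    apply: (@csq_neq0 z); first by rewrite zq.
    by rewrite [LHS]surjective_pairing; congr pair; move: e3 e4 => /=; lra.
  have nB' := nn _ (sBh x Bx); have nC' := nn _ (sCh x Cx).
  have h1 := csq_eq (etrans (sAh x Ax) (esym (sBh x Bx))).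
  have h2 := csq_eq (etrans (sBh x Bx) (esym (sCh x Cx))).
  have [e1|e1] := h1; rewrite e1.
    by split=> [e|[/(_ erefl)]].
  have nAB : - sB x <> sB x by move=> e; apply: nB'; rewrite e.
  have [e2|e2] := h2; rewrite e2.
    by split=> [e|[_ /(_ erefl) e]]; case: nC'; rewrite -e ?opprK.
  rewrite opprK; split=> // _; split=> e; case: nC'; by rewrite e.
have [Aa Ba] : (A `&` B) a by rewrite AB; left.
have [Ab Bb] : (A `&` B) b by rewrite AB; right.
have [_ Ca] : (B `&` C) a by rewrite BC; left.
have [_ Cb] : (B `&` C) b by rewrite BC; right.
have := key a Aa Ba Ca; have := key b Ab Bb Cb.
rewrite HAB HBC HAC => {HAB HBC HAC} -> ->.
have := pselect (sA a = sB a); have := pselect (sA b = sB b).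
have := pselect (sB a = sC a); have := pselect (sB b = sC b).
tauto.
Qed.

End Domain.

(** * Crossing an arc of a closed curve *)

Section Jump.
Variable R : realType.
Local Notation plane := (R * R)%type.
Local Notation odisk := (@open_disk R).
Local Notation cdisk := (@closed_disk R).
Local Notation circle := (@unit_circle R).

(** The upper half for [e = 1] and the lower half for [e = -1]. *)
Definition half_disk (e : R) : set plane := [set z | cdisk z /\ 0 <= e * z.2].

Lemma half_diskS e : half_disk e `<=` cdisk.
Proof. by move=> z []. Qed.

Lemma closed_half_disk e : closed (half_disk e).
Proof.
apply: closedI; first exact: closed_cdisk.
have c2 : cont_on setT (fun z : plane => e * z.2).
  by apply: cont_onM; [exact: cont_on_cst|apply: cont_on_snd; exact: cont_on_id].
rewrite -[X in closed X]setCK; apply: open_closedC.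
have := cont_on_open openT c2 (@open_lt R 0); rewrite setTI => o.
apply: (eq_ind _ open o); apply/seteqP; split=> z /=; first by move=> h; apply/negP; rewrite -ltNge.
by move=> /negP; rewrite -ltNge.
Qed.

Lemma compact_half_disk e : compact (half_disk e).
Proof.
apply: (subclosed_compact (@closed_half_disk e) (@compact_cdisk R)).
exact: half_diskS.
Qed.

Lemma half_disk_star e t z : itv01 t -> half_disk e z -> half_disk e (t *: z).
Proof.
move=> t01 [zd z0]; split; first exact: cdisk_star.
by move: t01; rewrite itv01E => /andP[t0 _] /=; rewrite mulrCA mulr_ge0.
Qed.

Lemma glue_half_disks (T : topologicalType) (h1 h2 : plane -> T) :
  cont_on (half_disk 1) h1 -> cont_on (half_disk (-1)) h2 ->
  inj_on (half_disk 1) h1 -> inj_on (half_disk (-1)) h2 ->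
  (forall x, cdisk (x, 0) -> h1 (x, 0) = h2 (x, 0)) ->
  (forall z w, cdisk z -> cdisk w -> 0 < z.2 -> w.2 < 0 -> h1 z <> h2 w) ->
  exists f : plane -> T, [/\ cont_on cdisk f, inj_on cdisk f,
    (forall z, cdisk z -> 0 <= z.2 -> f z = h1 z) &
    (forall z, cdisk z -> z.2 <= 0 -> f z = h2 z)].
Proof.
move=> c1 c2 i1 i2 h12 h1n2.
pose f z := if 0 <= z.2 then h1 z else h2 z.
have f1 z : cdisk z -> 0 <= z.2 -> f z = h1 z by rewrite /f => _ ->.
have f2 z : cdisk z -> z.2 <= 0 -> f z = h2 z.
  rewrite /f => zd z0; case: ifPn => // z0'.
  have z2 : z.2 = 0 by apply/eqP; rewrite eq_le z0 z0'.
  by rewrite [z]surjective_pairing z2 in zd *; exact: h12.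
have U z : cdisk z -> 0 <= z.2 -> half_disk 1 z by split=> //; rewrite mul1r.
have L z : cdisk z -> z.2 <= 0 -> half_disk (-1) z by split=> //; rewrite mulN1r oppr_ge0.
exists f; split=> //.
- have -> : cdisk = half_disk 1 `|` half_disk (-1).
    apply/seteqP; split=> [z zd|z [[]//|[]//]].
    by have [z0|/ltW z0] := leP 0 z.2; [left; exact: U|right; exact: L].
  apply: cont_onU; [exact: closed_half_disk|exact: closed_half_disk| |].
    by apply: eq_cont_on c1 => z [zd]; rewrite mul1r => z0; rewrite f1.
  by apply: eq_cont_on c2 => z [zd]; rewrite mulN1r oppr_ge0 => z0; rewrite f2.
- move=> z w zd wd.
  have [z0|z0] := leP 0 z.2; have [w0|w0] := leP 0 w.2.
  + by rewrite f1// f1//; apply: i1; exact: U.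
  + have [z00|z00] := eqVneq z.2 0.
      by rewrite f2 ?z00// f2 ?(ltW w0)//; apply: i2; apply: L; rewrite ?z00// ltW.
    by rewrite f1// (f2 w)// ?(ltW w0)// => /h1n2; case=> //; rewrite lt_neqAle eq_sym z00.
  + have [w00|w00] := eqVneq w.2 0.
      by rewrite f2 ?(ltW z0)// f2 ?w00//; apply: i2; apply: L; rewrite ?w00// ltW.
    by rewrite (f1 w)// (f2 z)// ?(ltW z0)// => /esym/h1n2; case=> //; rewrite lt_neqAle eq_sym w00.
  + by rewrite f2 ?(ltW z0)// f2 ?(ltW w0)//; apply: i2; apply: L; rewrite // ltW.
Qed.

(** Arcs from (-1, 0) to (1, 0): the upper semicircle for [c = 1], the diameter for [c = 0], the
    lower semicircle for [c = -1]. These three form a theta curve. *)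
Definition lens_arc (c t : R) : plane := (2 * t - 1, c * Num.sqrt (1 - (2 * t - 1) ^+ 2)).

Lemma sq2t1 (t : R) : itv01 t -> 0 <= 1 - (2 * t - 1) ^+ 2.
Proof. by rewrite itv01E => /andP[t0 t1]; nra. Qed.

Lemma arc_cdisk c t : -1 <= c <= 1 -> itv01 t -> cdisk (lens_arc c t).
Proof.
move=> /andP[c0 c1] /sq2t1 t01; rewrite /closed_disk/= exprMn sqr_sqrtr//.
have c2 : c ^+ 2 <= 1 by nra.
by rewrite -[leRHS](subrKC ((2 * t - 1) ^+ 2)) lerD2l ler_piMl.
Qed.

Lemma cont_on_arc c A : cont_on A (lens_arc c).
Proof.
have c1 : cont_on A (fun t : R => 2 * t - 1).
  by apply: cont_onB; [apply: cont_onM; [exact: cont_on_cst|exact: cont_on_id]|exact: cont_on_cst].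
apply: cont_on_pair => //; apply: cont_onM; first exact: cont_on_cst.
by apply: cont_on_sqrt; apply: cont_onB; [exact: cont_on_cst|exact: cont_onX].
Qed.

Lemma arc_inj c s t : lens_arc c s = lens_arc c t -> s = t.
Proof. by move=> /(congr1 fst)/=; lra. Qed.

Lemma arc0 c : lens_arc c 0 = (-1, 0).
Proof. by rewrite /lens_arc mulr0 add0r sqrrN expr1n subrr sqrtr0 mulr0. Qed.

Lemma arc1 c : lens_arc c 1 = (1, 0).
Proof. by rewrite /lens_arc mulr1 (_ : 2 - 1 = 1 :> R) ?expr1n ?subrr ?sqrtr0 ?mulr0//; lra. Qed.

Lemma arc_meet c d s t : itv01 s -> c != d -> lens_arc c s = lens_arc d t -> s = 0 \/ s = 1.
Proof.
move=> s01 cd e; have st : s = t by move: e => /(congr1 fst)/=; lra.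
move: e => /(congr1 snd)/=; rewrite -st => /eqP.
rewrite -subr_eq0 -mulrBl mulf_eq0 subr_eq0 (negbTE cd)/= sqrtr_eq0 => s1.
have /eqP : s * (1 - s) = 0 by have := sq2t1 s01; nra.
by rewrite mulf_eq0 subr_eq0 => /orP[/eqP|/eqP]; [left|right].
Qed.

Section Chart.
Variable f : plane -> plane.
Hypotheses (fc : cont_on cdisk f) (fI : inj_on cdisk f).

Let A c := (fun t => f (lens_arc c t)) @` (@itv01 R).

Let arclikeA c : -1 <= c <= 1 -> arclike (A c).
Proof.
move=> c1; apply: arclike_path.
  apply: (@cont_on_comp _ _ _ _ cdisk) => //; last exact: cont_on_arc.
  by move=> t t01; exact: arc_cdisk.
move=> s t s01 t01 /(fI (arc_cdisk c1 s01) (arc_cdisk c1 t01)).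
exact: arc_inj.
Qed.

Let AI c d : -1 <= c <= 1 -> -1 <= d <= 1 -> c != d ->
  A c `&` A d = [set f (-1, 0); f (1, 0)].
Proof.
move=> c1 d1 cd; apply/seteqP; split.
  move=> _ [[s s01 <-] [t t01 /(fI (arc_cdisk d1 t01) (arc_cdisk c1 s01))/esym]].
  by move=> /(arc_meet s01 cd)[->|->]; rewrite ?arc0 ?arc1; [left|right].
have z01 : itv01 (0 : R) by rewrite itv01E lexx ler01.
have o01 : itv01 (1 : R) by rewrite itv01E lexx ler01.
by move=> _ [->|->]; split; [exists 0|exists 0|exists 1|exists 1]; rewrite ?arc0 ?arc1.
Qed.

Let A_half c e : 0 <= e * c -> -1 <= c <= 1 -> A c `<=` f @` half_disk e.
Proof.
move=> ec c1 _ [t t01 <-]; exists (lens_arc c t) => //; split; first exact: arc_cdisk.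
by rewrite /= mulrA mulr_ge0// sqrtr_ge0.
Qed.

Let circleA : f @` circle `<=` A 1 `|` A (-1).
Proof.
move=> _ [z zc <-]; have [/andP[z1 z2] _] := disk_bound (circle_cdisk zc).
have t01 : itv01 ((z.1 + 1) / 2) by rewrite itv01E; apply/andP; split; lra.
have e1 : 2 * ((z.1 + 1) / 2) - 1 = z.1 by field.
have e2 : 1 - z.1 ^+ 2 = z.2 ^+ 2 by rewrite /unit_circle/= in zc; rewrite -zc; ring.
have [z0|/ltW z0] := leP 0 z.2; [left|right]; exists ((z.1 + 1) / 2) => //; rewrite /lens_arc e1 e2.
  by rewrite mul1r sqrtr_sqr ger0_norm// -surjective_pairing.
by rewrite mulN1r sqrtr_sqr ler0_norm// opprK -surjective_pairing.
Qed.

Variable K : set plane.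
Hypothesis aK : arclike K.
Hypothesis KI : K `&` (f @` cdisk) = [set f (-1, 0); f (1, 0)].

Let c1 : -1 <= (1 : R) <= 1. Proof. by apply/andP; split; lra. Qed.
Let c0 : -1 <= (0 : R) <= 1. Proof. by apply/andP; split; lra. Qed.
Let cN : -1 <= (-1 : R) <= 1. Proof. by apply/andP; split; lra. Qed.

Let ends_cdisk : cdisk (-1, 0) /\ cdisk (1, 0).
Proof. by split; rewrite /closed_disk/= ?sqrrN expr1n expr0n/= addr0. Qed.

Let nK z : odisk z -> ~ K (f z).
Proof.
move=> oz Kz; have : (K `&` (f @` cdisk)) (f z) by split=> //; exists z => //; exact: odisk_cdisk.
have [d1 d2] := ends_cdisk; have zd := odisk_cdisk oz.
rewrite KI => -[/(fI zd d1)|/(fI zd d2)] ze; move: oz;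
  by rewrite ze /open_disk/= ?sqrrN expr1n expr0n/= addr0 ltxx.
Qed.

Let AKI c : -1 <= c <= 1 -> A c `&` K = [set f (-1, 0); f (1, 0)].
Proof.
move=> cc; apply/seteqP; split.
  move=> x [[t t01 tx] Kx]; rewrite -KI; split=> //; rewrite -tx.
  by exists (lens_arc c t) => //; exact: arc_cdisk.
move=> x xe; have : (K `&` f @` cdisk) x by rewrite KI.
move=> [Kx _]; split=> //; case: xe => ->; [exists 0|exists 1]; rewrite ?arc0 ?arc1//;
  by rewrite itv01E lexx ler01.
Qed.

Let nA c z : odisk z -> -1 <= c <= 1 -> c ^+ 2 = 1 -> ~ A c (f z).
Proof.
move=> oz cc c2 [t t01 /(fI (arc_cdisk cc t01) (odisk_cdisk oz)) tz]; move: oz.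
rewrite -tz /open_disk/= exprMn c2 mul1r sqr_sqrtr ?sq2t1// => /eqP.
by rewrite subrKC ltxx.
Qed.

Let nA0 z : odisk z -> z.2 != 0 -> ~ A 0 (f z).
Proof.
move=> oz z2 [t t01 /(fI (arc_cdisk c0 t01) (odisk_cdisk oz)) tz]; move: z2.
by rewrite -tz /= mul0r eqxx.
Qed.

Let halves z e : odisk z -> e * z.2 < 0 -> even_around (f @` half_disk e) (f z).
Proof.
move=> oz z2; apply: even_around_disk_image.
- exact: compact_half_disk.
- exact: half_disk_star.
- by apply: cont_onS fc; exact: half_diskS.
- by apply: inj_onS fI; exact: half_diskS.
- move=> [w [wd w2] /(fI wd (odisk_cdisk oz)) wz].
  by move: w2; rewrite wz leNgt z2.
Qed.

Let parity_AK z w : odisk z -> odisk w ->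
  even_around (A 1 `|` K) (f z) <-> even_around (A 1 `|` K) (f w).
Proof.
have cAK : compact (A 1 `|` K).
  by apply: compactU; [case: (arclikeA c1)|case: aK].
have co : connected (f @` odisk).
  by apply: cont_on_connected (@connected_odisk R); apply: cont_onS fc; exact: odisk_cdisk.
have no x : (f @` odisk) x -> ~ (A 1 `|` K) x.
  move=> [y oy <-] [|]; last exact: nK.
  by apply: nA => //; rewrite expr1n.
by move=> oz ow; split; apply: (even_around_connected cAK co no); (by exists z) || (by exists w).
Qed.

(* Pushing the arc [A 0] of the theta curve off to [A 1] changes the parity on one
   side of [A 0] only. *)
Lemma parity_jump z w : odisk z -> odisk w -> 0 < z.2 -> w.2 < 0 ->
  (even_around (A 0 `|` K) (f z) <-> ~ even_around (A 0 `|` K) (f w)).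
Proof.
move=> oz ow z2 w2.
have n01 : (1 : R) != 0 by rewrite oner_eq0.
have n1N : (1 : R) != -1 by apply/eqP; lra.
have nN0 : (-1 : R) != 0 by rewrite oppr_eq0 oner_eq0.
have z2' : z.2 != 0 by rewrite gt_eqF.
have w2' : w.2 != 0 by rewrite lt_eqF.
have oneq : (1 : R) ^+ 2 = 1 by rewrite expr1n.
have oneqN : (-1 : R) ^+ 2 = 1 by rewrite sqrrN expr1n.
(* Around [f z] the whole boundary is odd and the lower half even, so the upper closed curve, [A 1]
   with [A 0], is odd. Around [f w] it is even. As [A 1] with [K] has one parity on the open disk,
   replacing [A 1] by [A 0] makes the parities differ. *)
have thz := theta_parity (arclikeA c1) (arclikeA cN) (arclikeA c0)
  (AI c1 cN n1N) (AI cN c0 nN0) (AI c1 c0 n01)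
  (nA oz c1 oneq) (nA oz cN oneqN) (nA0 oz z2').
have nUL : ~ even_around (A 1 `|` A (-1)) (f z).
  by move=> /(even_aroundS circleA); exact: odd_around_interior.
have Ld : even_around (A (-1) `|` A 0) (f z).
  apply: (@even_aroundS _ _ (f @` half_disk (-1))); last by apply: halves; rewrite // mulN1r oppr_lt0.
  by move=> x [|]; apply: A_half => //; rewrite ?mulr0// mulrNN mulr1.
have Ud : even_around (A 1 `|` A 0) (f w).
  apply: (@even_aroundS _ _ (f @` half_disk 1)); last by apply: halves; rewrite // mul1r.
  by move=> x [|]; apply: A_half => //; rewrite ?mulr0// mulr1.
have thzK := theta_parity (arclikeA c1) (arclikeA c0) aK
  (AI c1 c0 n01) (AKI c0) (AKI c1) (nA oz c1 oneq) (nA0 oz z2') (nK oz).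
have thwK := theta_parity (arclikeA c1) (arclikeA c0) aK
  (AI c1 c0 n01) (AKI c0) (AKI c1) (nA ow c1 oneq) (nA0 ow w2') (nK ow).
have AK := parity_AK oz ow.
have := pselect (even_around (A 1 `|` A 0) (f z)).
have := pselect (even_around (A 0 `|` K) (f z)).
have := pselect (even_around (A 0 `|` K) (f w)).
have := pselect (even_around (A 1 `|` K) (f w)).
tauto.
Qed.

End Chart.
End Jump.

(** * Polygons and charts around edges *)

Section CirclePoint.
Variable R : realType.
Local Notation plane := (R * R)%type.
Local Notation odisk := (@open_disk R).
Local Notation cdisk := (@closed_disk R).
Local Notation circle := (@unit_circle R).

Lemma circle_pointP (s : R) : circle (circle_point s).
Proof. by rewrite /unit_circle/= cos2Dsin2. Qed.

Lemma cont_on_circle_point (T : topologicalType) (A : set T) (f : T -> R) :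
  cont_on A f -> cont_on A (fun x => circle_point (f x)).
Proof.
move=> fA.
have f2 : cont_on A (fun x => 2 * pi * f x) by apply: cont_onM => //; exact: cont_on_cst.
apply: cont_on_pair; apply: (@cont_on_comp _ _ _ _ setT _ _ _ f2) => //;
  apply: continuous_cont_on; [exact: continuous_cos|exact: continuous_sin].
Qed.

Lemma circle_pointDn (s : R) n : circle_point (s + n%:R) = circle_point s.
Proof.
elim: n => [|n ih]; first by rewrite addr0.
rewrite -ih (_ : s + n.+1%:R = s + n%:R + 1); last by rewrite -addrA natr1.
by rewrite /circle_point mulrDr mulr1 [X in _ + X]mulr_natl cosD2pi sinD2pi.
Qed.

Lemma circle_point_inj (a b : R) : `|a - b| < 1 -> circle_point a = circle_point b -> a = b.
Proof.
have wlg : forall a b : R, 0 <= a - b < 1 -> circle_point a = circle_point b -> a = b.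
  move=> {}a {}b /andP[ab0 ab1] [ec es].
  have pi0 : 0 < pi :> R by exact: pi_gt0.
  have c1 : cos (2 * pi * (a - b)) = 1.
    by rewrite mulrBr cosB ec es -!expr2 cos2Dsin2.
  have z0 : (0 : R) \in `[0, pi] by rewrite in_itv/= lexx ltW.
  have [h|h] := leP (a - b) (1 / 2).
    have : 2 * pi * (a - b) = 0.
      apply: cos_inj => //; last by rewrite cos0.
      by rewrite in_itv/=; apply/andP; split; nra.
    by move=> /eqP; rewrite mulf_eq0 subr_eq0 gt_eqF/= ?mulr_gt0// => /eqP.
  have : 2 * pi - 2 * pi * (a - b) = 0.
    apply: cos_inj => //; first by rewrite in_itv/=; apply/andP; split; nra.
    by rewrite cos0 -cosN opprB -[RHS]c1 [2 * pi in X in _ - X]mulr_natl -[in RHS](subrK (pi *+ 2) (2 * pi * _)) cosD2pi.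
  by nra.
move=> ab e; have [h|h] := leP b a.
  by apply: wlg => //; rewrite subr_ge0 h/= (le_lt_trans (ler_norm _)).
by apply/esym/wlg => //; rewrite subr_ge0 (ltW h)/= (le_lt_trans (ler_norm _))// distrC.
Qed.

Lemma circle_point_surj c : circle c -> exists2 s : R, 0 <= s < 1 & circle_point s = c.
Proof.
move=> cc; have [c1 _] := disk_bound (circle_cdisk cc).
have pi0 : 0 < pi :> R by exact: pi_gt0.
have p2 : 2 * pi != 0 :> R by rewrite gt_eqF// mulr_gt0.
have [/andP[a0 a1] ca] := acos_def c1.
have sa : sin (acos c.1) = `|c.2|.
  rewrite sin_acos// -sqrtr_sqr; congr Num.sqrt; rewrite /unit_circle/= in cc.
  by rewrite -cc; ring.
have [h|h] := leP 0 c.2.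
  exists (acos c.1 / (2 * pi)).
    by rewrite divr_ge0 ?mulr_ge0 ?(ltW pi0)//= ltr_pdivrMr ?mulr_gt0// mul1r; nra.
  by rewrite /circle_point mulrC divfK// ca sa ger0_norm// -surjective_pairing.
have a00 : 0 < acos c.1.
  rewrite lt_neqAle a0 andbT eq_sym; apply/eqP => ac; move: sa; rewrite ac sin0.
  by move=> /esym/eqP; rewrite normr_eq0 lt_eqF.
exists (1 - acos c.1 / (2 * pi)).
  have : 0 < acos c.1 / (2 * pi) <= 1 / 2.
    by rewrite divr_gt0 ?mulr_gt0//= ler_pdivrMr ?mulr_gt0//; lra.
  by move=> /andP[h1 h2]; apply/andP; split; lra.
rewrite /circle_point mulrBr mulr1 (mulrC (2 * pi) (_ / _)) divfK//.
rewrite [2 * pi]mulr_natl [pi *+ 2 - _]addrC cosD2pi sinD2pi cosN sinN ca sa.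
by rewrite ltr0_norm// opprK -surjective_pairing.
Qed.

Lemma circle_param m c : (0 < m)%N -> circle c ->
  exists j (t : R), [/\ (j < m)%N, 0 <= t < 1 & c = circle_point ((j%:R + t) / m%:R)].
Proof.
move=> m0 /circle_point_surj[s /andP[s0 s1] <-].
have mR : 0 < m%:R :> R by rewrite ltr0n.
have sm : 0 <= s * m%:R by rewrite mulr_ge0// ltW.
have /andP[h1 h2] := truncn_itv sm.
exists (Num.truncn (s * m%:R)), (s * m%:R - (Num.truncn (s * m%:R))%:R); split.
- by rewrite -(ltr_nat R) (le_lt_trans h1)// gtr_pMl.
- by rewrite subr_ge0 h1/= ltrBlDl natr1.
- by rewrite subrKC mulfK// gt_eqF.
Qed.

(** Straightens the circle near [circle_point s]: the diameter goes to an arc of the circle and the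
    upper half plane to its inner side. The factor 1/2 keeps the radius positive on the unit
    disk. *)
Definition polar (s d : R) (z : plane) : plane := (1 - z.2 / 2) *: circle_point (s + d * z.1).

Lemma norm2_circle_point (s : R) : norm2 (circle_point s) = 1.
Proof. exact: circle_pointP. Qed.

Lemma norm2_polar s d z : norm2 (polar s d z) = (1 - z.2 / 2) ^+ 2.
Proof. by rewrite norm2Z norm2_circle_point mulr1. Qed.

Lemma polar_cdisk s d z : 0 <= z.2 <= 1 -> cdisk (polar s d z).
Proof.
move=> /andP[z0 z1]; rewrite /closed_disk/= -/(norm2 (polar s d z)) norm2_polar; nra.
Qed.

Lemma polar_odisk s d z : 0 < z.2 <= 1 -> odisk (polar s d z).
Proof.
move=> /andP[z0 z1]; rewrite /open_disk/= -/(norm2 (polar s d z)) norm2_polar; nra.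
Qed.

Lemma polar0 s d x : polar s d (x, 0) = circle_point (s + d * x).
Proof. by rewrite /polar/= mul0r subr0 scale1r. Qed.

Lemma cont_on_polar A s d : cont_on A (polar s d).
Proof.
have z1 : cont_on A (fun z : plane => z.1) by apply: cont_on_fst; exact: cont_on_id.
have z2 : cont_on A (fun z : plane => z.2) by apply: cont_on_snd; exact: cont_on_id.
apply: cont_on_scalep.
  by apply: cont_onB; [exact: cont_on_cst|apply: cont_onM => //; exact: cont_on_cst].
apply: cont_on_circle_point; apply: cont_onD; first exact: cont_on_cst.
by apply: cont_onM => //; exact: cont_on_cst.
Qed.

Lemma polar_eq s d s' d' z z' : -1 <= z.2 <= 1 -> -1 <= z'.2 <= 1 ->
  polar s d z = polar s' d' z' ->
  z.2 = z'.2 /\ circle_point (s + d * z.1) = circle_point (s' + d' * z'.1).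
Proof.
move=> /andP[z0 z1] /andP[z0' z1'] e.
have : (1 - z.2 / 2) ^+ 2 = (1 - z'.2 / 2) ^+ 2 by rewrite -(norm2_polar s d) -(norm2_polar s' d') e.
move=> /eqP; rewrite eqrXn2//; [|lra|lra]; move=> /eqP zz.
have z2 : z.2 = z'.2 by lra.
split=> //; move: e; rewrite /polar zz => /scalerI; apply.
by rewrite gt_eqF//; lra.
Qed.

Lemma polar_inj_on s d : 0 < d < 1 / 2 -> inj_on cdisk (polar s d).
Proof.
move=> /andP[d0 d1] z z' /disk_bound[/andP[a1 a2] za] /disk_bound[/andP[b1 b2] zb].
move=> /(polar_eq za zb)[z2 e].
have z1 : s + d * z.1 = s + d * z'.1.
  apply: circle_point_inj e; rewrite opprD addrACA subrr add0r -mulrBr normrM gtr0_norm//.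
  have : `|z.1 - z'.1| <= 2 by rewrite ler_norml; apply/andP; split; lra.
  nra.
rewrite [z]surjective_pairing [z']surjective_pairing z2; congr pair.
by move/addrI: z1 => /mulfI; apply; rewrite gt_eqF.
Qed.

End CirclePoint.

Section Charts.
Variables (R : realType) (S : topologicalType) (G : embedded_graph R S).
Local Notation plane := (R * R)%type.
Local Notation odisk := (@open_disk R).
Local Notation cdisk := (@closed_disk R).
Local Notation circle := (@unit_circle R).

(* The boundary walk of the face [F] is extended periodically to all of [nat], so a
   side [(F, j)] matters only modulo [m]. *)
Definition polygon (F : set S) (m : nat) (w : nat -> G) (phi : plane -> S) :=
  [/\ (2 < m)%N, forall j, w (j + m)%N = w j,
      forall j, adj (w j) (w j.+1) /\ adj (w j) (w j.+2),
      [/\ cont_on cdisk phi, inj_on odisk phi & phi @` odisk = F] &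
      forall j t, itv01 t ->
        phi (circle_point ((j%:R + t) / m%:R)) = earc (w j) (w j.+1) t].

Lemma boundary_walk_polygon F m (w0 : 'I_m -> G) : (2 < m)%N -> boundary_walk F w0 ->
  (forall i, adj (w0 i) (w0 (ordS (ordS i)))) -> exists w phi, polygon F m w phi.
Proof.
case: m w0 => // m w0 m2 [cw [phi [pc pI pF pw]]] w2.
pose o j : 'I_m.+1 := inord (j %% m.+1).
have vo j : val (o j) = (j %% m.+1)%N by rewrite /= inordK// ltn_mod.
have oS j : ordS (o j) = o j.+1.
  by apply: val_inj; rewrite /= !inordK ?ltn_mod// -addn1 modnDml addn1.
exists (fun j => w0 (o j)), phi; split=> //.
- by move=> j; congr w0; apply: val_inj; rewrite !vo modnDr.
- by move=> j; rewrite -!oS; split; [exact: cw|exact: w2].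
- by split=> //; [exact/cont_onP|exact/inj_onP].
- move=> j t t01; rewrite -oS -pw; last by rewrite in_itv/= -itv01E.
  have := vo j; rewrite /= => ->; congr phi.
  (* Reducing the index modulo the size changes the angle by whole turns. *)
  rewrite -[RHS](circle_pointDn _ (j %/ m.+1)); congr circle_point.
  have -> : j%:R = (j %/ m.+1)%:R * m.+1%:R + (j %% m.+1)%:R :> R.
    by rewrite -natrM -natrD -divn_eq.
  have m0 : m.+1%:R != 0 :> R by rewrite pnatr_eq0.
  by move: (m.+1%:R : R) m0 => M m0; field.
Qed.

Lemma ordS3 (i : 'I_3) : ordS (ordS (ordS i)) = i.
Proof. by apply: val_inj; case: i => [[|[|[|]]]]. Qed.

Lemma face_polygon F : irreducible_face G F \/ three_face G F ->
  exists m w phi, polygon F m w phi.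
Proof.
case=> [[_ [m [w0 [m4 bw w2]]]]|[_ [w0 bw]]].
  by have [w [phi h]] := boundary_walk_polygon (ltnW m4) bw w2; exists m, w, phi.
(* Around a triangle, two steps forward are one step back. *)
have w2 i : adj (w0 i) (w0 (ordS (ordS i))).
  by have [cw _] := bw; rewrite adj_sym -{2}(ordS3 i); exact: cw.
by have [w [phi h]] := boundary_walk_polygon (isT : 2 < 3)%N bw w2; exists 3%N, w, phi.
Qed.

Lemma polygon_boundary_walk F m w phi : polygon F m w phi ->
  boundary_walk F (fun i : 'I_m => w i).
Proof.
move=> [m2 wp wa [pc pI pF] pw].
have wS (i : 'I_m) : w (ordS i) = w i.+1.
  rewrite /=; have := ltn_ord i; rewrite leq_eqVlt => /orP[/eqP e|im]; last by rewrite modn_small.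
  by rewrite e modnn -[m in RHS]add0n wp.
split=> [i|]; first by rewrite wS; case: (wa i).
exists phi; split=> //; [exact/cont_onP|exact/inj_onP|].
by move=> i t t01; rewrite wS -pw// itv01E; move: t01; rewrite in_itv.
Qed.

Hypotheses (hH : hausdorff_space S) (hL : locally_disk R S).
Variables (m : set S -> nat) (w : set S -> nat -> G) (phi : set S -> plane -> S).
Hypothesis poly : forall F, face G F -> polygon F (m F) (w F) (phi F).

Lemma phi_cont F : face G F -> cont_on cdisk (phi F).
Proof. by move=> /poly[_ _ _ []]. Qed.

Lemma phi_inj F : face G F -> inj_on odisk (phi F).
Proof. by move=> /poly[_ _ _ []]. Qed.

Lemma phi_odisk F : face G F -> phi F @` odisk = F.
Proof. by move=> /poly[_ _ _ []]. Qed.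

Lemma phi_face F z : face G F -> odisk z -> F (phi F z).
Proof.
by move=> fF oz; have : (phi F @` odisk) (phi F z) by []; rewrite phi_odisk.
Qed.

Lemma face_open F : face G F -> open F.
Proof.
move=> fF; have := phi_odisk fF => /(congr1 open) <-; apply: invariance_of_domain => //.
- exact: open_odisk.
- by apply: cont_onS (phi_cont fF); exact: odisk_cdisk.
- exact: phi_inj.
Qed.

Lemma face_nograph F x : face G F -> F x -> ~ graph_set G x.
Proof. by move=> [y _ ->] /connected_component_sub. Qed.

Lemma face_eq F F' x : face G F -> face G F' -> F x -> F' x -> F = F'.
Proof.
move=> [y _ ->] [y' _ ->] /same_connected_component -> /same_connected_component ->.
by [].
Qed.

Lemma face_cover x : ~ graph_set G x -> exists2 F, face G F & F x.
Proof.
move=> nx; exists (connected_component (~` graph_set G) x); first by exists x.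
exact: connected_component_refl.
Qed.

Lemma earc_graph (u v : G) t : adj u v -> itv01 t -> graph_set G (earc u v t).
Proof. by move=> uv t01; right; exists u, v; split=> //; exists t. Qed.

Definition half_chart F s d z := phi F (polar s d z).
Local Notation hc := half_chart.

Lemma hc_cont F s d : face G F -> cont_on (half_disk 1) (hc F s d).
Proof.
move=> fF; apply: (@cont_on_comp _ _ _ _ cdisk); last exact: phi_cont.
  move=> z [/disk_bound[_ /andP[_ z1]]]; rewrite mul1r => z0.
  by apply: polar_cdisk; rewrite z0.
exact: cont_on_polar.
Qed.

Lemma hc_face F s d z : face G F -> cdisk z -> 0 < z.2 -> F (hc F s d z).
Proof.
move=> fF /disk_bound[_ /andP[_ z1]] z0; apply: phi_face => //.
by apply: polar_odisk; rewrite z0.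
Qed.

(** A disk in [S] cut in two by the arc [g]. [F1 = F2] is allowed, for an edge with both sides on
    one face. *)
Definition chart (f : plane -> S) (g : R -> S) (F1 F2 : set S) :=
  [/\ cont_on cdisk f, inj_on cdisk f,
      forall x, -1 <= x <= 1 -> f (x, 0) = g x,
      forall z, cdisk z -> 0 < z.2 -> F1 (f z) &
      forall z, cdisk z -> z.2 < 0 -> F2 (f z)].

Lemma cdisk_x0 (x : R) : cdisk (x, 0) <-> -1 <= x <= 1.
Proof.
split=> [/disk_bound[]//|/andP[x0 x1]]; rewrite /closed_disk/= expr0n/= addr0; nra.
Qed.

(** The polygon map is injective inside the disk, but on the circle only along the arc [g]; a point
    inside and a point of the circle are separated because faces avoid the graph. The sign [e]
    matches the direction of [g] with that of the walk. *)
Lemma hc_inj F (s d e : R) (g : R -> S) : face G F -> 0 < d < 1 / 2 -> e = 1 \/ e = -1 ->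
  (forall x y, -1 <= x <= 1 -> -1 <= y <= 1 -> g x = g y -> x = y) ->
  (forall x, -1 <= x <= 1 -> graph_set G (g x)) ->
  (forall x, -1 <= x <= 1 -> phi F (circle_point (s + d * (e * x))) = g x) ->
  inj_on (half_disk 1) (fun z => hc F s d (e * z.1, z.2)).
Proof.
move=> fF d0 e1 gI gG gphi.
have ee : e ^+ 2 = 1 by case: e1 => ->; rewrite ?sqrrN expr1n.
have eD z : cdisk z -> cdisk (e * z.1, z.2).
  by rewrite /closed_disk/= exprMn ee mul1r.
have g0 z : cdisk z -> z.2 = 0 -> hc F s d (e * z.1, z.2) = g z.1.
  move=> zd z0; rewrite z0 /half_chart polar0 gphi//.
  by case: (disk_bound zd).
have ng z z' : cdisk z -> cdisk z' -> z.2 = 0 -> 0 < z'.2 ->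
    hc F s d (e * z.1, z.2) <> hc F s d (e * z'.1, z'.2).
  move=> zd z'd z0 z'0 h; have := hc_face s d fF (eD _ z'd) z'0; rewrite -h g0//.
  by move=> /(face_nograph fF); apply; apply: gG; case: (disk_bound zd).
move=> z z' [zd]; rewrite mul1r => z0 [z'd]; rewrite mul1r => z'0 h.
have [z00|z00] := eqVneq z.2 0; have [z'00|z'00] := eqVneq z'.2 0.
- move: h; rewrite !g0// => /gI zz'.
  rewrite [z]surjective_pairing [z']surjective_pairing z00 z'00 zz'//.
  + by case: (disk_bound zd).
  + by case: (disk_bound z'd).
- by case: (ng z z'); rewrite // lt_neqAle eq_sym z'00.
- by case: (ng z' z); rewrite // lt_neqAle eq_sym z00.
have odp y : cdisk y -> 0 <= y.2 -> y.2 != 0 -> odisk (polar s d (e * y.1, y.2)).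
  move=> /disk_bound[_ /andP[_ y1]] y0 y00; apply: polar_odisk => /=.
  by rewrite lt_neqAle eq_sym y00 y0 y1.
have := phi_inj fF (odp _ zd z0 z00) (odp _ z'd z'0 z'00) h.
move=> /(polar_inj_on d0 (eD _ zd) (eD _ z'd))[e2 e3].
rewrite [z]surjective_pairing [z']surjective_pairing e3; congr pair.
by apply: (@mulfI _ e) => //; case: e1 => ->; rewrite ?oppr_eq0 oner_eq0.
Qed.

(** The second half chart is reflected and glued to the first along [g]. The last two conclusions
    remember the half chart a point comes from, which distinguishes two sides of the same face. *)
Lemma make_chart F1 F2 (s1 d1 s2 d2 e1 e2 : R) (g : R -> S) : face G F1 -> face G F2 ->
  0 < d1 < 1 / 2 -> 0 < d2 < 1 / 2 -> e1 = 1 \/ e1 = -1 -> e2 = 1 \/ e2 = -1 ->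
  (forall x y, -1 <= x <= 1 -> -1 <= y <= 1 -> g x = g y -> x = y) ->
  (forall x, -1 <= x <= 1 -> graph_set G (g x)) ->
  (forall x, -1 <= x <= 1 -> phi F1 (circle_point (s1 + d1 * (e1 * x))) = g x) ->
  (forall x, -1 <= x <= 1 -> phi F2 (circle_point (s2 + d2 * (e2 * x))) = g x) ->
  (forall z z', cdisk z -> cdisk z' -> 0 < z.2 -> 0 < z'.2 ->
    hc F1 s1 d1 z <> hc F2 s2 d2 z') ->
  exists f, [/\ chart f g F1 F2,
    forall z, cdisk z -> 0 < z.2 -> exists z', [/\ cdisk z', 0 < z'.2 & f z = hc F1 s1 d1 z'] &
    forall z, cdisk z -> z.2 < 0 -> exists z', [/\ cdisk z', 0 < z'.2 & f z = hc F2 s2 d2 z']].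
Proof.
move=> f1 f2 d1P d2P e1P e2P gI gG g1 g2 dis.
pose h1 (z : plane) := hc F1 s1 d1 (e1 * z.1, z.2).
pose h2' (z : plane) := hc F2 s2 d2 (e2 * z.1, z.2).
pose h2 (z : plane) := h2' (z.1, - z.2).
have ee (e : R) : e = 1 \/ e = -1 -> e ^+ 2 = 1 :> R by case=> ->; rewrite ?sqrrN expr1n.
have eD (e : R) (z : plane) : e = 1 \/ e = -1 -> cdisk z -> cdisk (e * z.1, z.2).
  by move=> /ee e2'; rewrite /closed_disk/= exprMn e2' mul1r.
have rD z : cdisk z -> cdisk (z.1, - z.2) by rewrite /closed_disk/= sqrrN.
have pc (e : R) A : cont_on A (fun z : plane => (e * z.1, z.2)).
  apply: cont_on_pair; last by apply: cont_on_snd; exact: cont_on_id.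
  by apply: cont_onM; [exact: cont_on_cst|apply: cont_on_fst; exact: cont_on_id].
have hcont F s d (e : R) : face G F -> e = 1 \/ e = -1 ->
    cont_on (half_disk 1) (fun z => hc F s d (e * z.1, z.2)).
  move=> fF eP; apply: (@cont_on_comp _ _ _ _ (half_disk 1)); [|exact: pc|exact: hc_cont].
  by move=> z [zd z0]; split=> //; exact: eD.
have rh (z : plane) : half_disk (-1) z -> half_disk 1 (z.1, - z.2).
  by move=> [zd]; rewrite mulN1r => z0; split; [exact: (rD z)|rewrite mul1r].
have h2c : cont_on (half_disk (-1)) h2.
  apply: (@cont_on_comp _ _ _ _ (half_disk 1) _ h2'); [exact: rh| |exact: hcont].
  apply: cont_on_pair; first by apply: cont_on_fst; exact: cont_on_id.
  by apply: cont_onN; apply: cont_on_snd; exact: cont_on_id.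
have h1I := hc_inj f1 d1P e1P gI gG g1.
have h2'I := hc_inj f2 d2P e2P gI gG g2.
have h2I : inj_on (half_disk (-1)) h2.
  move=> z z' /rh zh /rh z'h /(h2'I _ _ zh z'h)[e3 /oppr_inj e4].
  by rewrite [z]surjective_pairing [z']surjective_pairing e3 e4.
have h10 x : -1 <= x <= 1 -> h1 (x, 0) = g x by move=> x1; rewrite /h1 /half_chart polar0 g1.
have h20 x : -1 <= x <= 1 -> h2 (x, 0) = g x.
  by move=> x1; rewrite /h2 /h2' /= oppr0 /half_chart polar0 g2.
have h12 (x : R) : cdisk (x, 0) -> h1 (x, 0) = h2 (x, 0).
  by move=> /cdisk_x0 x1; rewrite h10// h20.
have h1n2 z z' : cdisk z -> cdisk z' -> 0 < z.2 -> z'.2 < 0 -> h1 z <> h2 z'.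
  move=> zd z'd z0 z'0; apply: dis => //=; [exact: eD| |by rewrite oppr_gt0].
  exact: (eD e2 (z'.1, - z'.2) e2P (rD _ z'd)).
have [f [fc fI fu fl]] := glue_half_disks (hcont _ s1 d1 _ f1 e1P) h2c h1I h2I h12 h1n2.
exists f.
have fu' z : cdisk z -> 0 < z.2 -> exists z', [/\ cdisk z', 0 < z'.2 & f z = hc F1 s1 d1 z'].
  move=> zd z0; exists (e1 * z.1, z.2); split=> //; first exact: eD.
  by rewrite fu// ltW.
have fl' z : cdisk z -> z.2 < 0 -> exists z', [/\ cdisk z', 0 < z'.2 & f z = hc F2 s2 d2 z'].
  move=> zd z0; exists (e2 * z.1, - z.2); split=> //; first exact: (eD e2 (z.1, - z.2) e2P (rD _ zd)).
    by rewrite oppr_gt0.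
  by rewrite fl// ltW.
split=> //; split=> //.
- by move=> x x1; rewrite fu//; [exact: h10|exact/cdisk_x0].
- by move=> z zd z0; have [z' [z'd z'0 ->]] := fu' z zd z0; exact: hc_face.
- by move=> z zd z0; have [z' [z'd z'0 ->]] := fl' z zd z0; exact: hc_face.
Qed.

Lemma chart_open f g F1 F2 : chart f g F1 F2 -> open (f @` odisk).
Proof.
move=> [fc fI _ _ _]; apply: invariance_of_domain => //.
- exact: open_odisk.
- by apply: cont_onS fc; exact: odisk_cdisk.
- by apply: inj_onS fI; exact: odisk_cdisk.
Qed.

End Charts.

(** * The two sides of an edge *)

(** The points of [K] adherent to those violating [A] form a compact set, whose image is closed and
    misses [p]. *)
Lemma compact_near_preimage (T U : topologicalType) (K : set T) (h : T -> U)
    (p : U) (A : set U) : hausdorff_space U -> compact K -> cont_on K h ->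
  (forall z, K z -> h z = p -> \forall z' \near z, K z' -> A (h z')) ->
  \forall y \near p, forall z, K z -> h z = y -> A y.
Proof.
move=> hU cK hcont hp.
pose B := K `&` closure [set z | K z /\ ~ A (h z)].
have cB : compact B by apply: compact_closedI => //; exact: closed_closure.
have clB : closed (h @` B).
  by apply: compact_closed => //; apply: cont_on_compact cB; apply: cont_onS hcont => z [].
have : nbhs p (~` (h @` B)).
  apply: open_nbhs_nbhs; split; first exact: closed_openC.
  move=> [z [Kz clz] hz]; have [y [[Ky nAy] /(_ Ky)]] := clz _ (hp z Kz hz).
  exact: nAy.
apply: filterS => y nB z Kz hz; apply: contrapT => nA; apply: nB; exists z => //.
by split=> //; apply: subset_closure; split=> //; rewrite hz.
Qed.

Section Sides.
Variables (R : realType) (S : topologicalType) (G : embedded_graph R S).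
Local Notation plane := (R * R)%type.
Local Notation odisk := (@open_disk R).
Local Notation cdisk := (@closed_disk R).
Local Notation circle := (@unit_circle R).
Hypotheses (hH : hausdorff_space S) (hL : locally_disk R S).
Variables (m : set S -> nat) (w : set S -> nat -> G) (phi : set S -> plane -> S).
Hypothesis poly : forall F, face G F -> polygon F (m F) (w F) (phi F).

Local Notation hc := (half_chart phi).

(** The edge reparametrized by [-1, 1], so as to fit the diameter of a chart; its midpoint is at
    0. *)
Definition arcg (u v : G) (x : R) : S := earc u v ((1 + x) / 2).

Definition face_side F j (u v : G) :=
  (w F j = u /\ w F j.+1 = v) \/ (w F j = v /\ w F j.+1 = u).

(** With the circle measured in turns, this is the middle of side [j], and [side_len] is half the
    length of a side. *)
Definition side_mid F j : R := (j%:R + 1 / 2) / (m F)%:R.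
Definition side_len F : R := 1 / 2 / (m F)%:R.

Lemma half01 (x : R) : -1 <= x <= 1 -> itv01 ((1 + x) / 2).
Proof. by move=> /andP[x0 x1]; rewrite itv01E; apply/andP; split; lra. Qed.

Lemma arcg_inj (u v : G) x y : adj u v -> -1 <= x <= 1 -> -1 <= y <= 1 ->
  arcg u v x = arcg u v y -> x = y.
Proof.
move=> uv /half01 x1 /half01 y1 /(earc_inj uv).
by rewrite !in_itv/= -!itv01E => /(_ x1 y1); lra.
Qed.

Lemma arcg_graph (u v : G) x : adj u v -> -1 <= x <= 1 -> graph_set G (arcg u v x).
Proof. by move=> uv /half01; exact: earc_graph. Qed.

Lemma m_gt0 F : face G F -> 0 < (m F)%:R :> R.
Proof. by move=> /poly[m2 _ _ _ _]; rewrite ltr0n (leq_trans _ m2). Qed.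

Lemma side_len_bound F : face G F -> 0 < side_len F < 1 / 2.
Proof.
move=> fF; have m0 := m_gt0 fF; have [m2 _ _ _ _] := poly fF.
rewrite /side_len divr_gt0//= ltr_pdivrMr// ltr_pMr// ltr1n.
by rewrite (leq_trans _ m2).
Qed.

Lemma side_pointE F j x : face G F ->
  side_mid F j + side_len F * x = (j%:R + (1 + x) / 2) / (m F)%:R.
Proof.
move=> fF; have m0 := m_gt0 fF; rewrite /side_mid /side_len.
by field; rewrite gt_eqF.
Qed.

Lemma sideS_adj F j u v : face G F -> face_side F j u v -> adj u v.
Proof.
move=> /poly[_ _ wa _ _] [[<- <-]|[<- <-]]; first by case: (wa j).
by rewrite adj_sym; case: (wa j).
Qed.

Lemma side_arc F j u v : face G F -> face_side F j u v ->
  exists2 e : R, e = 1 \/ e = -1 & forall x, -1 <= x <= 1 ->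
    phi F (circle_point (side_mid F j + side_len F * (e * x))) = arcg u v x.
Proof.
move=> fF s; have uv := sideS_adj fF s; have [_ _ wa _ pw] := poly fF.
case: s => -[wu wv].
  exists 1; [by left|move=> x x1; rewrite mul1r side_pointE// pw ?wu ?wv//].
  exact: half01.
exists (-1); [by right|move=> x x1; rewrite mulN1r side_pointE//].
have x1' : -1 <= - x <= 1 by move: x1 => /andP[? ?]; apply/andP; split; lra.
rewrite pw ?wu ?wv; last exact: half01.
rewrite earc_rev//; last by rewrite in_itv/= -itv01E; exact: half01.
by rewrite /arcg; congr earc; lra.
Qed.

Lemma hc_disjoint F1 j1 F2 j2 z z' : face G F1 -> face G F2 ->
  (j1 < m F1)%N -> (j2 < m F2)%N -> (F1, j1) <> (F2, j2) ->
  cdisk z -> cdisk z' -> 0 < z.2 -> 0 < z'.2 ->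
  hc F1 (side_mid F1 j1) (side_len F1) z <> hc F2 (side_mid F2 j2) (side_len F2) z'.
Proof.
move=> f1 f2 l1 l2 n12 zd z'd z0 z'0 e.
have h1 := hc_face poly (side_mid F1 j1) (side_len F1) f1 zd z0.
have h2 := hc_face poly (side_mid F2 j2) (side_len F2) f2 z'd z'0.
rewrite -e in h2; have F12 := face_eq f1 f2 h1 h2.
rewrite -{}F12 in f2 l2 n12 e h2.
(* A point of the disk above the diameter has abscissa strictly between -1 and 1, so different sides
   occupy disjoint open sectors. *)
have bd y : cdisk y -> 0 < y.2 -> (0 < (1 + y.1) / 2 < 1) /\ (0 < y.2 <= 1).
  move=> yd y0; have [_ /andP[_ y1]] := disk_bound yd.
  rewrite /closed_disk/= in yd; split; last by rewrite y0.
  by apply/andP; split; nra.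
have [/andP[a0 a1] za] := bd z zd z0; have [/andP[b0 b1] zb] := bd z' z'd z'0.
have := phi_inj poly f1 (polar_odisk _ _ za) (polar_odisk _ _ zb) e.
move=> /polar_eq[||_]; [by case: (disk_bound zd)|by case: (disk_bound z'd)|].
rewrite !side_pointE//; have m0 := m_gt0 f1.
have bnd (j : nat) (t : R) : (j < m F1)%N -> 0 < t < 1 -> 0 < (j%:R + t) / (m F1)%:R < 1.
  move=> jm /andP[t0 t1]; rewrite divr_gt0 ?ltr_wpDl//= ltr_pdivrMr// mul1r.
  by rewrite (lt_le_trans (_ : _ < j.+1%:R))// ?ler_nat// -natr1 ltrD2l.
have /andP[p0 p1] := bnd _ _ l1 (introT andP (conj a0 a1)).
have /andP[q0 q1] := bnd _ _ l2 (introT andP (conj b0 b1)).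
move=> /circle_point_inj.
have -> : `|(j1%:R + (1 + z.1) / 2) / (m F1)%:R - (j2%:R + (1 + z'.1) / 2) / (m F1)%:R| < 1 :> R.
  by rewrite ltr_norml; apply/andP; split; lra.
move=> /(_ isT)/(mulIf _) => /(_ (lt0r_neq0 _)); rewrite invr_gt0 => /(_ m0) jj.
apply: n12; congr pair; apply/eqP; rewrite eqn_leq; apply/andP; split; rewrite -ltnS -(ltr_nat R) -natr1; lra.
Qed.

Lemma edge_chart F1 j1 F2 j2 u v : face G F1 -> face G F2 ->
  (j1 < m F1)%N -> (j2 < m F2)%N -> face_side F1 j1 u v -> face_side F2 j2 u v ->
  (F1, j1) <> (F2, j2) ->
  exists f, [/\ chart f (arcg u v) F1 F2,
    forall z, cdisk z -> 0 < z.2 -> exists z', [/\ cdisk z', 0 < z'.2 &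
      f z = hc F1 (side_mid F1 j1) (side_len F1) z'] &
    forall z, cdisk z -> z.2 < 0 -> exists z', [/\ cdisk z', 0 < z'.2 &
      f z = hc F2 (side_mid F2 j2) (side_len F2) z']].
Proof.
move=> f1 f2 l1 l2 s1 s2 n12; have uv := sideS_adj f1 s1.
have [e1 e1P h1] := side_arc f1 s1; have [e2 e2P h2] := side_arc f2 s2.
apply: (make_chart poly f1 f2 (side_len_bound f1) (side_len_bound f2) e1P e2P _ _ h1 h2).
- by move=> x y; exact: arcg_inj.
- by move=> x; exact: arcg_graph.
- by move=> z z'; exact: hc_disjoint.
Qed.

Lemma hc_limit F s d (N : set S) : face G F -> open N -> N (phi F (circle_point s)) ->
  exists2 y : R, 0 < y <= 1 & N (hc F s d (0, y)).
Proof.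
move=> fF oN Np.
have z0 : half_disk 1 (0 : plane).
  by split; rewrite ?mulr0// /closed_disk/= expr0n/= addr0 ler01.
have h0 : hc F s d 0 = phi F (circle_point s).
  by rewrite /half_chart (_ : 0 = (0, 0))// polar0 mulr0 addr0.
have := cont_on_near (@hc_cont _ _ _ _ _ _ poly _ s d fF) z0 _; rewrite h0 => /(_ N (open_nbhs_nbhs (conj oN Np))).
move=> /nbhs_ballP[r /= r0 rN].
have [y [y0 yr y1]] := small_pos r0.
exists y; first by rewrite y0 ltW.
apply: (rN (0, y)).
  split; rewrite /= -ball_normE /ball_/= sub0r normrN ?normr0//.
  by rewrite gtr0_norm.
by split; rewrite ?mul1r ?ltW// /closed_disk/= expr0n/= add0r exprn_ile1 ?ltW//.
Qed.

Lemma side_mid_arc F j u v : face G F -> face_side F j u v ->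
  phi F (circle_point (side_mid F j)) = arcg u v 0.
Proof.
move=> fF /(side_arc fF)[e _ h]; rewrite -h ?mulr0 ?addr0//.
by apply/andP; split; lra.
Qed.

Lemma chart_mid (f : plane -> S) (g : R -> S) F1 F2 : chart f g F1 F2 -> f 0 = g 0.
Proof.
by case=> _ _ h _ _; rewrite -h// ; apply/andP; split; lra.
Qed.

(** Two sides already give an open chart around the midpoint of the edge. The half chart of a third
    side comes arbitrarily close to this midpoint, so it would meet one of the first two half charts
    or the edge itself. *)
Lemma at_most_two F1 j1 F2 j2 F3 j3 u v : face G F1 -> face G F2 -> face G F3 ->
  (j1 < m F1)%N -> (j2 < m F2)%N -> (j3 < m F3)%N ->
  face_side F1 j1 u v -> face_side F2 j2 u v -> face_side F3 j3 u v ->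
  (F1, j1) <> (F2, j2) -> (F3, j3) = (F1, j1) \/ (F3, j3) = (F2, j2).
Proof.
move=> f1 f2 f3 l1 l2 l3 s1 s2 s3 n12; apply: contrapT => /not_orP[n31 n32].
have [f [fC fu fl]] := edge_chart f1 f2 l1 l2 s1 s2 n12.
have oN := chart_open hL fC; have uv := sideS_adj f1 s1.
have [|y /andP[y0 y1] [z oz fz]] := @hc_limit F3 (side_mid F3 j3) (side_len F3) _ f3 oN.
  by rewrite (side_mid_arc f3 s3) -(chart_mid fC); exists 0 => //; exact: odisk0.
have zd := odisk_cdisk oz.
have yd : cdisk (0, y) by rewrite /closed_disk/= expr0n/= add0r exprn_ile1// ltW.
have [z0|z0|z0] := ltrgt0P z.2.
- have [z' [z'd z'0 e]] := fu z zd z0.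
  by apply: (hc_disjoint f1 f3 l1 l3 _ z'd yd z'0 y0); [move=> /esym|rewrite -e].
- have [z' [z'd z'0 e]] := fl z zd z0.
  by apply: (hc_disjoint f2 f3 l2 l3 _ z'd yd z'0 y0); [move=> /esym|rewrite -e].
- have := hc_face poly (side_mid F3 j3) (side_len F3) f3 yd y0; rewrite -fz.
  move=> /(face_nograph f3); apply.
  have x1 : -1 <= z.1 <= 1 by case: (disk_bound zd).
  case: fC => _ _ h _ _; rewrite [z]surjective_pairing z0 h//.
  exact: arcg_graph.
Qed.

(** Every face has a side 0, and each of the finitely many pairs of vertices serves as side 0 for at
    most two faces. *)
Lemma faces_finite : finite_set [set F | face G F].
Proof.
pose A (p : G * G) := [set F | face G F /\ face_side F 0 p.1 p.2].
apply: (@sub_finite_set _ _ (\bigcup_(p in [set: (G * G)%type]) A p)).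
  by move=> F fF; exists (w F 0, w F 1) => //; split=> //; left.
apply: bigcup_finite; first exact: finite_finset.
move=> p _; have [[F1 [f1 s1]]|nA] := pselect (exists F, A p F); last first.
  by apply: (@sub_finite_set _ _ set0) => // F AF; apply: nA; exists F.
have l0 F : face G F -> (0 < m F)%N by move=> /poly[m2 _ _ _ _]; rewrite (leq_trans _ m2).
have [[F2 [[f2 s2] n12]]|nA] := pselect (exists F, A p F /\ F <> F1); last first.
  apply: (@sub_finite_set _ _ [set F1]) => // F AF.
  by apply: contrapT => FF1; apply: nA; exists F.
apply: (@sub_finite_set _ _ [set F1; F2]) => // F [fF sF].
have n12' : (F1, 0%N) <> (F2, 0%N) by move=> [/esym].
by have [[->]|[->]] := at_most_two f1 f2 fF (l0 _ f1) (l0 _ f2) (l0 _ fF) s1 s2 sF n12'; [left|right].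
Qed.

Lemma near_finite (I : choiceType) (T : topologicalType) (D : set I) (p : T)
    (P : I -> set T) : finite_set D -> (forall i, D i -> nbhs p (P i)) ->
  \forall x \near p, forall i, D i -> P i x.
Proof.
move=> /finite_seqP[s ->] h.
suff : forall r : seq I, {subset r <= s} -> \forall x \near p, forall i, i \in r -> P i x.
  by move=> /(_ s); apply.
elim=> [|i r ih] rs; first by apply: nearW.
have ris : {subset r <= s} by move=> j jr; apply: rs; rewrite inE jr orbT.
have Pi : nbhs p (P i) by apply: h; apply: rs; rewrite inE eqxx.
apply: filterS2 Pi (ih ris) => x Pix h' j.
by rewrite inE => /orP[/eqP->|/h'].
Qed.

Lemma mid_vertex (u v a : G) : adj u v -> arcg u v 0 <> vpoint a.
Proof.
move=> uv; have h : ((1 + 0) / 2 : R) \in `]0, 1[ by rewrite in_itv/=; apply/andP; split; lra.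
exact: earc_vertex uv h.
Qed.

Lemma mid_edge (u v a b : G) t : adj u v -> adj a b -> itv01 t ->
  earc a b t = arcg u v 0 -> ((a = u /\ b = v) \/ (a = v /\ b = u)) /\ t = 1 / 2.
Proof.
move=> uv ab t01 e.
have h : ((1 + 0) / 2 : R) \in `]0, 1[ by rewrite in_itv/=; apply/andP; split; lra.
have t0 : t != 0 by apply/eqP => t0; move: e; rewrite t0 earc0// => /esym; exact: mid_vertex.
have t1 : t != 1 by apply/eqP => t1; move: e; rewrite t1 earc1// => /esym; exact: mid_vertex.
have tI : t \in `]0, 1[%R.
  by move: t01; rewrite itv01E in_itv/= !lt_neqAle eq_sym t0 t1.
have uvab := earc_disjoint uv ab h tI (esym e); split=> //.
have h' : ((1 + 0) / 2 : R) \in `[0, 1] by rewrite in_itv/=; apply/andP; split; lra.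
have tI' : t \in `[0, 1]%R by rewrite in_itv/= -itv01E.
case: uvab => -[ea eb]; rewrite ea eb in e.
  by have := earc_inj uv tI' h' e; lra.
rewrite earc_rev// in e.
have tI2 : 1 - t \in `[0, 1]%R by move: t01; rewrite itv01E in_itv/= => /andP[? ?]; apply/andP; split; lra.
by have := earc_inj uv tI2 h' e; lra.
Qed.

(** Every point near the midpoint lies in a face, on an edge or at a vertex. These are finite in
    number, so the hypotheses make the image of [K] a neighbourhood of the midpoint. Then [K] would
    be a neighbourhood of 0, although it lies in the closed upper half plane. *)
Lemma no_half_nbhs (u v : G) (K : set plane) (k : plane -> S) : adj u v ->
  compact K -> (forall z, K z -> 0 <= z.2) -> K 0 -> k 0 = arcg u v 0 ->
  cont_on K k -> inj_on K k ->
  (forall x, -1 < x < 1 -> (k @` K) (arcg u v x)) ->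
  (forall F z, face G F -> cdisk z -> phi F z = arcg u v 0 ->
    \forall z' \near z, cdisk z' -> (k @` K) (phi F z')) -> False.
Proof.
move=> uv cK K0 K00 k0 kc kI karc kphi; pose p := arcg u v 0.
have np : \forall y \near p, (k @` K) y.
  have n1 : \forall y \near p, forall F, face G F -> forall z, cdisk z -> phi F z = y -> (k @` K) y.
    apply: near_finite; first exact: faces_finite.
    move=> F fF; apply: compact_near_preimage => //; [exact: compact_cdisk|exact: (phi_cont poly fF)|].
    by move=> z zd zp; exact: kphi.
  have n2 : \forall y \near p, forall q : G * G, [set: (G * G)%type] q -> adj q.1 q.2 ->
      forall t, itv01 t -> earc q.1 q.2 t = y -> (k @` K) y.
    apply: near_finite; first exact: finite_finset.
    move=> [a b] _ /=; have [ab|nab] := boolP (adj a b); last by apply: nearW.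
    suff : \forall y \near p, forall t, itv01 t -> earc a b t = y -> (k @` K) y.
      by apply: filterS => y h _.
    apply: compact_near_preimage => //; first exact: segment_compact.
      exact/cont_onP/earc_continuous.
    move=> t t01 /(mid_edge uv ab t01)[abuv th].
    have : nbhs t [set s | 0 < s < 1].
      have -> : [set s : R | 0 < s < 1] = `]0, 1[%classic.
        by apply/seteqP; split=> s; rewrite /= in_itv.
      apply: open_nbhs_nbhs; split; first exact: itv_open.
      by rewrite th /= in_itv/=; apply/andP; split; lra.
    apply: filterS => s /andP[s0 s1] s01.
    have xE (x : R) : 0 < x < 1 -> (k @` K) (earc u v x).
      move=> /andP[x0 x1]; have -> : x = (1 + (2 * x - 1)) / 2 by field.
      by apply: karc; apply/andP; split; lra.
    case: abuv => -[-> ->]; first by apply: xE; rewrite s0.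
    by rewrite earc_rev//; apply: xE; apply/andP; split; lra.
  have n3 : \forall y \near p, forall a : G, [set: G] a -> vpoint a <> y.
    apply: near_finite; first exact: finite_finset.
    move=> a _; have ca : closed [set vpoint a] by apply: compact_closed => //; exact: compact_set1.
    have : nbhs p (~` [set vpoint a]).
      apply: open_nbhs_nbhs; split; first exact: closed_openC.
      exact: mid_vertex.
    by apply: filterS => y ny e; apply: ny.
  apply: filterS3 n1 n2 n3 => y h1 h2 h3.
  have [yG|nyG] := pselect (graph_set G y).
    case: yG => [[a _ ay]|[a [b [ab [t t01 ty]]]]]; first by case: (h3 a I).
    by apply: (h2 (a, b)) ty.
  have [F fF Fy] := face_cover nyG.
  have : (phi F @` odisk) y by rewrite (phi_odisk poly fF).
  by move=> [z oz zy]; apply: (h1 F fF z) => //; exact: odisk_cdisk.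
have : nbhs p (k @` K) by exact: np.
rewrite nbhsE => -[N [oN Np] NK].
have := invariance_of_domain_inverse hH hL cK kc kI oN NK; rewrite openE => /(_ 0).
have kN0 : (K `&` k @^-1` N) 0 by split=> //=; rewrite k0.
move=> /(_ kN0)/nbhs_ballP[r /= r0 rK].
have [] := rK (0, - (r / 2)).
  split; rewrite /= -ball_normE /ball_/= sub0r ?normr0 ?opprK; first by rewrite oppr0 normr0.
  by rewrite gtr0_norm; lra.
by move=> /K0 /=; lra.
Qed.

Lemma polygon_boundary F j z u v : face G F -> adj u v -> cdisk z -> phi F z = arcg u v 0 ->
  (forall i, (i < m F)%N -> face_side F i u v -> i = j) ->
  z = circle_point (side_mid F j) /\ (j < m F)%N /\ face_side F j u v.
Proof.
move=> fF uv zd zp uniq.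
have m12 : -1 <= (0 : R) <= 1 by apply/andP; split; lra.
have zc : circle z.
  rewrite /unit_circle/=; apply/eqP; rewrite eq_le [_ <= 1]zd leNgt; apply/negP => zo.
  have := phi_face poly fF zo; rewrite zp => /(face_nograph fF); apply.
  exact: arcg_graph.
have m0 : (0 < m F)%N by rewrite -(ltr0n R); exact: m_gt0.
have [i [t [im /andP[t0 t1] zE]]] := circle_param m0 zc.
have [_ _ wa _ pw] := poly fF.
have t01 : itv01 t by rewrite itv01E t0 ltW.
have [wi _] := wa i.
have [si th] : face_side F i u v /\ t = 1 / 2.
  by apply: mid_edge => //; rewrite -pw// -zE.
have ij := uniq i im si; rewrite -ij; split=> //.
by rewrite zE th.
Qed.

(** With no side, the points near the midpoint would be those of the edge alone, the image of a
    segment; with one side, they would be covered by the image of a half disk. [no_half_nbhs]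
    excludes both. *)
Lemma edge_two_sides (u v : G) : adj u v -> exists F1 j1 F2 j2,
  [/\ face G F1 /\ face G F2, (j1 < m F1)%N /\ (j2 < m F2)%N,
      face_side F1 j1 u v, face_side F2 j2 u v & (F1, j1) <> (F2, j2)].
Proof.
move=> uv; apply: contrapT => no.
have m12 : -1 <= (0 : R) <= 1 by apply/andP; split; lra.
have [[F [j [fF jm sj]]]|none] := pselect (exists F j, [/\ face G F, (j < m F)%N & face_side F j u v]); last first.
  apply: (@no_half_nbhs u v [set z | cdisk z /\ z.2 = 0] (fun z => arcg u v z.1)) => //.
  - apply: (@subclosed_compact _ _ cdisk); [|exact: compact_cdisk|by move=> z []].
    have -> : [set z : plane | cdisk z /\ z.2 = 0] = half_disk 1 `&` half_disk (-1).
      apply/seteqP; split=> z.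
        by move=> [zd z0]; split; split=> //; rewrite z0 mulr0.
      move=> [[zd]]; rewrite mul1r => z0 [_]; rewrite mulN1r oppr_ge0 => z0'; split=> //.
      by apply/eqP; rewrite eq_le z0 z0'.
    by apply: closedI; exact: closed_half_disk.
  - by move=> z [_ ->].
  - by split=> //; exact/odisk_cdisk/odisk0.
  - apply: (@cont_on_comp _ _ _ _ (@itv01 R) (fun z : plane => (1 + z.1) / 2)).
    + by move=> z [/disk_bound[z1 _] _]; exact: half01.
    + apply: cont_onM; last exact: cont_on_cst.
      by apply: cont_onD; [exact: cont_on_cst|apply: cont_on_fst; exact: cont_on_id].
    + exact/cont_onP/earc_continuous.
  - move=> z z' [/disk_bound[z1 _] z2] [/disk_bound[z1' _] z2'] /(arcg_inj uv z1 z1') e.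
    by rewrite [z]surjective_pairing [z']surjective_pairing e z2 z2'.
  - move=> x /andP[x0 x1]; exists (x, 0) => //; split=> //; apply/cdisk_x0.
    by rewrite !ltW.
  - move=> F z fF zd zp; have ui i : (i < m F)%N -> face_side F i u v -> i = 0%N.
      by move=> im si; case: none; exists F, i.
    have [_ [jm sj]] := polygon_boundary fF uv zd zp ui.
    by case: none; exists F, 0%N.
have uniq F' j' : face G F' -> (j' < m F')%N -> face_side F' j' u v -> (F', j') = (F, j).
  move=> fF' jm' sj'; apply: contrapT => ne; apply: no.
  by exists F', j', F, j.
have [e eP he] := side_arc fF sj.
have e0 : e != 0 by case: eP => ->; rewrite ?oppr_eq0 oner_eq0.
have ee : e ^+ 2 = 1 by case: eP => ->; rewrite ?sqrrN expr1n.
have dF := side_len_bound fF.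
apply: (@no_half_nbhs u v (half_disk 1)
  (fun z => hc F (side_mid F j) (side_len F) (e * z.1, z.2))) => //.
- exact: compact_half_disk.
- by move=> z [_]; rewrite mul1r.
- by split; [exact/odisk_cdisk/odisk0|rewrite /= mulr0].
- by rewrite /half_chart /= polar0 he.
- apply: (@cont_on_comp _ _ _ _ (half_disk 1)); last exact: (hc_cont poly).
    by move=> z [zd z0]; split=> //; move: zd; rewrite /closed_disk/= exprMn ee mul1r.
  apply: cont_on_pair; last by apply: cont_on_snd; exact: cont_on_id.
  by apply: cont_onM; [exact: cont_on_cst|apply: cont_on_fst; exact: cont_on_id].
- apply: (hc_inj poly fF dF eP _ _ he); first by move=> x y; exact: arcg_inj.
  by move=> x; exact: arcg_graph.
- move=> x /andP[x0 x1]; have x1' : -1 <= x <= 1 by rewrite !ltW.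
  exists (x, 0); last by rewrite /half_chart/= polar0 he.
  by split; [exact/cdisk_x0|rewrite /= mulr0].
move=> F' z fF' zd zp.
have ui i : (i < m F')%N -> face_side F' i u v -> i = j.
  by move=> im si; have [] := uniq F' i fF' im si.
have [zE [jm' sj']] := polygon_boundary fF' uv zd zp ui.
have [FE] := uniq F' j fF' jm' sj'; rewrite FE in zE *.
(* Points of the closed polygon close to the midpoint of the side therefore have polar coordinates,
   with nonnegative depth since their norm is at most 1. *)
have : open (polar (side_mid F j) (side_len F) @` odisk).
  apply: invariance_of_domain; [exact: plane_locally_disk|exact: open_odisk|exact: cont_on_polar|].
  by apply: inj_onS (polar_inj_on dF); exact: odisk_cdisk.
move=> op; have : nbhs z (polar (side_mid F j) (side_len F) @` odisk).
  apply: open_nbhs_nbhs; split=> //; exists 0; first exact: odisk0.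
  by rewrite (_ : 0 = (0, 0))// polar0 mulr0 addr0.
apply: filterS => _ [y oy <-] pd; have yd := odisk_cdisk oy.
have [_ /andP[y0 y1]] := disk_bound yd.
have y00 : 0 <= y.2.
  have : norm2 (polar (side_mid F j) (side_len F) y) <= 1 := pd.
  by rewrite norm2_polar => pd'; nra.
exists (e * y.1, y.2).
  by split; rewrite ?mul1r//; move: yd; rewrite /closed_disk/= exprMn ee mul1r.
by rewrite /= mulrA -expr2 ee mul1r -surjective_pairing.
Qed.

End Sides.

(** * Corners of faces *)

Section Corner.
Variables (R : realType) (S : topologicalType) (G : embedded_graph R S).
Local Notation plane := (R * R)%type.
Local Notation odisk := (@open_disk R).
Local Notation cdisk := (@closed_disk R).
Local Notation circle := (@unit_circle R).
Hypotheses (hH : hausdorff_space S) (hL : locally_disk R S).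
Variables (m : set S -> nat) (w : set S -> nat -> G) (phi : set S -> plane -> S).
Hypothesis poly : forall F, face G F -> polygon F (m F) (w F) (phi F).

Lemma adj_neqG (u v : G) : adj u v -> u <> v.
Proof. by move=> uv e; move: uv; rewrite e adj_irr. Qed.

Lemma earc_vpoint (u v x : G) t : adj u v -> itv01 t -> earc u v t = vpoint x ->
  (t = 0 /\ x = u) \/ (t = 1 /\ x = v).
Proof.
move=> uv t01 e; have [t0|t0] := eqVneq t 0.
  by left; split=> //; apply: (@vpoint_inj _ _ G); rewrite -e t0 earc0.
have [t1|t1] := eqVneq t 1.
  by right; split=> //; apply: (@vpoint_inj _ _ G); rewrite -e t1 earc1.
case: (@earc_vertex _ _ G u v x t) => //.
by move: t01; rewrite itv01E in_itv/= !lt_neqAle eq_sym t0 t1.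
Qed.

Lemma edgeC (u v : G) : adj u v -> edge u v = edge v u.
Proof.
move=> uv; have h a b : adj a b -> edge a b `<=` edge b a.
  move=> ab _ [t t01 <-]; exists (1 - t).
    by move: t01; rewrite /= !in_itv/= => /andP[? ?]; apply/andP; split; lra.
  rewrite earc_rev//; first by rewrite opprB subrKC.
  by rewrite in_itv/=; move: t01; rewrite /= in_itv/= => /andP[? ?]; apply/andP; split; lra.
by apply/seteqP; split; apply: h; rewrite // adj_sym.
Qed.

Definition interior_edge (u v : G) : set S := earc u v @` [set t | 0 < t < 1].

Lemma edge_interior (u v : G) x : edge u v x ->
  adj u v -> interior_edge u v x \/ x = vpoint u \/ x = vpoint v.
Proof.
move=> [t t01 <-] uv; have [t0|t0] := eqVneq t 0.
  by right; left; rewrite t0 earc0.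
have [t1|t1] := eqVneq t 1; first by right; right; rewrite t1 earc1.
left; exists t => //; move: t01; rewrite /= in_itv/= !lt_neqAle => /andP[h1 h2].
by rewrite eq_sym t0 t1 h1.
Qed.

Lemma interior_edge_edge (u v : G) : interior_edge u v `<=` edge u v.
Proof.
by move=> _ [t /andP[t0 t1] <-]; exists t; rewrite //= in_itv/= !ltW.
Qed.

Lemma interior_edge_disjoint (u v a b : G) x : adj u v -> adj a b ->
  interior_edge u v x -> edge a b x -> (a = u /\ b = v) \/ (a = v /\ b = u).
Proof.
move=> uv ab [s s01 <-] /edge_interior/(_ ab)[[t t01 e]|[|]].
- by apply: (@earc_disjoint _ _ G u v a b s t); rewrite ?in_itv.
- by move=> e; case: (@earc_vertex _ _ G u v a s) => //; rewrite in_itv.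
- by move=> e; case: (@earc_vertex _ _ G u v b s) => //; rewrite in_itv.
Qed.

Lemma interior_edge_arcg (u v : G) x : -1 < x < 1 -> interior_edge u v (arcg u v x).
Proof.
by move=> /andP[x0 x1]; exists ((1 + x) / 2) => //=; apply/andP; split; lra.
Qed.

(** The second half of the edge [a p] followed by the first half of [p b], with [p] at 0: a window
    of the boundary walk shifted by half a side, as [polygon_corner] shows. *)
Definition cornerg (a p b : G) (x : R) : S :=
  if 0 <= x then earc p b (x / 2) else earc a p (1 + x / 2).

Lemma cornerg_inj (a p b : G) x y : adj a p -> adj p b -> a <> b ->
  -1 <= x <= 1 -> -1 <= y <= 1 -> cornerg a p b x = cornerg a p b y -> x = y.
Proof.
move=> ap pb ab.
have key s t : 0 <= s <= 1 -> -1 <= t < 0 -> earc p b (s / 2) <> earc a p (1 + t / 2).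
  move=> /andP[s0 s1] /andP[t0 t1] e.
  have ti : interior_edge a p (earc a p (1 + t / 2)).
    by exists (1 + t / 2) => //=; apply/andP; split; lra.
  have : edge p b (earc a p (1 + t / 2)).
    by rewrite -e; exists (s / 2) => //=; rewrite in_itv/=; apply/andP; split; lra.
  move=> /(interior_edge_disjoint ap pb ti)[[pa _]|[_ ba]].
    by apply: (adj_neqG ap).
  by apply: ab.
move=> /andP[x0 x1] /andP[y0 y1]; rewrite /cornerg.
case: (leP 0 x) => hx; case: (leP 0 y) => hy e.
- have := earc_inj pb _ _ e; rewrite !in_itv/= => h.
  suff : x / 2 = y / 2 by lra.
  by apply: h; apply/andP; split; lra.
- by case: (key x y) => //; apply/andP; split; lra.
- by case: (key y x) => //; apply/andP; split; lra.
- have := earc_inj ap _ _ e; rewrite !in_itv/= => h.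
  suff : 1 + x / 2 = 1 + y / 2 by lra.
  by apply: h; apply/andP; split; lra.
Qed.

Lemma cornerg_edge (a p b : G) x : -1 <= x <= 1 ->
  edge p b (cornerg a p b x) \/ edge a p (cornerg a p b x).
Proof.
move=> /andP[x0 x1]; rewrite /cornerg; case: leP => h; [left|right].
  by exists (x / 2) => //=; rewrite in_itv/=; apply/andP; split; lra.
by exists (1 + x / 2) => //=; rewrite in_itv/=; apply/andP; split; lra.
Qed.

Lemma polygon_corner F j x : face G F -> -1 <= x <= 1 ->
  phi F (circle_point ((j.+1)%:R / (m F)%:R + side_len R m F * x)) =
  cornerg (w F j) (w F j.+1) (w F j.+2) x.
Proof.
move=> fF /andP[x0 x1]; have m0 := m_gt0 poly fF; have [_ _ wa _ pw] := poly fF.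
rewrite /cornerg /side_len; case: leP => h.
  rewrite -pw; last by rewrite itv01E; apply/andP; split; lra.
  by congr (phi F (circle_point _)); field; rewrite gt_eqF.
rewrite -pw; last by rewrite itv01E; apply/andP; split; lra.
congr (phi F (circle_point _)); rewrite -natr1; field.
by rewrite gt_eqF.
Qed.

Lemma corner_chart F1 j1 F2 j2 : face G F1 -> face G F2 -> F1 <> F2 ->
  w F1 j1.+1 = w F2 j2.+1 ->
  (w F1 j1 = w F2 j2 /\ w F1 j1.+2 = w F2 j2.+2) \/
  (w F1 j1 = w F2 j2.+2 /\ w F1 j1.+2 = w F2 j2) ->
  exists f, chart f (cornerg (w F1 j1) (w F1 j1.+1) (w F1 j1.+2)) F1 F2.
Proof.
move=> f1 f2 n12 wp wab.
have [_ _ wa1 _ _] := poly f1; have [_ _ wa2 _ _] := poly f2.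
have [ap ab] := wa1 j1; have [pb _] := wa1 j1.+1.
have g1 x : -1 <= x <= 1 -> phi F1 (circle_point ((j1.+1)%:R / (m F1)%:R + side_len R m F1 * (1 * x))) =
    cornerg (w F1 j1) (w F1 j1.+1) (w F1 j1.+2) x.
  by move=> x1; rewrite mul1r polygon_corner.
have [e eP g2] : exists2 e : R, e = 1 \/ e = -1 & forall x, -1 <= x <= 1 ->
    phi F2 (circle_point ((j2.+1)%:R / (m F2)%:R + side_len R m F2 * (e * x))) =
    cornerg (w F1 j1) (w F1 j1.+1) (w F1 j1.+2) x.
  case: wab => -[ea eb].
    by exists 1; [left|move=> x x1; rewrite mul1r polygon_corner// ea wp eb].
  exists (-1); [by right|move=> x /andP[x0 x1]; rewrite mulN1r polygon_corner//].
    rewrite -ea -wp -eb /cornerg oppr_ge0.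
    case: (leP x 0) => hx; case: (leP 0 x) => hx'; rewrite ?mulNr.
    - have -> : x = 0 by apply/eqP; rewrite eq_le hx.
      by rewrite mul0r oppr0 !earc0// adj_sym.
    - rewrite (earc_rev ap).
        by congr earc; lra.
      by rewrite in_itv/=; apply/andP; split; lra.
    - rewrite (earc_rev pb).
        by congr earc; lra.
      by rewrite in_itv/=; apply/andP; split; lra.
    - by have := lt_trans hx hx'; rewrite ltxx.
  by apply/andP; split; lra.
have [||z z' zd z'd z0 z'0 ez|f [fC _ _]] := make_chart poly f1 f2
   (side_len_bound poly f1) (side_len_bound poly f2) (or_introl erefl) eP _ _ g1 g2.
- by move=> x y; apply: cornerg_inj => //; exact: adj_neqG.
- move=> x /(cornerg_edge (w F1 j1) (w F1 j1.+1) (w F1 j1.+2))[h|h]; right.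
    by exists (w F1 j1.+1), (w F1 j1.+2).
  by exists (w F1 j1), (w F1 j1.+1).
- have h1 := hc_face poly ((j1.+1)%:R / (m F1)%:R) (side_len R m F1) f1 zd z0.
  have h2 := hc_face poly ((j2.+1)%:R / (m F2)%:R) (side_len R m F2) f2 z'd z'0.
  by rewrite -ez in h2; exact: n12 (face_eq f1 f2 h1 h2).
by exists f.
Qed.

(** The two faces and the two half edges fill an open disk around the apex. A further edge starts
    inside this disk and avoids the faces, so its first points lie on one of the two half edges. *)
Lemma corner_degree F1 j1 F2 j2 : face G F1 -> face G F2 -> F1 <> F2 ->
  w F1 j1.+1 = w F2 j2.+1 ->
  (w F1 j1 = w F2 j2 /\ w F1 j1.+2 = w F2 j2.+2) \/
  (w F1 j1 = w F2 j2.+2 /\ w F1 j1.+2 = w F2 j2) ->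
  forall y, adj (w F1 j1.+1) y -> y = w F1 j1 \/ y = w F1 j1.+2.
Proof.
move=> f1 f2 n12 wp wab y py.
have [_ _ wa1 _ _] := poly f1.
have [ap ab] := wa1 j1; have [pb _] := wa1 j1.+1.
have [f fC] := corner_chart f1 f2 n12 wp wab.
have oN := chart_open hL fC.
have g0 : f 0 = vpoint (w F1 j1.+1).
  by rewrite (chart_mid fC) /cornerg lexx mul0r earc0.
have t01 : itv01 (0 : R) by rewrite itv01E lexx ler01.
have Np : (f @` odisk) (earc (w F1 j1.+1) y 0).
  by rewrite earc0// -g0; exists 0 => //; exact: odisk0.
have /cont_onP ec := @earc_continuous _ _ G _ _ py.
have := cont_on_near ec t01 (open_nbhs_nbhs (conj oN Np)).
move=> /nbhs_ballP[r /= r0 rN].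
have [t [t0 tr t1]] := small_pos r0.
have [||z oz fz] := rN t.
- by rewrite -ball_normE /ball_/= sub0r normrN gtr0_norm.
- by rewrite /= in_itv/= !ltW.
have tI : interior_edge (w F1 j1.+1) y (f z) by rewrite fz; exists t => //=; rewrite t0.
have zd := odisk_cdisk oz; have [_ _ fg fu fl] := fC.
have nG F : face G F -> ~ F (f z).
  move=> fF /(face_nograph fF); apply; right; exists (w F1 j1.+1), y.
  by split=> //; exact: interior_edge_edge.
have z0 : z.2 = 0.
  have [z0|z0|//] := ltrgt0P z.2; first by case: (nG _ f1); exact: fu.
  by case: (nG _ f2); exact: fl.
have x1 : -1 <= z.1 <= 1 by case: (disk_bound zd).
have fE : f z = cornerg (w F1 j1) (w F1 j1.+1) (w F1 j1.+2) z.1.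
  by rewrite -fg// -z0 -surjective_pairing.
have := cornerg_edge (w F1 j1) (w F1 j1.+1) (w F1 j1.+2) x1; rewrite -fE.
move=> [/(interior_edge_disjoint py pb tI)|/(interior_edge_disjoint py ap tI)].
  by case=> [[_ ->]|[e e']]; [right|case: (adj_neqG py)].
by case=> [[e e']|[-> _]]; [case: (adj_neqG py)|left].
Qed.

End Corner.

(** * Triangles inside an embedded disk *)

Section Disk.
Variables (R : realType) (S : topologicalType) (G : embedded_graph R S).
Local Notation plane := (R * R)%type.
Local Notation odisk := (@open_disk R).
Local Notation cdisk := (@closed_disk R).
Local Notation circle := (@unit_circle R).
Local Notation adjG := (@adj R S G).
Hypotheses (hH : hausdorff_space S) (hL : locally_disk R S).
Variables (m : set S -> nat) (w : set S -> nat -> G) (phi : set S -> plane -> S).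
Hypothesis poly : forall F, face G F -> polygon F (m F) (w F) (phi F).

Lemma circle_near_odisk c (N : set plane) : circle c -> nbhs c N -> exists2 z, odisk z & N z.
Proof.
move=> cc /nbhs_ballP[r /= r0 rN].
have [e [e0 er e1]] := small_pos r0.
have [/andP[a0 a1] /andP[b0 b1]] := disk_bound (circle_cdisk cc).
exists ((1 - e) *: c).
  have -> : odisk ((1 - e) *: c) = (norm2 ((1 - e) *: c) < 1) by [].
  rewrite norm2Z (_ : norm2 c = 1)//; nra.
apply: rN; split; rewrite /= -ball_normE /ball_/= -[_ *: _]/(_ * _) ltr_norml;
  by apply/andP; split; nra.
Qed.

Lemma circle_not_interior c (N : set plane) : circle c -> nbhs c N -> ~ N `<=` cdisk.
Proof.
move=> cc /nbhs_ballP[r /= r0 rN] Nd.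
have [/andP[a0 a1] /andP[b0 b1]] := disk_bound (circle_cdisk cc).
have := Nd ((1 + r / 2) *: c).
have -> : cdisk ((1 + r / 2) *: c) = (norm2 ((1 + r / 2) *: c) <= 1) by [].
rewrite norm2Z (_ : norm2 c = 1)// => h.
suff : (1 + r / 2) ^+ 2 * 1 <= 1 by nra.
apply: h; apply: rN; split; rewrite /= -ball_normE /ball_/= -[_ *: _]/(_ * _) ltr_norml;
  by apply/andP; split; nra.
Qed.

Definition cycle_set (C : {set G}) : set S :=
  [set x | exists u v, [/\ u \in C, v \in C, adj u v & edge u v x]].

Lemma cyc_graph C : cycle_set C `<=` graph_set G.
Proof. by move=> x [u [v [_ _ uv xe]]]; right; exists u, v. Qed.

Lemma cyc_interior C (u v : G) x : adj u v -> interior_edge u v x -> cycle_set C x ->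
  (u \in C) && (v \in C).
Proof.
move=> uv xi [a [b [aC bC ab xe]]].
by have [[<- <-]|[<- <-]] := interior_edge_disjoint uv ab xi xe; rewrite aC bC.
Qed.

Lemma cyc_vertex C (a : G) : cycle_set C (vpoint a) -> a \in C.
Proof.
move=> [u [v [uC vC uv [t t01 e]]]].
by have [[_ ->]|[_ ->]] := earc_vpoint uv t01 e.
Qed.

Lemma vertex_cyc C (a : G) : triangle adjG C -> a \in C -> cycle_set C (vpoint a).
Proof.
move=> tC aC; have [b [c [ab ac bc CE]]] := triangle_edge (@adj_sym _ _ G) tC aC.
exists a, b; split=> //; first by rewrite CE !inE eqxx orbT.
by exists 0; [rewrite /= in_itv/= lexx ler01|rewrite earc0].
Qed.

Lemma edge_compact (u v : G) : adj u v -> compact (edge u v).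
Proof.
move=> uv; apply: cont_on_compact; last exact: segment_compact.
exact/cont_onP/earc_continuous.
Qed.

Lemma edge_connected (u v : G) : adj u v -> connected (edge u v).
Proof.
move=> uv; apply: cont_on_connected; last exact: segment_connected.
exact/cont_onP/earc_continuous.
Qed.

Lemma edge_vertex (u v : G) : adj u v -> edge u v (vpoint u) /\ edge u v (vpoint v).
Proof.
move=> uv; split; [exists 0|exists 1]; rewrite ?earc0 ?earc1//;
  by rewrite /= in_itv/= lexx ler01.
Qed.

Lemma cyc_triangle (a b c : G) : adj a b -> adj b c -> adj a c ->
  cycle_set [set a; b; c]%SET = edge a b `|` (edge a c `|` edge b c).
Proof.
move=> ab bc ac; apply/seteqP; split=> x.
  move=> [u [v [/in_set3 uC /in_set3 vC uv xe]]].
  case: uC xe uv => ->; case: vC => -> xe uv; try (by case: (adj_neqG uv)).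
  - by left.
  - by right; left.
  - by left; rewrite edgeC.
  - by right; right.
  - by right; left; rewrite edgeC.
  - by right; right; rewrite edgeC.
have aC : a \in [set a; b; c]%SET by rewrite !inE eqxx.
have bC : b \in [set a; b; c]%SET by rewrite !inE eqxx orbT.
have cC : c \in [set a; b; c]%SET by rewrite !inE eqxx orbT.
by move=> [|[|]] xe; [exists a, b|exists a, c|exists b, c].
Qed.

Lemma cyc_compact C : triangle adjG C -> compact (cycle_set C).
Proof.
move=> [a [b [c [ab bc ac ->]]]]; rewrite cyc_triangle//.
by apply: compactU; [|apply: compactU]; exact: edge_compact.
Qed.

(** An open disk with one boundary point is star-shaped. Adding a single point relates the face to
    that point even when other parts of its boundary lie on the 3-cycle under study. *)
Lemma face_point_connected F c : face G F -> circle c -> connected (F `|` [set phi F c]).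
Proof.
move=> fF cc.
have -> : F `|` [set phi F c] = phi F @` (odisk `|` [set c]).
  by rewrite image_setU image_set1 (phi_odisk poly fF).
apply: cont_on_connected.
  apply: cont_onS (phi_cont poly fF) => z [|->]; [exact: odisk_cdisk|exact: circle_cdisk].
apply: star_connected => t z t01 [oz|->]; first by left; exact: odisk_star.
have [->|t1] := eqVneq t 1; first by right; rewrite scale1r.
left; have -> : odisk (t *: c) = (norm2 (t *: c) < 1) by [].
move: t01; rewrite itv01E => /andP[t0 t1']; rewrite norm2Z (_ : norm2 c = 1)//.
have : t < 1 by rewrite lt_neqAle t1.
nra.
Qed.

Lemma sideS_boundary F j u v : face G F -> face_side w F j u v ->
  phi F (circle_point (side_mid R m F j)) = arcg u v 0.
Proof. exact: side_mid_arc. Qed.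

Lemma mid_interior (u v : G) : interior_edge u v (arcg u v 0).
Proof. by apply: interior_edge_arcg; apply/andP; split; lra. Qed.

Variables (delta : plane -> S) (C0 : {set G}).
Hypotheses (dc : cont_on cdisk delta) (dI : inj_on cdisk delta).
Hypotheses (tC0 : triangle adjG C0) (dC : delta @` circle = cycle_set C0).
(** The inverse of [delta]: parities live in the plane, so the disk is pulled back along it. *)
Variable del : S -> plane.
Hypotheses (delK : forall z, cdisk z -> del (delta z) = z).
Hypothesis delc : cont_on (delta @` cdisk) del.

Let D : set S := delta @` cdisk.
Let Do : set S := delta @` odisk.

Lemma Do_open : open Do.
Proof.
apply: invariance_of_domain => //; first exact: open_odisk.
  by apply: cont_onS dc; exact: odisk_cdisk.
by apply: inj_onS dI; exact: odisk_cdisk.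
Qed.

Lemma D_closed : closed D.
Proof. by apply: compact_closed => //; apply: cont_on_compact dc (@compact_cdisk R). Qed.

Lemma Do_D : Do `<=` D.
Proof. by move=> _ [z oz <-]; exists z => //; exact: odisk_cdisk. Qed.

Lemma D_split x : D x -> Do x \/ cycle_set C0 x.
Proof.
move=> [z zd <-]; have [oz|nz] := ltP (norm2 z) 1; first by left; exists z.
right; rewrite -dC; exists z => //; rewrite /unit_circle/=; apply/eqP.
by rewrite eq_le [_ <= 1]zd.
Qed.

Lemma cycD : cycle_set C0 `<=` D.
Proof. by rewrite -dC => _ [z zc <-]; exists z => //; exact: circle_cdisk. Qed.

Lemma Do_ncyc x : Do x -> ~ cycle_set C0 x.
Proof.
move=> [z oz <-]; rewrite -dC => -[c cc e].
have := dI (circle_cdisk cc) (odisk_cdisk oz) e => cz.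
by move: oz; rewrite -cz /open_disk/= cc ltxx.
Qed.

Lemma deltaK x : D x -> delta (del x) = x /\ cdisk (del x).
Proof. by move=> [z zd <-]; rewrite delK. Qed.

Lemma del_inj x y : D x -> D y -> del x = del y -> x = y.
Proof. by move=> Dx Dy e; rewrite -(deltaK Dx).1 -(deltaK Dy).1 e. Qed.

Lemma del_circle x : cycle_set C0 x -> norm2 (del x) = 1.
Proof. by rewrite -dC => -[c cc <-]; rewrite delK//; exact: circle_cdisk. Qed.

(** The open disk is open in [S], the closed disk is closed, and they differ by the cycle that [A]
    avoids. *)
Lemma disk_dichotomy A : connected A -> (forall x, A x -> ~ cycle_set C0 x) ->
  A `<=` Do \/ forall x, A x -> ~ D x.
Proof.
move=> cA nA; have [[a Aa Da]|no] := pselect (exists2 a, A a & Do a); last first.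
  right=> x Ax /D_split[Dx|]; last exact: nA.
  by apply: no; exists x.
left=> x Ax; apply: (@connected_locally_constant _ A Do cA _ a x Aa Ax Da) => y Ay.
have [Dy|nDy] := pselect (Do y).
  by apply: filterS (open_nbhs_nbhs (conj Do_open Dy)) => z Dz _.
have nD : ~ D y by move=> /D_split[//|]; exact: nA.
apply: filterS (open_nbhs_nbhs (conj (closed_openC D_closed) nD)) => z nDz _.
by split=> // /Do_D.
Qed.

Lemma phi_D F z : face G F -> F `<=` Do -> cdisk z -> D (phi F z).
Proof.
move=> fF FD zd; have [oz|nz] := ltP (norm2 z) 1; first by apply/Do_D/FD; exact: (phi_face poly fF).
apply: contrapT => nD.
have zc : circle z by rewrite /unit_circle/=; apply/eqP; rewrite eq_le [_ <= 1]zd.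
have := cont_on_near (phi_cont poly fF) zd (open_nbhs_nbhs (conj (closed_openC D_closed) nD)).
move=> /(circle_near_odisk zc)[y oy /(_ (odisk_cdisk oy))]; apply.
by apply/Do_D/FD; exact: (phi_face poly fF).
Qed.

Lemma face_point_in F c : face G F -> circle c -> ~ cycle_set C0 (phi F c) ->
  F `<=` Do <-> Do (phi F c).
Proof.
move=> fF cc nc.
have nA x : (F `|` [set phi F c]) x -> ~ cycle_set C0 x.
  by move=> [Fx /cyc_graph|->//]; exact: face_nograph Fx.
have [AD|AD] := disk_dichotomy (face_point_connected fF cc) nA.
  by split=> [_|_ x Fx]; apply: AD; [right|left].
split=> [FD|/Do_D/AD []]; last by right.
have F0 := phi_face poly fF (@odisk0 R).
by case: (AD _ (or_introl F0)); exact/Do_D/FD.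
Qed.

Lemma side_in F j u v : face G F -> face_side w F j u v -> ~~ ((u \in C0) && (v \in C0)) ->
  F `<=` Do <-> Do (arcg u v 0).
Proof.
move=> fF s nC; rewrite -(sideS_boundary fF s); apply: face_point_in => //.
  exact: circle_pointP.
rewrite (sideS_boundary fF s) => /(cyc_interior (sideS_adj poly fF s) (mid_interior u v)).
exact/negP.
Qed.

Lemma vertex_Do (x : G) : Do (vpoint x) -> x \notin C0.
Proof. by move=> /Do_ncyc nx; apply/negP => xC; apply: nx; exact: vertex_cyc. Qed.

(** Without its end [y], the edge avoids the boundary cycle, because [x] is not on it; the end [y]
    then belongs to the closed disk as a limit. *)
Lemma edge_in_D (x y : G) : Do (vpoint x) -> adj x y ->
  edge x y `<=` D /\ interior_edge x y `<=` Do.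
Proof.
move=> Dx xy; have nx := vertex_Do Dx.
pose A := earc x y @` [set t | 0 <= t < 1].
have ec : cont_on (@itv01 R) (earc x y) by exact/cont_onP/earc_continuous.
have cA : connected A.
  apply: cont_on_connected.
    by apply: cont_onS ec => t /= /andP[t0 t1]; rewrite itv01E t0 ltW.
  apply/connected_intervalP => s t /= /andP[s0 s1] /andP[t0 t1] z /andP[sz zt].
  by rewrite (le_trans s0 sz) (le_lt_trans zt t1).
have Ax : A (vpoint x) by exists 0; [rewrite /= lexx ltr01|rewrite earc0].
have nA z : A z -> ~ cycle_set C0 z.
  move=> [t /andP[t0 t1] <-].
  have [->|t00] := eqVneq t 0; first by rewrite earc0// => /cyc_vertex; exact/negP.
  have ti : interior_edge x y (earc x y t) by exists t; rewrite //= lt_neqAle eq_sym t00 t0.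
  by move=> /(cyc_interior xy ti); rewrite (negbTE nx).
have [AD|nAD] := disk_dichotomy cA nA; last by case: (nAD _ Ax); exact: Do_D.
have iD : interior_edge x y `<=` Do.
  by move=> _ [t /andP[t0 t1] <-]; apply: AD; exists t; rewrite //= ltW.
split=> // z /edge_interior/(_ xy)[/iD/Do_D//|[->|->]]; first exact: Do_D.
apply: contrapT => nD.
have o01 : itv01 (1 : R) by rewrite itv01E lexx ler01.
have nD' : (~` D) (earc x y 1) by rewrite earc1.
have := cont_on_near ec o01 (open_nbhs_nbhs (conj (closed_openC D_closed) nD')).
move=> /nbhs_ballP[r /= r0 rN].
have [e [e0 er e1]] := small_pos r0.
apply: (rN (1 - e)).
- by rewrite -ball_normE /ball_/= subKr gtr0_norm.
- by rewrite itv01E; apply/andP; split; lra.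
by apply/Do_D/iD; exists (1 - e) => //=; apply/andP; split; lra.
Qed.

(** If both faces were inside, a boundary point of the disk would have a neighbourhood in the disk,
    and pulled back by [delta] a point of the circle would be interior to the unit disk. If none
    were, the points of the open disk that approach the edge would lie nowhere. *)
Lemma boundary_one F1 j1 F2 j2 u v : face G F1 -> face G F2 ->
  (j1 < m F1)%N -> (j2 < m F2)%N -> face_side w F1 j1 u v -> face_side w F2 j2 u v ->
  (F1, j1) <> (F2, j2) -> u \in C0 -> v \in C0 ->
  (F1 `<=` Do /\ ~ F2 `<=` Do) \/ (F2 `<=` Do /\ ~ F1 `<=` Do).
Proof.
move=> f1 f2 l1 l2 s1 s2 n12 uC vC.
have uv := sideS_adj poly f1 s1.
have [f [fC _ _]] := edge_chart poly f1 f2 l1 l2 s1 s2 n12.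
have oN := chart_open hL fC; have [_ _ fg fu fl] := fC.
have m1 : -1 <= (0 : R) <= 1 by apply/andP; split; lra.
have ec x : -1 <= x <= 1 -> cycle_set C0 (arcg u v x).
  by move=> x1; exists u, v; split=> //; exists ((1 + x) / 2) => //; exact: half01.
have [c cc cp] : (delta @` circle) (arcg u v 0) by rewrite dC; exact: ec.
have Np : (f @` odisk) (delta c).
  by rewrite cp -(chart_mid fC); exists 0 => //; exact: odisk0.
have x1 z : odisk z -> -1 <= z.1 <= 1 by move=> /odisk_cdisk/disk_bound[].
have f0 z : odisk z -> z.2 = 0 -> cycle_set C0 (f z).
  by move=> oz z0; rewrite [z]surjective_pairing z0 fg ?x1//; apply: ec; exact: x1.
have notboth : ~ (F1 `<=` Do /\ F2 `<=` Do).
  move=> [F1D F2D].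
  have ND : f @` odisk `<=` delta @` cdisk.
    move=> _ [z oz <-]; have zd := odisk_cdisk oz.
    have [z0|z0|z0] := ltrgt0P z.2.
    - exact/Do_D/F1D/fu.
    - exact/Do_D/F2D/fl.
    - exact/cycD/f0.
  have := invariance_of_domain_inverse hH hL (@compact_cdisk R) dc dI oN ND.
  move=> oW; apply: (circle_not_interior cc (open_nbhs_nbhs (conj oW _))).
    by split=> //; exact: circle_cdisk.
  by move=> z [].
have one : F1 `<=` Do \/ F2 `<=` Do.
  have := cont_on_near dc (circle_cdisk cc) (open_nbhs_nbhs (conj oN Np)).
  move=> /(circle_near_odisk cc)[y oy /(_ (odisk_cdisk oy))[z oz fz]].
  have Dfz : Do (f z) by rewrite fz; exists y.
  have fD F : face G F -> F (f z) -> F `<=` Do.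
    move=> fF Ffz.
    have cF : connected F by case: fF => ? _ ->; exact: component_connected.
    have nF x : F x -> ~ cycle_set C0 x by move=> Fx /cyc_graph; exact: face_nograph Fx.
    by have [//|nD] := disk_dichotomy cF nF; case: (nD _ Ffz); exact: Do_D.
  have zd := odisk_cdisk oz; have [z0|z0|z0] := ltrgt0P z.2.
  - by left; apply: fD => //; exact: fu.
  - by right; apply: fD => //; exact: fl.
  - by case: (Do_ncyc Dfz); exact: f0.
case: one => h; [left|right]; split=> // h'; exact: notboth.
Qed.

Variables (FT : finType) (fc : FT -> set S).
Hypotheses (fcF : forall i, face G (fc i)) (fc_inj : injective fc).
Hypothesis fc_surj : forall F, face G F -> exists i, fc i = F.

Let mi i := m (fc i).
Let wi i := w (fc i).

Lemma sideP i j u v : side wi i j u v <-> face_side w (fc i) j u v.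
Proof.
split=> [/orP[]|[[]|[]]]; rewrite /side /wi.
- by move=> /andP[/eqP ? /eqP ?]; left.
- by move=> /andP[/eqP ? /eqP ?]; right.
- by move=> -> ->; rewrite !eqxx.
- by move=> -> ->; rewrite !eqxx orbT.
Qed.

Lemma sides_chart u v i1 j1 i2 j2 : sides mi wi u v i1 j1 i2 j2 ->
  [/\ adj u v, (j1 < m (fc i1))%N /\ (j2 < m (fc i2))%N, face_side w (fc i1) j1 u v,
      face_side w (fc i2) j2 u v & (fc i1, j1) <> (fc i2, j2)].
Proof.
move=> [[l1 l2] /sideP s1 /sideP s2 n12 _]; split=> //.
  exact: (sideS_adj poly (fcF i1) s1).
by move=> [/fc_inj e1 e2]; rewrite e1 e2 eqxx in n12.
Qed.

Definition disk_faces : {set FT} := [set i | `[< fc i `<=` Do >]]%SET.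
Definition disk_vertices : {set G} := [set x | `[< Do (vpoint x) >]]%SET.

Lemma disk_facesP i : reflect (fc i `<=` Do) (i \in disk_faces).
Proof. by rewrite inE; exact: asboolP. Qed.

Lemma disk_verticesP (x : G) : reflect (Do (vpoint x)) (x \in disk_vertices).
Proof. by rewrite inE; exact: asboolP. Qed.

Lemma polygon_vertex i j : phi (fc i) (circle_point (j%:R / (m (fc i))%:R)) = vpoint (w (fc i) j).
Proof.
have [_ _ wa _ pw] := poly (fcF i); have [a _] := wa j.
rewrite -(addr0 (j%:R)) pw ?earc0//.
by rewrite itv01E lexx ler01.
Qed.

Lemma disk_region : region adjG mi wi C0 disk_faces disk_vertices.
Proof.
split=> //.
- move=> u v i1 j1 i2 j2 /sides_chart[uv [l1 l2] s1 s2 n12].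
  have [/andP[uC vC]|nC] := boolP ((u \in C0) && (v \in C0)).
    have [[/disk_facesP-> /disk_facesP/negbTE->]|[/disk_facesP-> /disk_facesP/negbTE->]] //
      := boundary_one (fcF i1) (fcF i2) l1 l2 s1 s2 n12 uC vC.
  have h1 := side_in (fcF i1) s1 nC; have h2 := side_in (fcF i2) s2 nC.
  have -> : (i1 \in disk_faces) = (i2 \in disk_faces); last by rewrite addbb.
  by apply/disk_facesP/disk_facesP; rewrite h1 h2.
- by move=> x /disk_verticesP; exact: vertex_Do.
- move=> x y /disk_verticesP Dx xy; have [eD iD] := edge_in_D Dx xy; split.
    have /D_split[Dy|/cyc_vertex->] : D (vpoint y) by apply: eD; case: (edge_vertex xy).
      by apply/orP; left; exact/disk_verticesP.
    by rewrite orbT.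
  move=> i j /sideP s; apply/disk_facesP; apply/(side_in (fcF i) s).
    by rewrite (negbTE (vertex_Do Dx)).
  exact/iD/mid_interior.
- move=> i j /disk_facesP iD.
  have : D (vpoint (w (fc i) j)).
    rewrite -polygon_vertex; apply: phi_D => //.
    exact/circle_cdisk/circle_pointP.
  move=> /D_split[Dy|/cyc_vertex ->]; last by rewrite orbT.
  by apply/orP; left; exact/disk_verticesP.
Qed.

(** * Faces and vertices surrounded by a 3-cycle in the disk *)

Section Parity.
Variable C : {set G}.
Hypotheses (tC : triangle adjG C) (CD : cycle_set C `<=` D).

Let K : set plane := del @` cycle_set C.
Let ev x := even_around K (del x).

Lemma K_compact : compact K.
Proof.
apply: cont_on_compact; last exact: cyc_compact.
exact: cont_onS delc.
Qed.

Lemma K_cdisk : K `<=` cdisk.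
Proof. by move=> _ [x /CD Dx <-]; case: (deltaK Dx). Qed.

Lemma K_del x : D x -> K (del x) -> cycle_set C x.
Proof. by move=> Dx [y yC /(del_inj (CD yC) Dx) <-]. Qed.

Lemma ev_connected A x y : connected A -> A `<=` D -> (forall z, A z -> ~ cycle_set C z) ->
  A x -> A y -> ev x <-> ev y.
Proof.
move=> cA AD nA Ax Ay.
have cdA : connected (del @` A).
  by apply: cont_on_connected cA; exact: cont_onS delc.
have nK z : (del @` A) z -> ~ K z.
  by move=> [a Aa <-] /(K_del (AD _ Aa)); exact: nA.
by split; apply: (even_around_connected K_compact cdA nK); (by exists x) || (by exists y).
Qed.

(** Pulled back to the plane, [x] is on the unit circle and the 3-cycle stays in the unit disk, so
    [even_around_outside] applies. *)
Lemma ev_boundary x : cycle_set C0 x -> ~ cycle_set C x -> ev x.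
Proof.
move=> x0 nx; apply: even_around_outside; [exact: K_compact|exact: K_cdisk| |].
  by move=> /(K_del (cycD x0)).
by rewrite del_circle.
Qed.

Lemma odd_interior x : D x -> ~ cycle_set C x -> ~ ev x -> Do x.
Proof. by move=> /D_split[//|x0] nx; case; exact: ev_boundary. Qed.

Definition odd_faces : {set FT} :=
  [set i | `[< fc i `<=` Do /\ forall x, fc i x -> ~ ev x >]]%SET.
Definition odd_vertices : {set G} :=
  [set x | [&& x \notin C, `[< Do (vpoint x) >] & `[< ~ ev (vpoint x) >]]]%SET.

Lemma odd_face_point i c : circle c -> fc i `<=` Do -> ~ cycle_set C (phi (fc i) c) ->
  (i \in odd_faces) <-> ~ ev (phi (fc i) c).
Proof.
move=> cc iD nc; have fi := fcF i.
have AD : fc i `|` [set phi (fc i) c] `<=` D.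
  move=> x [/iD/Do_D//|->]; apply: phi_D => //; exact: circle_cdisk.
have nA x : (fc i `|` [set phi (fc i) c]) x -> ~ cycle_set C x.
  by move=> [Fx /cyc_graph|->//]; exact: face_nograph Fx.
have h x : fc i x -> ev x <-> ev (phi (fc i) c).
  move=> ix; apply: (ev_connected (face_point_connected fi cc) AD nA); first by left.
  by right.
split=> [|ne]; last first.
  by rewrite inE; apply/asboolP; split=> // x ix; rewrite h.
rewrite inE => /asboolP[_ ho].
have i0 := phi_face poly fi (@odisk0 R).
by rewrite -(h _ i0); exact: ho.
Qed.

Lemma odd_face_any i x : fc i `<=` Do -> fc i x -> (i \in odd_faces) <-> ~ ev x.
Proof.
move=> iD ix; split=> [|nx]; first by rewrite inE => /asboolP[_]; exact.
rewrite inE; apply/asboolP; split=> // y iy.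
have cF : connected (fc i) by have [? _ ->] := fcF i; exact: component_connected.
have nF z : fc i z -> ~ cycle_set C z by move=> iz /cyc_graph; exact: face_nograph iz.
by rewrite (@ev_connected (fc i) y x)// => z /iD/Do_D.
Qed.

Lemma triangle_two (u v : G) : adj u v -> u \in C -> v \in C ->
  exists z, [/\ adj u z, adj v z & C = [set u; v; z]%SET].
Proof.
move=> uv uC vC; have [y [z [uy uz yz CE]]] := triangle_edge (@adj_sym _ _ G) tC uC.
have : v \in [set u; y; z]%SET by rewrite -CE.
move=> /in_set3[vu|vy|vz].
- by move: uv; rewrite vu adj_irr.
- by exists z; rewrite vy.
- exists y; rewrite vz; split=> //; first by rewrite adj_sym.
  by rewrite CE -!finset.setUA; congr (_ :|: _)%SET; rewrite finset.setUC.
Qed.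

Lemma arclike_edge (a b : G) : adj a b -> edge a b `<=` D -> arclike (del @` edge a b).
Proof.
move=> ab abD.
have -> : del @` edge a b = (fun t => del (earc a b t)) @` (@itv01 R).
  by rewrite /edge image_comp.
have ac t : itv01 t -> D (earc a b t) by move=> t01; apply: abD; exists t.
apply: arclike_path.
  by apply: (@cont_on_comp _ _ _ _ D) => //; exact/cont_onP/earc_continuous.
move=> s t s01 t01 /(del_inj (ac _ s01) (ac _ t01)).
by apply: (earc_inj ab); rewrite in_itv/= -itv01E.
Qed.

(** The edge [u v] is the diameter of [f], and the other two edges of [C] together form the arclike
    set of [parity_jump]. *)
Lemma jump (f : plane -> plane) (u v : G) : adj u v -> u \in C -> v \in C ->
  cont_on cdisk f -> inj_on cdisk f ->
  (forall x, -1 <= x <= 1 -> f (x, 0) = del (arcg u v x)) ->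
  (forall y, cdisk y -> y.2 != 0 -> ~ K (f y)) ->
  forall y z, odisk y -> odisk z -> 0 < y.2 -> z.2 < 0 ->
  even_around K (f y) <-> ~ even_around K (f z).
Proof.
move=> uv uC vC fcont fI fg fK y z oy oz y2 z2.
have [t [ut vt CE]] := triangle_two uv uC vC.
have tv : adj t v by rewrite adj_sym.
have KE : cycle_set C = edge u v `|` (edge u t `|` edge v t) by rewrite CE cyc_triangle.
have utD : edge u t `<=` D by move=> x xe; apply: CD; rewrite KE; right; left.
have vtD : edge v t `<=` D by move=> x xe; apply: CD; rewrite KE; right; right.
have uvD : edge u v `<=` D by move=> x xe; apply: CD; rewrite KE; left.
pose L := del @` edge u t `|` del @` edge v t.
have [uu tu] := edge_vertex ut; have [vv tv'] := edge_vertex vt.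
have aL : arclike L.
  apply: (@arclikeU _ _ _ (del (vpoint t))); [exact: arclike_edge|exact: arclike_edge|].
  apply/seteqP; split=> [_ [[x xu <-] [x' xv e]]|_ ->]; last by split; [exists (vpoint t)|exists (vpoint t)].
  have {}e := del_inj (vtD _ xv) (utD _ xu) e; rewrite e in xv.
  have [xi|[xE|->//]] := edge_interior xu ut; last first.
    rewrite xE in xv *; congr del; have [s s01 se] := xv.
    have [[_ vu]|[_ ut']] := earc_vpoint vt s01 se; first by case: (adj_neqG uv).
    by rewrite ut'.
  by have [[vu _]|[e1 e2]] := interior_edge_disjoint ut vt xi xv;
    [case: (adj_neqG uv)|case: (adj_neqG vt)].
have arcE : (fun s => f (lens_arc 0 s)) @` (@itv01 R) = del @` edge u v.
  rewrite /edge image_comp; apply: eq_imagel => s s01; rewrite /lens_arc mul0r fg.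
    by congr del; rewrite /arcg; congr earc; field.
  by move: s01; rewrite itv01E => /andP[? ?]; apply/andP; split; lra.
have KL : K = (fun s => f (lens_arc 0 s)) @` (@itv01 R) `|` L.
  by rewrite arcE /K KE !image_setU.
have m1 : -1 <= (-1 : R) <= 1 by apply/andP; split; lra.
have p1 : -1 <= (1 : R) <= 1 by apply/andP; split; lra.
have fN1 : f (-1, 0) = del (vpoint u).
  by rewrite fg// /arcg (_ : (1 + -1) / 2 = 0) ?earc0//; field.
have f1 : f (1, 0) = del (vpoint v).
  by rewrite fg// /arcg (_ : (1 + 1) / 2 = 1) ?earc1//; field.
have LI : L `&` (f @` cdisk) = [set f (-1, 0); f (1, 0)].
  apply/seteqP; split; last first.
    move=> _ [->|->]; split.
    - by rewrite fN1; left; exists (vpoint u).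
    - by exists (-1, 0) => //; exact/cdisk_x0.
    - by rewrite f1; right; exists (vpoint v).
    - by exists (1, 0) => //; exact/cdisk_x0.
  move=> q0 [Lx [x xd ex]]; rewrite -{}ex in Lx *.
  have x2 : x.2 = 0.
    apply/eqP; apply/negPn/negP => x2; apply: (fK x xd x2).
    by rewrite KL; right.
  have x1 : -1 <= x.1 <= 1 by case: (disk_bound xd).
  have fx : f x = del (arcg u v x.1) by rewrite -fg// -x2 -surjective_pairing.
  rewrite fx; have au : edge u v (arcg u v x.1) by exists ((1 + x.1) / 2) => //; exact: half01.
  have xut : edge u t (arcg u v x.1) \/ edge v t (arcg u v x.1).
    by move: Lx; rewrite fx => -[] [q qe e]; [left|right];
      rewrite -(@del_inj q (arcg u v x.1))//; (exact: utD || exact: vtD || exact: uvD).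
  have [xi|[->|->]] := edge_interior au uv; [|by left; rewrite fN1|by right; rewrite f1].
  case: xut => [/(interior_edge_disjoint uv ut xi)|/(interior_edge_disjoint uv vt xi)].
    by move=> [[_ tv0]|[uv0 _]]; [case: (adj_neqG vt)|case: (adj_neqG uv)].
  by move=> [[vu0 _]|[_ tu0]]; [case: (adj_neqG uv)|case: (adj_neqG ut)].
have := parity_jump fcont fI aL LI oy oz y2 z2.
by rewrite -KL.
Qed.

Lemma jump_inside i1 j1 i2 j2 u v : (j1 < m (fc i1))%N -> (j2 < m (fc i2))%N ->
  face_side w (fc i1) j1 u v -> face_side w (fc i2) j2 u v -> (fc i1, j1) <> (fc i2, j2) ->
  u \in C -> v \in C -> fc i1 `<=` Do -> fc i2 `<=` Do ->
  (i1 \in odd_faces) = ~~ (i2 \in odd_faces).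
Proof.
move=> l1 l2 s1 s2 n12 uC vC i1D i2D.
have uv := sideS_adj poly (fcF i1) s1.
have [f [[fcont fI fg fu fl] _ _]] := edge_chart poly (fcF i1) (fcF i2) l1 l2 s1 s2 n12.
have fD z : cdisk z -> D (f z).
  move=> zd; have [z0|z0|z0] := ltrgt0P z.2.
  - exact/Do_D/i1D/fu.
  - exact/Do_D/i2D/fl.
  - rewrite [z]surjective_pairing z0 fg; last by case: (disk_bound zd).
    apply: CD; exists u, v; split=> //; exists ((1 + z.1) / 2) => //.
    by apply: half01; case: (disk_bound zd).
have dfc : cont_on cdisk (fun z => del (f z)) by apply: (@cont_on_comp _ _ _ _ D).
have dfI : inj_on cdisk (fun z => del (f z)).
  by move=> x y xd yd /(del_inj (fD _ xd) (fD _ yd)); exact: fI.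
have dfg x : -1 <= x <= 1 -> del (f (x, 0)) = del (arcg u v x) by move=> /fg ->.
have dfK y : cdisk y -> y.2 != 0 -> ~ K (del (f y)).
  move=> yd y2 /(K_del (fD _ yd))/cyc_graph.
  have [y0|y0|y0] := ltrgt0P y.2; last by rewrite y0 eqxx in y2.
    exact: (face_nograph (fcF i1) (fu _ yd y0)).
  exact: (face_nograph (fcF i2) (fl _ yd y0)).
pose y : plane := (0, 1 / 2); pose z : plane := (0, - (1 / 2)).
have oy : odisk y by rewrite /open_disk/= expr0n/=; lra.
have oz : odisk z by rewrite /open_disk/= expr0n/=; lra.
have y2 : 0 < y.2 by rewrite /=; lra.
have z2 : z.2 < 0 by rewrite /=; lra.
have jj := jump uv uC vC dfc dfI dfg dfK oy oz y2 z2.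
have h1 := odd_face_any i1D (fu _ (odisk_cdisk oy) y2).
have h2 := odd_face_any i2D (fl _ (odisk_cdisk oz) z2).
apply/idP/idP => [/h1 ny|/negP n2].
  apply/negP => /h2 nz; apply: ny; exact/jj.
by apply/h1 => /jj nz; apply: n2; exact/h2.
Qed.

(** Only one face at the edge is in the disk, so the chart is completed in the plane: its lower half
    is a collar beyond the unit circle, where the parity is even. By [jump] it is odd in [fc i1]. *)
Lemma jump_boundary i1 j1 i2 j2 u v : (j1 < m (fc i1))%N -> (j2 < m (fc i2))%N ->
  face_side w (fc i1) j1 u v -> face_side w (fc i2) j2 u v -> (fc i1, j1) <> (fc i2, j2) ->
  u \in C -> v \in C -> u \in C0 -> v \in C0 -> fc i1 `<=` Do -> i1 \in odd_faces.
Proof.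
move=> l1 l2 s1 s2 n12 uC vC uC0 vC0 i1D.
have uv := sideS_adj poly (fcF i1) s1.
have [f [[fcont fI fg fu _] _ _]] := edge_chart poly (fcF i1) (fcF i2) l1 l2 s1 s2 n12.
have edgeC0 x : -1 <= x <= 1 -> cycle_set C0 (arcg u v x).
  by move=> x1; exists u, v; split=> //; exists ((1 + x) / 2) => //; exact: half01.
have f0 z : cdisk z -> z.2 = 0 -> f z = arcg u v z.1.
  move=> zd z0; rewrite [in LHS](surjective_pairing z) z0 fg//.
  by case: (disk_bound zd).
have fD z : half_disk 1 z -> D (f z).
  move=> [zd]; rewrite mul1r le_eqVlt => /orP[/eqP z0|z0]; last exact/Do_D/i1D/fu.
  by rewrite f0//; apply/cycD/edgeC0; case: (disk_bound zd).
pose h1 z := del (f z).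
(* On the lower half [1 - z.2] is at least 1, so the arc is pushed radially outwards. *)
pose h2 (z : plane) : plane := (1 - z.2) *: del (arcg u v z.1).
have h1c : cont_on (half_disk 1) h1.
  by apply: (@cont_on_comp _ _ _ _ D) => //; apply: cont_onS fcont; exact: half_diskS.
have h1I : inj_on (half_disk 1) h1.
  by move=> x y xd yd /(del_inj (fD _ xd) (fD _ yd)); apply: fI; [exact: (half_diskS xd)|exact: (half_diskS yd)].
have z1 (z : plane) : half_disk (-1) z -> -1 <= z.1 <= 1 by move=> [/disk_bound[]].
have h2c : cont_on (half_disk (-1)) h2.
  apply: cont_on_scalep.
    by apply: cont_onB; [exact: cont_on_cst|apply: cont_on_snd; exact: cont_on_id].
  apply: (@cont_on_comp _ _ _ _ D _ _ _ _ delc).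
    by move=> z /z1/edgeC0/cycD.
  apply: (@cont_on_comp _ _ _ _ (@itv01 R) (fun z : plane => (1 + z.1) / 2)).
  - by move=> z /z1; exact: half01.
  - apply: cont_onM; last exact: cont_on_cst.
    by apply: cont_onD; [exact: cont_on_cst|apply: cont_on_fst; exact: cont_on_id].
  - exact/cont_onP/earc_continuous.
have n2 z : half_disk (-1) z -> norm2 (h2 z) = (1 - z.2) ^+ 2.
  by move=> /z1/edgeC0 ze; rewrite norm2Z del_circle// mulr1.
have zneg (z : plane) : half_disk (-1) z -> z.2 <= 0 by move=> [_]; rewrite mulN1r oppr_ge0.
have h2I : inj_on (half_disk (-1)) h2.
  move=> x y xh yh e; have := congr1 (@norm2 R) e; rewrite !n2// => /eqP.
  have x2 := zneg x xh; have y2 := zneg y yh.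
  rewrite eqrXn2//; [|lra|lra]; move=> /eqP xy.
  have xy2 : x.2 = y.2 by lra.
  move: e; rewrite /h2 xy => /scalerI e.
  have {}e : del (arcg u v x.1) = del (arcg u v y.1) by apply: e; rewrite gt_eqF//; lra.
  have := del_inj (cycD (edgeC0 _ (z1 _ xh))) (cycD (edgeC0 _ (z1 _ yh))) e.
  move=> /(arcg_inj uv (z1 _ xh) (z1 _ yh)) xy1.
  by rewrite [x]surjective_pairing [y]surjective_pairing xy1 xy2.
have h12 (x : R) : cdisk (x, 0) -> h1 (x, 0) = h2 (x, 0).
  by move=> xd; rewrite /h1 /h2 /= subr0 scale1r f0.
have Lh (z : plane) : cdisk z -> z.2 <= 0 -> half_disk (-1) z by split=> //; rewrite mulN1r oppr_ge0.
have Uh (z : plane) : cdisk z -> 0 <= z.2 -> half_disk 1 z by split=> //; rewrite mul1r.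
have out z : cdisk z -> z.2 < 0 -> 1 < norm2 (h2 z).
  by move=> zd z0; rewrite n2; [nra|apply: Lh => //; exact: ltW].
have h1n2 z z' : cdisk z -> cdisk z' -> 0 < z.2 -> z'.2 < 0 -> h1 z <> h2 z'.
  move=> zd z'd z0 z'0 e; have := out _ z'd z'0; rewrite -e.
  have [_ h1d] := deltaK (fD _ (Uh _ zd (ltW z0))).
  by rewrite ltNge [_ <= 1]h1d.
have [g [gc gI gu gl]] := glue_half_disks h1c h2c h1I h2I h12 h1n2.
have gg x : -1 <= x <= 1 -> g (x, 0) = del (arcg u v x).
  move=> x1; have xd : cdisk (x, 0) by apply/cdisk_x0.
  by rewrite gu//= /h1 f0.
have gK y : cdisk y -> y.2 != 0 -> ~ K (g y).
  move=> yd y2; have [y0|y0|y0] := ltrgt0P y.2; last by rewrite y0 eqxx in y2.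
    rewrite gu ?(ltW y0)// => /(K_del (fD _ (Uh _ yd (ltW y0))))/cyc_graph.
    exact: (face_nograph (fcF i1) (fu _ yd y0)).
  rewrite gl ?(ltW y0)// => /K_cdisk hd; have := out _ yd y0.
  by rewrite ltNge [_ <= 1]hd.
pose y : plane := (0, 1 / 2); pose z : plane := (0, - (1 / 2)).
have oy : odisk y by rewrite /open_disk/= expr0n/=; lra.
have oz : odisk z by rewrite /open_disk/= expr0n/=; lra.
have y2 : 0 < y.2 by rewrite /=; lra.
have z2 : z.2 < 0 by rewrite /=; lra.
have jj := jump uv uC vC gc gI gg gK oy oz y2 z2.
have yd := odisk_cdisk oy; have zd := odisk_cdisk oz.
apply/(odd_face_any i1D (fu _ yd y2)); rewrite /ev -/(h1 y) -gu ?(ltW y2)// => /jj; apply.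
apply: even_around_outside; [exact: K_compact|exact: K_cdisk| |].
  by apply: gK; rewrite // lt_eqF.
by rewrite gl ?(ltW z2)// ltW// out.
Qed.

(** The change of parity across an edge is checked for edges on [C0], inside the disk and outside
    it. Off [C], the parity is carried along edges and along faces with one boundary point. *)
Lemma odd_region : region adjG mi wi C odd_faces odd_vertices.
Proof.
have notin u v : adj u v -> ~~ ((u \in C) && (v \in C)) -> ~ cycle_set C (arcg u v 0).
  by move=> uv nC /(cyc_interior uv (mid_interior u v)); exact/negP.
have status i j u v : face_side w (fc i) j u v -> ~~ ((u \in C) && (v \in C)) ->
    fc i `<=` Do -> (i \in odd_faces) <-> ~ ev (arcg u v 0).
  move=> s nC iD; rewrite -(sideS_boundary (fcF i) s).
  apply: odd_face_point => //; first exact: circle_pointP.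
  rewrite (sideS_boundary (fcF i) s); apply: notin => //.
  exact: (sideS_adj poly (fcF i) s).
have out i : ~ fc i `<=` Do -> (i \in odd_faces) = false.
  by move=> niD; rewrite inE; apply/asboolP => -[].
split=> //.
- move=> u v i1 j1 i2 j2 /sides_chart[uv [l1 l2] s1 s2 n12].
  have [/andP[uC0 vC0]|nC0] := boolP ((u \in C0) && (v \in C0)).
    have one i j i' j' : (j < m (fc i))%N -> (j' < m (fc i'))%N ->
        face_side w (fc i) j u v -> face_side w (fc i') j' u v -> (fc i, j) <> (fc i', j') ->
        fc i `<=` Do -> (i \in odd_faces) = (u \in C) && (v \in C).
      move=> l l' s s' n iD; have [/andP[uC vC]|nC] := boolP ((u \in C) && (v \in C)).
        by rewrite (jump_boundary l l' s s' n).
      apply/idP => /(status _ _ _ _ s nC iD); apply.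
      apply: ev_boundary; last exact: notin.
      exists u, v; split=> //; exact/interior_edge_edge/mid_interior.
    have [[iD /out->]|[iD /out->]] := boundary_one (fcF i1) (fcF i2) l1 l2 s1 s2 n12 uC0 vC0.
      by rewrite addbF (one _ _ _ _ l1 l2 s1 s2 n12).
    by rewrite addFb (one _ _ _ _ l2 l1 s2 s1 (fun e => n12 (esym e))).
  have h1 := side_in (fcF i1) s1 nC0; have h2 := side_in (fcF i2) s2 nC0.
  have [Dm|nDm] := pselect (Do (arcg u v 0)); last first.
    rewrite !out ?h1 ?h2//; apply/esym/negbTE/negP => /andP[uC vC].
    have /CD/D_split[//|] : cycle_set C (arcg u v 0).
      by exists u, v; split=> //; exact/interior_edge_edge/mid_interior.
    by move=> /(cyc_interior uv (mid_interior u v)); exact/negP.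
  have i1D : fc i1 `<=` Do by rewrite h1.
  have i2D : fc i2 `<=` Do by rewrite h2.
  have [/andP[uC vC]|nC] := boolP ((u \in C) && (v \in C)).
    by rewrite (jump_inside l1 l2 s1 s2 n12 uC vC i1D i2D); case: (_ \in _).
  have -> : (i1 \in odd_faces) = (i2 \in odd_faces); last by rewrite addbb.
  apply/idP/idP => h.
    by apply/(status _ _ _ _ s2 nC i2D)/(status _ _ _ _ s1 nC i1D).
  by apply/(status _ _ _ _ s1 nC i1D)/(status _ _ _ _ s2 nC i2D).
- by move=> x; rewrite inE => /and3P[].
- move=> x y; rewrite inE => /and3P[xC /asboolP Dx /asboolP nx] xy.
  have [eD iD] := edge_in_D Dx xy.
  have nC : ~~ ((x \in C) && (y \in C)) by rewrite (negbTE xC).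
  have [vx vy] := edge_vertex xy.
  have nA z : edge x y z -> z <> vpoint y -> ~ cycle_set C z.
    move=> /edge_interior/(_ xy)[zi _ /(cyc_interior xy zi)|[->|//] _ /cyc_vertex]; exact/negP.
  have midD := iD _ (mid_interior x y).
  (* The end [y] is left out because it may lie on [C]; the half-open edge still joins [x] to the
     midpoint. *)
  pose A := earc x y @` [set t | 0 <= t < 1].
  have AE : A `<=` edge x y.
    by move=> _ [t /andP[t0 t1] <-]; exists t; rewrite //= in_itv/= t0 ltW.
  have cA : connected A.
    apply: cont_on_connected.
      have /cont_onP := @earc_continuous _ _ G x y xy; apply: cont_onS => t /= /andP[t0 t1].
      by rewrite in_itv/= t0 ltW.
    apply/connected_intervalP => s t /= /andP[s0 s1] /andP[t0 t1] z /andP[sz zt].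
    by rewrite (le_trans s0 sz) (le_lt_trans zt t1).
  have nAC z : A z -> ~ cycle_set C z.
    move=> Az; apply: nA; first exact: AE.
    move: Az => [t /andP[t0 t1] <-] e.
    have t01 : itv01 t by rewrite itv01E t0 ltW.
    have [[_ yx]|[te _]] := earc_vpoint xy t01 e; first by case: (adj_neqG xy).
    by rewrite te ltxx in t1.
  have Ax : A (vpoint x) by exists 0; [rewrite /= lexx ltr01|rewrite earc0].
  have Am : A (arcg x y 0) by exists ((1 + 0) / 2) => //=; apply/andP; split; lra.
  have AD : A `<=` D by move=> z /AE/eD.
  have nm : ~ ev (arcg x y 0) by rewrite -(ev_connected cA AD nAC Ax Am).
  split.
    have [yC|yC] := boolP (y \in C); first by rewrite orbT.
    have nE z : edge x y z -> ~ cycle_set C z.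
      move=> ze; have [->|zy] := pselect (z = vpoint y); last exact: nA.
      by move=> /cyc_vertex; exact/negP.
    have ny : ~ ev (vpoint y).
      by rewrite -(ev_connected (edge_connected xy) eD nE vx vy).
    rewrite orbF inE yC/=; apply/andP; split; apply/asboolP => //.
    by apply: odd_interior => //; [exact: eD|exact: nE].
  move=> i j /sideP s.
  have iD' : fc i `<=` Do.
    by apply/(side_in (fcF i) s) => //; rewrite (negbTE (vertex_Do Dx)).
  exact/(status _ _ _ _ s nC iD').
- move=> i j iX; have [wC|wC] := boolP (wi i j \in C); first by rewrite orbT.
  have iD : fc i `<=` Do by move: iX; rewrite inE => /asboolP[].
  have cc := circle_pointP (j%:R / (m (fc i))%:R : R).
  have nc : ~ cycle_set C (phi (fc i) (circle_point (j%:R / (m (fc i))%:R))).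
    by rewrite polygon_vertex => /cyc_vertex; exact/negP.
  have := (odd_face_point cc iD nc).1 iX; rewrite polygon_vertex => nw.
  rewrite orbF inE wC/=; apply/andP; split; apply/asboolP => //.
  apply: odd_interior nw; last by rewrite -polygon_vertex.
  by rewrite -polygon_vertex; apply: phi_D => //; exact: circle_cdisk.
Qed.

End Parity.

Lemma mi_gt2 i : (2 < mi i)%N.
Proof. by have [h _ _ _ _] := poly (fcF i). Qed.

Lemma wi_periodic i j : wi i (j + mi i)%N = wi i j.
Proof. by have [_ h _ _ _] := poly (fcF i); exact: h. Qed.

Lemma wi_adj1 i j : adjG (wi i j) (wi i j.+1).
Proof. by have [_ _ wa _ _] := poly (fcF i); case: (wa j). Qed.

Lemma wi_adj2 i j : adjG (wi i j) (wi i j.+2).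
Proof. by have [_ _ wa _ _] := poly (fcF i); case: (wa j). Qed.

Lemma wi_two_sided u v : adjG u v -> exists i1 j1 i2 j2, sides mi wi u v i1 j1 i2 j2.
Proof.
move=> uv; have [F1 [j1 [F2 [j2 [[f1 f2] [l1 l2] s1 s2 n12]]]]] := edge_two_sides hH hL poly uv.
have [i1 e1] := fc_surj f1; have [i2 e2] := fc_surj f2.
rewrite -{}e1 -{}e2 in f1 f2 l1 l2 s1 s2 n12.
exists i1, j1, i2, j2; split=> //; [exact/sideP|exact/sideP| |].
  by apply/eqP => -[e1 e2]; apply: n12; rewrite e1 e2.
move=> i j jm /sideP s.
have [[/fc_inj-> ->]|[/fc_inj-> ->]] := at_most_two hL poly f1 f2 (fcF i) l1 l2 jm s1 s2 s n12.
  by left.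
by right.
Qed.

Lemma wi_corner i1 j1 i2 j2 : i1 != i2 -> wi i1 j1.+1 = wi i2 j2.+1 ->
  (wi i1 j1 = wi i2 j2 /\ wi i1 j1.+2 = wi i2 j2.+2 \/
   wi i1 j1 = wi i2 j2.+2 /\ wi i1 j1.+2 = wi i2 j2) ->
  forall y, adjG (wi i1 j1.+1) y -> y = wi i1 j1 \/ y = wi i1 j1.+2.
Proof.
move=> n12; apply: (corner_degree hL poly (fcF i1) (fcF i2)).
by move=> /fc_inj e; rewrite e eqxx in n12.
Qed.

(** The union of the closed faces of a balanced set is compact, and it is a neighbourhood of each of
    its points that is not a vertex, since an edge has both or none of its sides in [Y]. In the
    plane, a ray that starts in this union and avoids the vertices could never leave it, although
    the union is bounded. *)
Lemma disk_balanced (Y : {set FT}) : Y \subset disk_faces -> balanced mi wi Y ->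
  Y = finset.set0.
Proof.
move=> sY bY; apply/eqP; apply/negPn/negP => /set0Pn[i iY].
have YD k : k \in Y -> fc k `<=` Do.
  by move=> kY; apply/disk_facesP; exact: (fintype.subsetP sY).
pose KY := [set x | exists2 k, k \in Y & (phi (fc k) @` cdisk) x].
have KYD : KY `<=` D.
  by move=> _ [k kY [z zd <-]]; apply: phi_D => //; exact: YD.
have cKY : compact KY.
  have -> : KY = \big[setU/set0]_(k <- enum Y) (phi (fc k) @` cdisk).
    rewrite -bigcup_seq; apply/seteqP; split=> x [k kY xk]; exists k => //.
      by rewrite /= mem_enum.
    by move: kY; rewrite /= mem_enum.
  apply: bigsetU_compact => k _; apply: cont_on_compact; last exact: compact_cdisk.
  exact: (phi_cont poly (fcF k)).
pose PY := del @` KY.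
have cPY : closed PY.
  apply: compact_closed_plane; apply: cont_on_compact cKY.
  exact: cont_onS delc.
have PYd : PY `<=` cdisk by move=> _ [x /KYD/deltaK[_ xd] <-].
have fKY k : k \in Y -> fc k `<=` KY.
  move=> kY x kx; exists k => //; have : (phi (fc k) @` odisk) x by rewrite (phi_odisk poly (fcF k)).
  by move=> [z oz <-]; exists z => //; exact: odisk_cdisk.
have opn x : KY x -> (forall v : G, x <> vpoint v) -> exists N, [/\ open N, N x & N `<=` KY].
  move=> [k kY [z zd <-]] nv; have fk := fcF k.
  have [oz|nz] := ltP (norm2 z) 1.
    exists (fc k); split; [exact: (face_open hL poly)|exact: (phi_face poly)|exact: fKY].
  have zc : circle z by rewrite /unit_circle/=; apply/eqP; rewrite eq_le [_ <= 1]zd.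
  have m0 : (0 < m (fc k))%N by rewrite (ltn_trans _ (mi_gt2 k)).
  have [j [t [jm /andP[t0 t1] zE]]] := circle_param m0 zc.
  have [_ _ wa _ pw] := poly fk; have [uv _] := wa j.
  have t01 : itv01 t by rewrite itv01E t0 ltW.
  set u := w (fc k) j in uv; set v := w (fc k) j.+1 in uv.
  have xE : phi (fc k) z = earc u v t by rewrite zE pw.
  have t00 : t != 0 by apply/eqP => t00; apply: (nv u); rewrite xE t00 earc0.
  have [i1 [j1 [i2 [j2 uvS]]]] := wi_two_sided uv.
  have sk : side wi k j u v by apply/sideP; left.
  have [i1Y i2Y] : i1 \in Y /\ i2 \in Y.
    have := bY _ _ _ _ _ _ uvS.
    by case: (sides_face mi_gt2 wi_periodic uvS sk) => <-; rewrite kY => h; split=> //; rewrite -?h// h.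
  have [_ [l1 l2] s1 s2 n12] := sides_chart uvS.
  have [f [fC _ _]] := edge_chart poly (fcF i1) (fcF i2) l1 l2 s1 s2 n12.
  have [_ _ fg fu fl] := fC.
  exists (f @` odisk); split; first exact: chart_open fC.
    exists (2 * t - 1, 0).
      rewrite /open_disk/= expr0n/= addr0.
      have t0' : 0 < t by rewrite lt_neqAle eq_sym t00.
      nra.
    rewrite fg; last by apply/andP; split; lra.
    by rewrite xE /arcg; congr earc; field.
  move=> _ [y oy <-]; have yd := odisk_cdisk oy.
  have [y0|y0|y0] := ltrgt0P y.2.
  - exact/(fKY _ i1Y)/fu.
  - exact/(fKY _ i2Y)/fl.
  - have y1 : -1 <= y.1 <= 1 by case: (disk_bound yd).
    have [e _ he] := side_arc poly (fcF i1) s1.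
    rewrite [y]surjective_pairing y0 fg// -he//; exists i1 => //.
    exists (circle_point (side_mid R m (fc i1) j1 + side_len R m (fc i1) * (e * y.1))) => //.
    exact/circle_cdisk/circle_pointP.
have opnP x : KY x -> (forall v : G, x <> vpoint v) -> nbhs (del x) PY.
  move=> Kx nv; have [N [oN Nx NK]] := opn x Kx nv.
  have ND : N `<=` delta @` cdisk by move=> y /NK/KYD.
  have oW := invariance_of_domain_inverse hH hL (@compact_cdisk R) dc dI oN ND.
  have [dx xd] := deltaK (KYD _ Kx).
  have : nbhs (del x) (cdisk `&` delta @^-1` N).
    by apply: open_nbhs_nbhs; split=> //; split=> //; rewrite /= dx.
  by apply: filterS => y [yd Ny]; exists (delta y); [exact: NK|exact: delK].
pose q := del (phi (fc i) 0).
have q0 : KY (phi (fc i) 0) by exists i => //; exists 0 => //; exact/odisk_cdisk/odisk0.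
have [dq qd] := deltaK (KYD _ q0).
(* Slopes from [q] towards the vertices. The ray gets the slope [s], larger than all of them, so it
   meets no vertex in the union. *)
pose sl (v : G) : R := ((del (vpoint v)).2 - q.2) / ((del (vpoint v)).1 - q.1).
pose s : R := 1 + \sum_(v : G) `|sl v|.
have sls v : sl v < s.
  rewrite /s (bigD1 v)//= (le_lt_trans (ler_norm _))//.
  rewrite addrCA ltrDl (lt_le_trans ltr01)// lerDl sumr_ge0// => *; exact: normr_ge0.
pose l (t : R) : plane := q + t *: ((1, s) : plane).
have lc : cont_on setT l.
  apply: cont_on_addp; first exact: cont_on_cst.
  by apply: cont_on_scalep; [exact: cont_on_id|exact: cont_on_cst].
have nv (t : R) (v : G) : 0 <= t -> PY (l t) -> delta (l t) <> vpoint v.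
  move=> t0 lP dv; have lE : l t = del (vpoint v) by rewrite -dv delK//; exact: PYd.
  have [t00|t00] := eqVneq t 0.
    have := phi_face poly (fcF i) (@odisk0 R).
    have -> : phi (fc i) 0 = vpoint v by rewrite -dv t00 /l scale0r addr0 /q dq.
    by move=> /(face_nograph (fcF i)); apply; left; exists v.
  have := sls v; rewrite /sl -lE /l /= -[t *: s]/(t * s) -[t *: 1]/(t * 1).
  by rewrite mulr1 addrAC subrr add0r addrAC subrr add0r mulrAC divff// mul1r ltxx.
(* At parameter 3 the abscissa has grown by 3, more than the width of the unit disk. *)
have all3 : PY (l 3).
  apply: (@connected_locally_constant _ [set t : R | 0 <= t] (fun t => PY (l t)) _ _ 0 3) => //=.
  - apply/connected_intervalP => a b /= a0 b0 z /andP[az zb]; exact: le_trans az.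
  - move=> t /= t0; have [lP|nlP] := pselect (PY (l t)).
      have [x Kx xl] := lP; have [dx _] := deltaK (KYD _ Kx).
      have nvx (v : G) : x <> vpoint v by rewrite -dx xl; exact: nv.
      have := opnP x Kx nvx; rewrite xl => /(cont_on_near lc I).
      by apply: filterS => y /(_ I) h _; split.
    have := cont_on_near lc I (open_nbhs_nbhs (conj (closed_openC cPY) nlP)).
    by apply: filterS => y /(_ I) h _; split.
  - by rewrite /l scale0r addr0; exists (phi (fc i) 0).
have [/andP[_ h3] _] := disk_bound (PYd _ all3).
have [/andP[h1 _] _] := disk_bound qd.
move: h3; rewrite /l /= -[_ *: _]/(_ * _) -/q in h1 *; lra.
Qed.

(** The disk is the region to which [interior_empty] applies; the regions of the 3-cycles through
    its inner vertices come from [odd_region]. *)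
Lemma disk_facial : (forall x : G, exists y, adj x y) ->
  (forall x y : G, adj x y -> ~ contractible_pair adjG mi wi x y) -> facial mi wi C0.
Proof.
move=> nbr nc.
have DI : disk_vertices = finset.set0.
  apply: (interior_empty (@adj_sym _ _ G) (@adj_irr _ _ G) mi_gt2 wi_periodic wi_adj1
    wi_adj2 wi_two_sided wi_corner disk_balanced disk_region) => //.
  move=> x C /disk_verticesP Dx tC xC.
  (* The edges at the inner vertex [x] stay in the disk. So does the third edge [y z]: one of its
     ends is inner, or both are on [C0] and it is an edge of [C0]. *)
  have CD : cycle_set C `<=` D.
    have [y [z [xy xz yz CE]]] := triangle_edge (@adj_sym _ _ G) tC xC.
    have [xyD _] := edge_in_D Dx xy; have [xzD _] := edge_in_D Dx xz.
    rewrite CE cyc_triangle// => p [/xyD//|[/xzD//|]].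
    have [_ vy] := edge_vertex xy; have [_ vz] := edge_vertex xz.
    have [Dy|y0] := D_split (xyD _ vy).
      by have [yzD _] := edge_in_D Dy yz; exact: yzD.
    have [Dz|z0] := D_split (xzD _ vz).
      by rewrite edgeC//; have [zyD _] := edge_in_D Dz (etrans (@adj_sym _ _ G z y) yz); exact: zyD.
    move=> pe; apply: cycD; exists y, z; split=> //; exact: cyc_vertex.
  exists (odd_faces C), (odd_vertices C); split; first exact: odd_region.
    by apply/fintype.subsetP => i; rewrite inE => /asboolP[iD _]; exact/disk_facesP.
  by apply/fintype.subsetP => y; rewrite inE => /and3P[_ /asboolP Dy _]; exact/disk_verticesP.
apply: (empty_region_facial (@adj_sym _ _ G) (@adj_irr _ _ G) mi_gt2 wi_periodic wi_adj1
    wi_adj2 wi_two_sided (X := disk_faces)).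
by rewrite -DI; exact: disk_region.
Qed.

End Disk.

(** * Three-cycles *)

Section ThreeCycles.
Variables (R : realType) (S : topologicalType) (G : embedded_graph R S).
Local Notation adjG := (@adj R S G).

Lemma ord3P (i : 'I_3) :
  [\/ i = ord0, i = ordS ord0 | i = ordS (ordS ord0)].
Proof.
by case: i => [[|[|[|//]]] h]; [apply: Or31|apply: Or32|apply: Or33]; exact: val_inj.
Qed.

Lemma walk_set3 (w : 'I_3 -> G) : closed_walk w ->
  triangle adjG [set w ord0; w (ordS ord0); w (ordS (ordS ord0))]%SET /\
  walk_set w = cycle_set [set w ord0; w (ordS ord0); w (ordS (ordS ord0))]%SET.
Proof.
move=> cw; have a1 := cw ord0; have a2 := cw (ordS ord0).
have a3 := cw (ordS (ordS ord0)); rewrite ordS3 in a3.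
have a3' : adjG (w ord0) (w (ordS (ordS ord0))) by rewrite adj_sym.
split; first by exists (w ord0), (w (ordS ord0)), (w (ordS (ordS ord0))).
rewrite cyc_triangle//; apply/seteqP; split=> x.
  move=> [i _]; case: (ord3P i) => ->; rewrite ?ordS3 => xe.
  - by left.
  - by right; right.
  - by right; left; rewrite edgeC.
move=> [xe|[xe|xe]]; [exists ord0|exists (ordS (ordS ord0))|exists (ordS ord0)] => //.
by rewrite ordS3 edgeC.
Qed.

Lemma triangle_three_cycle (C : {set G}) : triangle adjG C -> three_cycle G (cycle_set C).
Proof.
move=> [a [b [c [ab bc ac ->]]]].
pose w (i : 'I_3) : G := nth a [:: a; b; c] i.
have cw : closed_walk w.
  by move=> i; case: (ord3P i) => ->; rewrite /w//=; rewrite adj_sym.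
by exists w => //; have [_ ->] := walk_set3 cw.
Qed.

Lemma three_cycle_triangle (C : set S) : three_cycle G C ->
  exists2 T : {set G}, triangle adjG T & C = cycle_set T.
Proof.
move=> [w cw ->]; have [tT ->] := walk_set3 cw.
by exists [set w ord0; w (ordS ord0); w (ordS (ordS ord0))]%SET.
Qed.

Lemma edge_cyc (T : {set G}) (u v : G) : adj u v ->
  edge u v `<=` cycle_set T <-> (u \in T) && (v \in T).
Proof.
move=> uv; split=> [h|/andP[uT vT] x xe]; last by exists u, v.
apply: (cyc_interior uv (mid_interior u v)); apply: h.
exact/interior_edge_edge/mid_interior.
Qed.

Lemma triangle_card (C : {set G}) : triangle adjG C -> #|C| = 3%N.
Proof.
move=> [a [b [c [ab bc ac ->]]]]; rewrite -finset.setUA !cardsU1 cards1 !inE.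
have [/eqP/negbTE-> /eqP/negbTE-> /eqP/negbTE->] // :=
  And3 (adj_neqG ab) (adj_neqG ac) (adj_neqG bc).
Qed.

Lemma cyc_inj (C T : {set G}) : triangle adjG C -> triangle adjG T ->
  cycle_set C = cycle_set T -> C = T.
Proof.
move=> tC tT e; apply/eqP; rewrite eqEcard (triangle_card tC) (triangle_card tT) leqnn andbT.
by apply/fintype.subsetP => x xC; apply: cyc_vertex; rewrite -e; exact: vertex_cyc.
Qed.

End ThreeCycles.

(** * Rotations and reflections of the disk *)

Section Isometry.
Variable R : realType.
Local Notation plane := (R * R)%type.

(** The rotation by the angle [a], preceded for [e = -1] by the reflection in the horizontal
    axis. *)
Definition plane_isom (a e : R) (z : plane) : plane :=
  (z.1 * cos a - e * z.2 * sin a, z.1 * sin a + e * z.2 * cos a).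

Lemma norm2_isometry a e z : e ^+ 2 = 1 -> norm2 (plane_isom a e z) = norm2 z.
Proof.
move=> e2; rewrite /norm2/=.
transitivity ((z.1 ^+ 2 + e ^+ 2 * z.2 ^+ 2) * (cos a ^+ 2 + sin a ^+ 2)); first by ring.
by rewrite cos2Dsin2 e2 mulr1 mul1r.
Qed.

Lemma isometryK a e z : e ^+ 2 = 1 ->
  plane_isom a e (z.1 * cos a + z.2 * sin a, e * (z.2 * cos a - z.1 * sin a)) = z.
Proof.
move=> e2; rewrite /plane_isom/= [RHS]surjective_pairing; congr pair.
  transitivity (z.1 * (cos a ^+ 2 + e ^+ 2 * sin a ^+ 2) + (1 - e ^+ 2) * (z.2 * cos a * sin a)); first by ring.
  by rewrite e2 mul1r cos2Dsin2 subrr mul0r mulr1 addr0.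
transitivity (z.2 * (sin a ^+ 2 + e ^+ 2 * cos a ^+ 2) + (1 - e ^+ 2) * (z.1 * cos a * sin a)); first by ring.
by rewrite e2 mul1r addrC subrr mul0r add0r addrC cos2Dsin2 mulr1.
Qed.

Lemma isometry_inj a e z z' : e ^+ 2 = 1 -> plane_isom a e z = plane_isom a e z' -> z = z'.
Proof.
move=> e2 h; apply/eqP; rewrite -subr_eq0; apply/eqP/norm2_eq0.
rewrite -(norm2_isometry a _ e2).
have -> : plane_isom a e (z - z') = plane_isom a e z - plane_isom a e z'.
  by rewrite [RHS]surjective_pairing /plane_isom/=; congr pair; ring.
by rewrite h subrr /norm2/= expr0n/= addr0.
Qed.

Lemma cont_on_isometry A a e : cont_on A (plane_isom a e).
Proof.
have z1 : cont_on A (fun z : plane => z.1) by apply: cont_on_fst; exact: cont_on_id.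
have z2 : cont_on A (fun z : plane => z.2) by apply: cont_on_snd; exact: cont_on_id.
by apply: cont_on_pair; [apply: cont_onB|apply: cont_onD];
  do ?[apply: cont_onM|exact: cont_on_cst|exact: z1|exact: z2].
Qed.

Lemma isometry_circle_point (k e s : R) : e = 1 \/ e = -1 ->
  plane_isom (2 * pi * k) e (circle_point s) = circle_point (k + e * s).
Proof.
rewrite /plane_isom /circle_point/=; case=> ->.
  by rewrite !mul1r [2 * pi * (k + s)]mulrDr cosD sinD; congr pair; ring.
by rewrite !mulN1r [2 * pi * (k - s)]mulrBr cosB sinB; congr pair; ring.
Qed.

End Isometry.

(** * Two triangular faces with the same boundary *)

Section Twins.
Variables (R : realType) (S : topologicalType) (G : embedded_graph R S).
Local Notation plane := (R * R)%type.
Local Notation odisk := (@open_disk R).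
Local Notation cdisk := (@closed_disk R).
Local Notation circle := (@unit_circle R).
Local Notation adjG := (@adj R S G).
Hypotheses (hH : hausdorff_space S) (hL : locally_disk R S).
Variables (m : set S -> nat) (w : set S -> nat -> G) (phi : set S -> plane -> S).
Hypothesis poly : forall F, face G F -> polygon F (m F) (w F) (phi F).
Variables (FT : finType) (fc : FT -> set S).
Hypotheses (fcF : forall i, face G (fc i)) (fc_inj : injective fc).
Hypothesis fc_surj : forall F, face G F -> exists i, fc i = F.
Hypothesis conn : forall u v : G, connect adjG u v.

Let mi i := m (fc i).
Let wi i := w (fc i).
Let mi2 : forall i, (2 < mi i)%N := mi_gt2 poly fcF.
Let wip : forall i j, wi i (j + mi i)%N = wi i j := wi_periodic poly fcF.
Let wi1 : forall i j, adjG (wi i j) (wi i j.+1) := wi_adj1 poly fcF.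
Let wi2 : forall i j, adjG (wi i j) (wi i j.+2) := wi_adj2 poly fcF.

Variables a b : FT.
Hypotheses (ab : a != b) (ma : mi a = 3%N) (mb : mi b = 3%N).
Hypothesis vab : vset wi a = vset wi b.

Lemma vset_next i (p : G) : mi i = 3%N -> p \in vset wi i -> exists j, wi i j.+1 = p.
Proof.
move=> m3; rewrite (vset3 wip 1 m3) => /in_set3[] ->; [by exists 0%N|by exists 1%N|by exists 2%N].
Qed.

(** The two faces have the same corner at [p], so the neighbours of [p] are the other two vertices
    of the triangle. *)
Lemma twin_closed (p y : G) : p \in vset wi a -> adj p y -> y \in vset wi a.
Proof.
move=> pC py; have [j1 e1] := vset_next ma pC.
have [j2 e2] : exists j, wi b j.+1 = p by apply: vset_next => //; rewrite -vab.
have in2 (z : G) : z \in vset wi a -> z <> p -> z = wi b j2 \/ z = wi b j2.+2.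
  rewrite vab (vset3 wip j2 mb) e2 => /in_set3[] ->; [by left| |by right].
  by case.
have vaE := vset3 wip j1 ma.
have z1 : wi a j1 \in vset wi a by rewrite vaE !inE eqxx.
have z3 : wi a j1.+2 \in vset wi a by rewrite vaE !inE eqxx orbT.
have n13 := adj_neqG (wi2 a j1).
have n1 : wi a j1 <> p by rewrite -e1; exact/adj_neqG/wi1.
have n3 : wi a j1.+2 <> p by rewrite -e1 => /esym; exact/adj_neqG/wi1.
have wab : wi a j1 = wi b j2 /\ wi a j1.+2 = wi b j2.+2 \/
           wi a j1 = wi b j2.+2 /\ wi a j1.+2 = wi b j2.
  have [h1|h1] := in2 _ z1 n1; have [h3|h3] := in2 _ z3 n3.
  - by case: n13; rewrite h1 h3.
  - by left.
  - by right.
  - by case: n13; rewrite h1 h3.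
have pe : wi a j1.+1 = wi b j2.+1 by rewrite e1 e2.
have py' : adjG (wi a j1.+1) y by rewrite e1.
by have [->|->] := wi_corner hL poly fcF fc_inj ab pe wab py'.
Qed.

Lemma twin_all (y : G) : y \in vset wi a.
Proof.
have /connectP[p] := conn (wi a 0) y.
have : wi a 0 \in vset wi a by rewrite !inE eqxx.
elim: p (wi a 0) => [|z p ih] x xC /=; first by move=> _ ->.
by move=> /andP[xz pz]; apply: ih => //; exact: twin_closed xz.
Qed.

Lemma twin_card : #|G| = 3%N.
Proof.
have tC : triangle adjG (vset wi a).
  by have := walk_triangle wi1 wi2 a 0.
rewrite -(triangle_card tC) -cardsT; congr #|pred_of_set _|.
by apply/setP => x; rewrite inE twin_all.
Qed.

(** Every edge joins two of the three vertices, so its two sides are taken by [a] and [b]. *)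
Lemma twin_faces_all F : face G F -> F = fc a \/ F = fc b.
Proof.
move=> /fc_surj[i <-]; pose u := wi i 0; pose v := wi i 1.
have uv : adjG u v by exact: wi1.
have [i1 [j1 [i2 [j2 uvS]]]] := wi_two_sided hH hL poly fcF fc_inj fc_surj uv.
have nuv : u != v by apply/eqP; exact: adj_neqG.
have [ja sa] := vset_side wip ma nuv (twin_all u) (twin_all v).
have [jb sb] : exists j, side wi b j u v by apply: (vset_side wip) => //; rewrite -vab twin_all.
have si : side wi i 0 u v by rewrite /side !eqxx.
have ha := sides_face mi2 wip uvS sa; have hb := sides_face mi2 wip uvS sb.
have hi := sides_face mi2 wip uvS si.
case: ha => ea; case: hb => eb; case: hi => ei; rewrite ei -?ea -?eb;
  try (by left); try (by right); by move: ab; rewrite ea eb eqxx.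
Qed.

Lemma walk3_inj i j k : mi i = 3%N -> (j < 3)%N -> (k < 3)%N -> wi i j = wi i k -> j = k.
Proof.
move=> m3.
have n01 := adj_neqG (wi1 i 0); have n12 := adj_neqG (wi1 i 1).
have n02 := adj_neqG (wi2 i 0).
by case: j => [|[|[|//]]] _; case: k => [|[|[|//]]] _ //= e; (exfalso; (by apply: n01; rewrite e) || (by apply: n12; rewrite e) || (by apply: n02; rewrite e)).
Qed.

Lemma walk3_mod i j : mi i = 3%N -> wi i (j %% 3)%N = wi i j.
Proof. by move=> m3; rewrite -m3; exact: (w_modn wip). Qed.

(** The three sides of a triangular face are different edges, so the closed face is embedded and its
    two halves can be glued into a sphere. *)
Lemma polygon3_inj i : mi i = 3%N -> inj_on cdisk (phi (fc i)).
Proof.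
move=> m3; have fi := fcF i; have [_ _ _ _ pw] := poly fi.
have m0 : (0 < m (fc i))%N by rewrite -/(mi i) m3.
have cir z : cdisk z -> ~ odisk z -> circle z.
  move=> zd nz; rewrite /unit_circle/=; apply/eqP; rewrite eq_le [_ <= 1]zd leNgt.
  by apply/negP => oz; apply: nz.
have cG z : circle z -> graph_set G (phi (fc i) z).
  move=> zc; have [j [t [jm /andP[t0 t1] ->]]] := circle_param m0 zc.
  rewrite pw; last by rewrite itv01E t0 ltW.
  by apply: earc_graph; [exact: wi1|rewrite itv01E t0 ltW].
have cI z z' : circle z -> circle z' -> phi (fc i) z = phi (fc i) z' -> z = z'.
  move=> zc z'c.
  have [j [t [jm /andP[t0 t1] ->]]] := circle_param m0 zc.
  have [k [s [km /andP[s0 s1] ->]]] := circle_param m0 z'c.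
  have t01 : itv01 t by rewrite itv01E t0 ltW.
  have s01 : itv01 s by rewrite itv01E s0 ltW.
  rewrite !pw// -/(wi i _) => e; rewrite -/(mi i) m3 in jm km.
  suff [-> ->] : j = k /\ t = s by [].
  have aj := wi1 i j; have ak := wi1 i k.
  have [t00|t00] := eqVneq t 0.
    move: (e); rewrite t00 earc0//.
    move=> /esym/(earc_vpoint ak s01)[[-> /(walk3_inj m3 jm km)->]//|[s1' _]].
    by rewrite s1' ltxx in s1.
  have [s00|s00] := eqVneq s 0.
    move: (e); rewrite s00 earc0//.
    move=> /(earc_vpoint aj t01)[[t00' _]|[t1' _]]; first by rewrite t00' eqxx in t00.
    by rewrite t1' ltxx in t1.
  have tI : t \in `]0, 1[ by rewrite in_itv/= lt_neqAle eq_sym t00 t0.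
  have sI : s \in `]0, 1[ by rewrite in_itv/= lt_neqAle eq_sym s00 s0.
  have [[kj _]|[kj kj1]] := earc_disjoint aj ak tI sI e.
    have jk := walk3_inj m3 km jm kj; rewrite jk in e; split=> //.
    by apply: (earc_inj aj) e; rewrite in_itv/= -itv01E.
  exfalso; rewrite -(walk3_mod _ m3) in kj1; rewrite -[RHS](walk3_mod _ m3) in kj.
  have := walk3_inj m3 km (ltn_pmod _ (isT : 0 < 3)%N) kj.
  have := walk3_inj m3 (ltn_pmod _ (isT : 0 < 3)%N) jm kj1.
  by move: jm km; case: (j) => [|[|[|//]]] _; case: (k) => [|[|[|//]]].
move=> z z' zd z'd e.
have [oz|nz] := pselect (odisk z); have [oz'|nz'] := pselect (odisk z').
- exact: (phi_inj poly fi) e.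
- by have := phi_face poly fi oz; rewrite e => /(face_nograph fi); case; apply/cG/cir.
- by have := phi_face poly fi oz'; rewrite -e => /(face_nograph fi); case; apply/cG/cir.
- by apply: cI => //; exact: cir.
Qed.

(** Two walks around one triangle differ by a shift, or by a shift and a reversal; modulo 3, going
    back by [j] is going forward by [2 * j]. *)
Lemma twin_match : exists k, (forall j, wi b (k + j)%N = wi a j) \/
  (forall j, wi b (k + 2 * j)%N = wi a j).
Proof.
have a0 : wi a 0 \in vset wi b by rewrite -vab !inE eqxx.
have [k ek] := vset_next mb a0; exists k.+1.
have per i j : mi i = 3%N -> wi i j.+3 = wi i j by move=> m3; rewrite -addn3 -m3 wip.
have inb (z : G) : z \in vset wi a -> [\/ z = wi b k.+1, z = wi b k.+2 | z = wi b k.+3].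
  by rewrite vab (vset3 wip k.+1 mb) => /in_set3.
have a1 : wi a 1 \in vset wi a by rewrite !inE eqxx orbT.
have a2 : wi a 2 \in vset wi a by rewrite !inE eqxx orbT.
have n01 := adj_neqG (wi1 a 0); have n12 := adj_neqG (wi1 a 1); have n02 := adj_neqG (wi2 a 0).
have step (P : nat -> nat) : wi b (P 0%N) = wi a 0 -> wi b (P 1%N) = wi a 1 -> wi b (P 2%N) = wi a 2 ->
    (forall j, wi b (P j.+3) = wi b (P j)) -> forall j, wi b (P j) = wi a j.
  move=> p0 p1 p2 pp j.
  suff : [/\ wi b (P j) = wi a j, wi b (P j.+1) = wi a j.+1 & wi b (P j.+2) = wi a j.+2] by case.
  by elim: j => [|j [h1 h2 h3]]; split=> //; rewrite pp per.
case: (inb _ a1) => e1; first by case: n01; rewrite e1 ek.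
  case: (inb _ a2) => e2; first by case: n02; rewrite e2 ek.
    by case: n12; rewrite e1 e2.
  left; apply: (step (fun j => k.+1 + j)%N); rewrite ?addn0 ?addn1 ?addn2//.
  by move=> j; rewrite !addnS per.
case: (inb _ a2) => e2; first by case: n02; rewrite e2 ek.
  right; apply: (step (fun j => k.+1 + 2 * j)%N); rewrite ?muln0 ?addn0 ?muln1 ?addn2//.
    by rewrite -[RHS]/(wi a 2) e2 !addnS addn0 per.
  by move=> j; rewrite !mulnS !addnA !addn2 !per.
by case: n12; rewrite e1 e2.
Qed.

(** Both boundary maps run through the edges by [earc] on thirds of the circle, so a shift of the
    walk is a rotation and a reversal is a reflection. *)
Lemma twin_isometry : exists t e : R, [/\ e ^+ 2 = 1 & forall c, circle c ->
  phi (fc b) (plane_isom t e c) = phi (fc a) c].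
Proof.
have [_ _ _ _ pa] := poly (fcF a); have [_ _ _ _ pb] := poly (fcF b).
rewrite -/(mi a) ma in pa; rewrite -/(mi b) mb in pb.
have [k km] := twin_match.
have par c : circle c -> exists j (t : R), itv01 t /\ c = circle_point ((j%:R + t) / 3).
  move=> /(circle_param (isT : 0 < 3)%N)[j [t [_ /andP[t0 t1] ->]]].
  by exists j, t; rewrite itv01E t0 ltW.
case: km => km.
  exists (2 * pi * (k%:R / 3)), 1; split; first by rewrite expr1n.
  move=> _ /par[j [t [t01 ->]]]; rewrite isometry_circle_point; last by left.
  have -> : k%:R / 3 + 1 * ((j%:R + t) / 3) = ((k + j)%:R + t) / 3 by rewrite natrD; field.
  by rewrite pa// pb// -addnS; congr earc; exact: km.
exists (2 * pi * (k%:R / 3)), (-1); split; first by rewrite sqrrN expr1n.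
move=> _ /par[j [t [t01 ->]]]; rewrite isometry_circle_point; last by right.
(* Adding [j.+1] whole turns makes the index of the side a natural number. *)
rewrite -(circle_pointDn _ j.+1).
have -> : k%:R / 3 + -1 * ((j%:R + t) / 3) + j.+1%:R = ((k + 2 * j.+1)%:R + (1 - t)) / 3 :> R.
  by rewrite natrD natrM -natr1; field.
have t01' : itv01 (1 - t).
  by move: t01; rewrite !itv01E => /andP[? ?]; apply/andP; split; lra.
rewrite pa// pb// -/(wi b _) -/(wi b _) -/(wi a _) -/(wi a _).
have -> : wi b (k + 2 * j.+1)%N = wi a j.+1 by exact: km.
have -> : wi b (k + 2 * j.+1).+1 = wi a j.
  by rewrite -(km j) mulnS addnA addn2 -[RHS]wip mb addn3 !addSn.
have aj : adjG (wi a j.+1) (wi a j) by rewrite adj_sym; exact: wi1.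
by rewrite (earc_rev aj).
Qed.

(** The two hemispheres, projected to the disk, are mapped onto the two closed faces; the isometry
    makes the maps agree on the equator. *)
Lemma twin_sphere : sphere R S.
Proof.
have fa := fcF a; have fb := fcF b.
have [t [e [e2 iso]]] := twin_isometry.
pose space := (plane * R)%type.
pose psi z := phi (fc b) (plane_isom t e z).
have isod z : cdisk z -> cdisk (plane_isom t e z).
  by move=> zd; have := norm2_isometry t z e2; rewrite /norm2 /closed_disk/= => ->.
have isoo z : odisk z -> odisk (plane_isom t e z).
  by move=> zd; have := norm2_isometry t z e2; rewrite /norm2 /open_disk/= => ->.
have psic : cont_on cdisk psi.
  by apply: (@cont_on_comp _ _ _ _ cdisk) => //; [exact: cont_on_isometry|exact: (phi_cont poly)].
pose f (p : space) := if 0 <= p.2 then phi (fc a) p.1 else psi p.1.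
pose sph := @unit_sphere R.
have sphE p : sph p = (norm2 p.1 + p.2 ^+ 2 = 1) by [].
have sd (p : space) : sph p -> cdisk p.1.
  by rewrite sphE /closed_disk/= -/(norm2 p.1) => h; have := sqr_ge0 p.2; lra.
have so (p : space) : sph p -> p.2 != 0 -> odisk p.1.
  rewrite sphE /open_disk/= -/(norm2 p.1) => h p2.
  have : 0 < p.2 ^+ 2 by rewrite exprn_even_gt0.
  lra.
have sc (p : space) : sph p -> p.2 = 0 -> circle p.1.
  by rewrite sphE /unit_circle/= -/(norm2 p.1) => h p2; move: h; rewrite p2 expr0n/= addr0.
have p1c A : cont_on A (fun p : space => p.1) by apply: cont_on_fst; exact: cont_on_id.
have p2c A : cont_on A (fun p : space => p.2) by apply: cont_on_snd; exact: cont_on_id.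
have nc : cont_on setT (fun p : space => norm2 p.1 + p.2 ^+ 2).
  by apply: cont_onD; [exact: cont_on_norm2|exact: cont_onX].
have closedP (h : space -> R) (A : set R) : cont_on setT h -> closed A -> closed (h @^-1` A).
  move=> hcont cA; rewrite -[X in closed X]setCK; apply: open_closedC.
  by have := cont_on_open openT hcont (closed_openC cA); rewrite setTI preimage_setC.
have clS : closed sph by exact: (closedP _ _ nc (@closed_eq R 1)).
have cS : compact sph.
  apply: (@subclosed_compact _ _ (cdisk `*` [set` `[-1 : R, 1]])) => //.
    by apply: compact_setX; [exact: compact_cdisk|exact: segment_compact].
  move=> p ps; split; first exact: sd.
  move: ps; rewrite sphE => ps; have := norm2_ge0 p.1 => n0.
  by rewrite /= in_itv/=; apply/andP; split; nra.
pose up := sph `&` [set p : space | 0 <= p.2].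
pose lo := sph `&` [set p : space | p.2 <= 0].
have clup : closed up by apply: closedI => //; exact: (closedP _ _ (p2c _) (@closed_ge R 0)).
have cllo : closed lo by apply: closedI => //; exact: (closedP _ _ (p2c _) (@closed_le R 0)).
have fup p : up p -> f p = phi (fc a) p.1 by move=> [_ /= p0]; rewrite /f p0.
have flo p : lo p -> f p = psi p.1.
  move=> [ps /= p0]; rewrite /f; case: ifPn => // p0'.
  have p2 : p.2 = 0 by apply/eqP; rewrite eq_le p0 p0'.
  by rewrite /psi iso//; exact: sc.
have fcont : cont_on sph f.
  have -> : sph = up `|` lo.
    apply/seteqP; split=> [p ps|p [[]//|[]//]].
    by have [p0|/ltW p0] := leP 0 p.2; [left|right].
  apply: cont_onU => //.
    apply: (@eq_cont_on _ _ _ (fun p => phi (fc a) p.1)) => [p pu|]; first by rewrite fup.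
    by apply: (@cont_on_comp _ _ _ _ cdisk) => //; [move=> p [/sd]|exact: (phi_cont poly)].
  apply: (@eq_cont_on _ _ _ (fun p => psi p.1)) => [p pl|]; first by rewrite flo.
  by apply: (@cont_on_comp _ _ _ _ cdisk) => // p [/sd].
have psib z : odisk z -> (fc b) (psi z) by move=> /isoo oz; exact: (phi_face poly).
have nab x : fc a x -> fc b x -> False.
  by move=> xa xb; have /fc_inj e' := face_eq fa fb xa xb; move: (ab); rewrite e' eqxx.
have anb z : cdisk z -> ~ fc b (phi (fc a) z).
  move=> zd; have [oz|nz] := ltP (norm2 z) 1; first by apply: nab; exact: (phi_face poly).
  have zc : circle z by rewrite /unit_circle/=; apply/eqP; rewrite eq_le [_ <= 1]zd.
  have m0 : (0 < m (fc a))%N by rewrite -/(mi a) ma.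
  have [_ _ wa _ pa] := poly fa.
  have [j [s [_ /andP[s0 s1] ->]]] := circle_param m0 zc.
  have s01 : itv01 s by rewrite itv01E s0 ltW.
  rewrite pa// => /(face_nograph fb); apply; apply: earc_graph => //.
  by case: (wa j).
have fI : inj_on sph f.
  move=> p q ps qs; rewrite /f.
  have zq : p.1 = q.1 -> p.2 ^+ 2 = q.2 ^+ 2.
    by move=> pq; move: ps qs; rewrite !sphE pq => <- /addrI.
  have fin : p.1 = q.1 -> p.2 = q.2 -> p = q.
    by move=> h1 h2; rewrite [p]surjective_pairing [q]surjective_pairing h1 h2.
  case: (leP 0 p.2) => p0; case: (leP 0 q.2) => q0 h.
  - have pq := polygon3_inj ma (sd _ ps) (sd _ qs) h; apply: fin => //.
    by apply/eqP; rewrite -(@eqrXn2 _ 2)//; apply/eqP; exact: zq.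
  - case: (anb p.1 (sd _ ps)); rewrite h; apply: psib; apply: so => //; exact: ltr0_neq0.
  - case: (anb q.1 (sd _ qs)); rewrite -h; apply: psib; apply: so => //; exact: ltr0_neq0.
  - have op := so _ ps (ltr0_neq0 p0); have oq := so _ qs (ltr0_neq0 q0).
    have /(isometry_inj e2) pq := phi_inj poly fb (isoo _ op) (isoo _ oq) h.
    apply: fin => //; apply: oppr_inj; apply/eqP.
    by rewrite -(@eqrXn2 _ 2) ?oppr_ge0 ?(ltW p0) ?(ltW q0)// !sqrrN; apply/eqP; exact: zq.
have surj x : exists2 p, sph p & f p = x.
  have lift z : cdisk z -> exists2 p : space, up p & p.1 = z.
    move=> zd; exists (z, Num.sqrt (1 - norm2 z)) => //; split; last by rewrite /= sqrtr_ge0.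
    by rewrite sphE /= sqr_sqrtr ?subrKC// subr_ge0.
  have liftn z : cdisk z -> exists2 p : space, lo p & p.1 = z.
    move=> zd; exists (z, - Num.sqrt (1 - norm2 z)) => //; split; last by rewrite /= oppr_le0 sqrtr_ge0.
    by rewrite sphE /= sqrrN sqr_sqrtr ?subrKC// subr_ge0.
  have ina : (phi (fc a) @` cdisk) x -> exists2 p, sph p & f p = x.
    move=> [z zd <-]; have [p pu pz] := lift z zd.
    by exists p; [case: pu|rewrite fup// pz].
  have edges (u v : G) : adj u v -> edge u v x -> exists2 p, sph p & f p = x.
    move=> uv xe; apply: ina.
    have nuv : u != v by apply/eqP; exact: adj_neqG.
    have [j /(sideP w fc) sj] := vset_side wip ma nuv (twin_all u) (twin_all v).
    have [_ _ _ _ pw] := poly fa.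
    case: sj => -[eu ev].
      have [s s01 <-] := xe; exists (circle_point ((j%:R + s) / (m (fc a))%:R)).
        exact/circle_cdisk/circle_pointP.
      by rewrite pw// eu ev.
    rewrite edgeC// in xe; have [s s01 <-] := xe.
    exists (circle_point ((j%:R + s) / (m (fc a))%:R)); first exact/circle_cdisk/circle_pointP.
    by rewrite pw// eu ev.
  have [[[v _ vx]|[u [v [uv xe]]]]|nx] := pselect (graph_set G x).
  - have [y vy] : exists y, adjG v y.
      have [j ej] := vset_next ma (twin_all v).
      by exists (wi a j.+2); rewrite -ej; exact: wi1.
    by apply: (edges _ _ vy); rewrite -vx; case: (edge_vertex vy).
  - exact: edges uv xe.
  - have [F fF Fx] := face_cover nx; case: (twin_faces_all fF) => FE; rewrite FE in Fx.
      apply: ina; have : (phi (fc a) @` odisk) x by rewrite (phi_odisk poly fa).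
      by move=> [z oz <-]; exists z => //; exact: odisk_cdisk.
    have : (phi (fc b) @` odisk) x by rewrite (phi_odisk poly fb).
    move=> [z oz zx].
    pose z' : plane := (z.1 * cos t + z.2 * sin t, e * (z.2 * cos t - z.1 * sin t)).
    have z'E : plane_isom t e z' = z by exact: isometryK.
    have z'd : cdisk z'.
      rewrite /closed_disk/= -/(norm2 z') -(norm2_isometry t z' e2) z'E.
      exact: odisk_cdisk.
    have [p pl pz] := liftn z' z'd.
    by exists p; [case: pl|rewrite flo// pz /psi z'E].
have [g gf gc] := compact_inverse (0 : space) hH cS fcont fI.
have fT : f @` sph = [set: S].
  by apply/seteqP; split=> // x _; have [p ps px] := surj x; exists p.
exists g, f; split.
- by apply/cont_onP; rewrite -fT.
- exact/cont_onP.
- by move=> x _; have [p ps <-] := surj x; rewrite gf.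
- by move=> p ps; rewrite gf.
Qed.

End Twins.

(** * Contractible edges, and the proof of the theorem *)

Section Contract.
Variables (R : realType) (S : topologicalType) (G : embedded_graph R S).
Local Notation plane := (R * R)%type.
Local Notation adjG := (@adj R S G).
Variables (m : set S -> nat) (w : set S -> nat -> G) (phi : set S -> plane -> S).
Hypothesis poly : forall F, face G F -> polygon F (m F) (w F) (phi F).
Variables (FT : finType) (fc : FT -> set S).
Hypothesis fcF : forall i, face G (fc i).

Let mi i := m (fc i).
Let wi i := w (fc i).

Lemma facial_triangle (C : {set G}) : facial mi wi C -> triangle adjG C.
Proof.
move=> [i _ ->]; exact: (walk_triangle (wi_adj1 poly fcF) (wi_adj2 poly fcF) i 0).
Qed.

Lemma facial_bounds (C : {set G}) : facial mi wi C -> bounds_three_face G (cycle_set C).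
Proof.
move=> [i m3 ->]; have fi := fcF i.
have : polygon (fc i) 3 (w (fc i)) (phi (fc i)) by have := poly fi; rewrite -/(mi i) m3.
move=> /polygon_boundary_walk bw; have [cw _] := bw.
exists (fc i), (fun j : 'I_3 => w (fc i) j); split=> //.
by have [_ ->] := walk_set3 cw.
Qed.

Lemma contractible_pairP (x y : G) : adj x y -> contractible_pair adjG mi wi x y ->
  contractible x y.
Proof.
move=> xy [z1 [z2 [z12 f1 f2 only]]].
have t1 := facial_triangle f1; have t2 := facial_triangle f2.
exists (cycle_set [set x; y; z1]%SET), (cycle_set [set x; y; z2]%SET); split.
- move=> /(cyc_inj t1 t2) e; have : z1 \in [set x; y; z2]%SET by rewrite -e !inE eqxx orbT.
  have := triangle_card t1; move=> c1 /in_set3[z1x|z1y|/eqP].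
  + by move: c1; rewrite z1x finset.setUC finset.setUA finset.setUid cards2; case: (_ != _).
  + by move: c1; rewrite z1y -finset.setUA finset.setUid cards2; case: (_ != _).
  + exact/negP.
- apply/seteqP; split=> C.
    move=> [/three_cycle_triangle[T tT ->] /(edge_cyc T xy)/andP[xT yT]].
    by have [->|->] := only T tT xT yT; [left|right].
  by move=> [->|->]; (split; [exact: triangle_three_cycle|]);
    apply/(edge_cyc _ xy); rewrite !inE !eqxx ?orbT.
- exact: facial_bounds.
- exact: facial_bounds.
Qed.

End Contract.

Theorem theorem2 (R : realType) (S : topologicalType) (G : embedded_graph R S)
    (hS : surface R S) (hG : irreducible_map G)
    (hK3 : ~ (sphere R S /\ #|G| = 3%N)) :
  forall u v : G, adj u v -> essentially_noncontractible u v.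
Proof.
move=> u v uv; have [_ hH hL] := hS; have [[_ conn _] fi nc] := hG.
apply: contrapT => ness; apply: hK3.
have [m [w [phi poly]]] : exists (m : set S -> nat) (w : set S -> nat -> G)
    (phi : set S -> R * R -> S), forall F, face G F -> polygon F (m F) (w F) (phi F).
  have h F : exists d : nat * (nat -> G) * (R * R -> S),
      face G F -> polygon F d.1.1 d.1.2 d.2.
    (* Sets that are not faces get dummy data. *)
    have [fF|nF] := pselect (face G F); last by exists (0%N, fun=> u, fun=> vpoint u).
    by have [m [w [phi p]]] := face_polygon (fi F fF); exists (m, w, phi).
  have [d dP] := choice h.
  by exists (fun F => (d F).1.1), (fun F => (d F).1.2), (fun F => (d F).2).
have /finite_seqP[s sE] := faces_finite hL poly.
(* The faces are numbered without repetition, since the combinatorial part works over a finite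
   type. *)
pose FT := 'I_(size (undup s)).
pose fc (i : FT) : set S := nth set0 (undup s) i.
have memF F : (F \in undup s) <-> face G F.
  rewrite mem_undup; have -> : face G F = [set F | face G F] F by [].
  by rewrite sE.
have fcF i : face G (fc i) by apply/memF; exact: mem_nth.
have fc_inj : injective fc.
  move=> i j /eqP; rewrite nth_uniq ?undup_uniq// => /eqP; exact: val_inj.
have fc_surj F : face G F -> exists i, fc i = F.
  move=> /memF Fs; have Fi : (index F (undup s) < size (undup s))%N by rewrite index_mem.
  by exists (Ordinal Fi); rewrite /fc/= nth_index.
have nbr (x : G) : exists y, adj x y.
  have /connectP[[|y p] /= pp e] := conn x u; first by exists v; rewrite -e.
  by exists y; case/andP: pp.
pose mi i := m (fc i); pose wi i := w (fc i).
have ncp x y : adj x y -> ~ contractible_pair (@adj R S G) mi wi x y.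
  by move=> xy /(contractible_pairP poly fcF xy); exact: nc.
(* The assumption that [u v] is not essentially noncontractible makes every such 3-cycle bound a
   disk. *)
have fac (C : {set G}) : triangle (@adj R S G) C -> u \in C -> v \in C -> facial mi wi C.
  move=> tC uC vC.
  have : bounds_disk R (cycle_set C).
    apply: contrapT => nb; apply: ness; exists (cycle_set C); split=> //.
      exact: triangle_three_cycle.
    by apply/(edge_cyc _ uv); rewrite uC.
  move=> [delta [/cont_onP dc /inj_onP dI dC]].
  have [del delK delc] := compact_inverse (0 : R * R) hH (@compact_cdisk R) dc dI.
  exact: (disk_facial hH hL poly dc dI tC dC delK delc fcF fc_inj fc_surj nbr ncp).
have := facial_edge (@adj_sym _ _ G) (@adj_irr _ _ G) (mi_gt2 poly fcF)
  (wi_periodic poly fcF) (wi_adj1 poly fcF) (wi_adj2 poly fcF)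
  (wi_two_sided hH hL poly fcF fc_inj fc_surj) (wi_corner hL poly fcF fc_inj) uv fac.
case=> [/(ncp _ _ uv)//|[a [b [ab ma mb vab _]]]]; split.
  exact: (twin_sphere hH hL poly fcF fc_inj fc_surj conn ab ma mb vab).
exact: (twin_card hL poly fcF fc_inj conn ab ma mb vab).
Qed.
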